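(* Let $\mathcal{A} \subseteq \mathcal{B}$ be a unital $C^*$-inclusion. If $\dim(\mathcal{A}) < \infty$, then the following are equivalent: (i) $\mathcal{A} \subseteq \mathcal{B}$ has the pure extension property (PEP); (ii) $\mathcal{A} \subseteq \mathcal{B}$ has the almost extension property (AEP); (iii) $\mathcal{A} \subseteq \mathcal{B}$ is aperiodic; (iv) $\mathcal{A} \subseteq \mathcal{B}$ has a unique pseudo-expectation; (v) $\mathcal{A} \subseteq \mathcal{B}$ has a unique conditional expectation; (vi) $\mathcal{A}' \cap \mathcal{B} = Z(\mathcal{A})$. In particular, if $\dim(\mathcal{B}) = \infty$, then all these conditions are false.
   Context: A (unital) $C^*$-inclusion $\mathcal{A} \subseteq \mathcal{B}$ is an inclusion of unital $C^*$-algebras with $1_{\mathcal{B}} = 1_{\mathcal{A}}$. $Z(\mathcal{A}) = \mathcal{A}' \cap \mathcal{A}$ is the center, $\mathcal{A}' \cap \mathcal{B}$ is the relative commutant of $\mathcal{A}$ in $\mathcal{B}$, and $PS(\cdot)$ denotes the set of pure states. $I(\mathcal{A})$ is the (Hamana) injective envelope of $\mathcal{A}$: the unique minimal injective operator system containing $\mathcal{A}$, which is a $C^*$-algebra containing $\mathcal{A}$ as a $C^*$-subalgebra. ''ucp'' means unital completely positive. The inclusion $\mathcal{A} \subseteq \mathcal{B}$: - has the PEP if every $\phi \in PS(\mathcal{A})$ extends uniquely to a pure state of $\mathcal{B}$; - has the AEP if the set of pure states of $\mathcal{A}$ which extend uniquely to pure states of $\mathcal{B}$ is weak* dense in $PS(\mathcal{A})$;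 - is aperiodic if for every $b \in \mathcal{B}$, every non-zero hereditary $C^*$-subalgebra $\mathcal{D}$ of $\mathcal{A}$, and every $\varepsilon > 0$, there exist a positive $d \in \mathcal{D}$ with $\|d\| = 1$ and $a \in \mathcal{A}$ such that $\|dbd - a\| < \varepsilon$; - has a unique pseudo-expectation if there is exactly one ucp map $\Psi: \mathcal{B} \to I(\mathcal{A})$ with $\Psi(a) = a$ for all $a \in \mathcal{A}$; - has a unique conditional expectation if there is exactly one ucp map $E: \mathcal{B} \to \mathcal{A}$ with $E(a) = a$ for all $a \in \mathcal{A}$. *)

(* Defs.v *)
From HB Require Import structures.
From mathcomp Require Import all_boot all_order all_algebra.
From mathcomp Require Import all_classical all_reals all_analysis.
From mathcomp Require Import complex.

Set Implicit Arguments.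
Unset Strict Implicit.
Unset Printing Implicit Defensive.

Import Order.TTheory GRing.Theory Num.Theory.
Import numFieldNormedType.Exports.

Local Open Scope classical_set_scope.
Local Open Scope ring_scope.
Local Open Scope complex_scope.

(* Unital C*-algebras over R[i], with R : realType.  MathComp has no join of
   its rings with its normed modules, so the complete norm is carried by a
   separate real-valued function on an R[i]-algebra.  MathComp algebras are
   nontrivial (1 != 0).  In R[i], x <= y means that y - x is a nonnegative
   real. *)
HB.mixin Record isCStarAlgebra (R : realType) A of GRing.Algebra R[i] A := {
  star : A -> A ;
  cnorm : A -> R ;
  starK : involutive star ;
  starD : {morph star : x y / x + y} ;
  starZ : forall (c : R[i]) (x : A), star (c *: x) = c^* *: star x ;
  starM : forall x y : A, star (x * y) = star y * star x ;
  cnorm0_eq0 : forall x : A, cnorm x = 0 -> x = 0 ;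
  cnormD_le : forall x y : A, cnorm (x + y) <= cnorm x + cnorm y ;
  cnormZ : forall (c : R[i]) (x : A), (cnorm (c *: x))%:C = `|c| * (cnorm x)%:C ;
  cnormM_le : forall x y : A, cnorm (x * y) <= cnorm x * cnorm y ;
  cnorm_starM : forall x : A, cnorm (star x * x) = cnorm x ^+ 2 ;
  cnorm_complete : forall u : nat -> A,
    (forall eps : R, 0 < eps -> exists N : nat, forall m n : nat,
       (N <= m)%N -> (N <= n)%N -> cnorm (u m - u n) < eps) ->
    exists l : A, cnorm (u n - l) @[n --> \oo] --> (0 : R)
}.

#[short(type="cstarAlgType")]
HB.structure Definition CStarAlgebra (R : realType) :=
  {A of GRing.Algebra R[i] A & isCStarAlgebra R A}.

Definition finite_dim (K : fieldType) (V : lmodType K) : Prop :=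
  exists (n : nat) (e : 'I_n -> V),
    forall v : V, exists c : 'I_n -> K, v = \sum_(i < n) c i *: e i.

(* A C*-inclusion A ⊆ B is given by its inclusion map, a unital
   *-homomorphism A -> B through which A carries the norm of B. *)
Definition cstar_inclusion (R : realType) (A B : cstarAlgType R)
    (iota : {lrmorphism A -> B}) : Prop :=
  (forall a, iota (star a) = star (iota a)) /\ (forall a, cnorm (iota a) = cnorm a).

Section Positivity.
Context {R : realType} {A : cstarAlgType R}.

Definition cpos (x : A) : Prop := exists y : A, x = star y * y.

Definition mxstar m n (M : 'M[A]_(m, n)) : 'M[A]_(n, m) :=
  map_mx star M^T.

(* positive elements of the C*-algebra M_n(A) *)
Definition mxpos n (M : 'M[A]_n) : Prop :=
  exists Y : 'M[A]_n, M = mxstar Y *m Y.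

Definition is_state (phi : A -> R[i]) : Prop :=
  [/\ linear phi, (forall x, cpos x -> 0 <= phi x) & phi 1 = 1].

(* extreme points of the state space *)
Definition pure_state (phi : A -> R[i]) : Prop :=
  is_state phi /\
  forall (psi1 psi2 : A -> R[i]) (t : R),
    is_state psi1 -> is_state psi2 -> 0 < t < 1 ->
    (forall x, phi x = t%:C * psi1 x + (1 - t)%:C * psi2 x) ->
    psi1 = phi /\ psi2 = phi.

Definition norm_closed (D : set A) : Prop :=
  forall (u : nat -> A) (l : A), (forall n, D (u n)) ->
    cnorm (u n - l) @[n --> \oo] --> (0 : R) -> D l.

(* C*-subalgebras, not required to contain the unit of A *)
Definition cstar_subalg (D : set A) : Prop :=
  [/\ norm_closed D,
      D 0 /\ (forall (c : R[i]) x y, D x -> D y -> D (c *: x + y)),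
      (forall x y, D x -> D y -> D (x * y)) &
      (forall x, D x -> D (star x))].

Definition hereditary_subalg (D : set A) : Prop :=
  cstar_subalg D /\
  forall a d, D d -> cpos a -> cpos (d - a) -> D a.

Definition opsys (S : set A) : Prop :=
  [/\ S 1,
      (forall (c : R[i]) x y, S x -> S y -> S (c *: x + y)) &
      (forall x, S x -> S (star x))].

End Positivity.

Definition cstar_center (R : realType) (A : cstarAlgType R) : set A :=
  [set z | forall a, z * a = a * z].
Arguments cstar_center {R} A.

(* A ucp map between the operator systems V ⊆ B and E ⊆ C is represented by a
   function B -> C whose values outside V are irrelevant. *)
Definition ucp (R : realType) (B C : cstarAlgType R) (V : set B) (E : set C)
    (f : B -> C) : Prop :=
  [/\ (forall x, V x -> E (f x)),
      (forall (c : R[i]) x y, V x -> V y -> f (c *: x + y) = c *: f x + f y),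
      f 1 = 1 &
      (forall n (M : 'M[B]_n), (forall i j, V (M i j)) ->
         mxpos M -> mxpos (map_mx f M))].

(* injectivity in the category of operator systems and ucp maps *)
Definition injective_opsys (R : realType) (C : cstarAlgType R) (E : set C)
    : Prop :=
  opsys E /\
  forall (B : cstarAlgType R) (V W : set B) (f : B -> C),
    opsys V -> opsys W -> V `<=` W -> ucp V E f ->
    exists g : B -> C, ucp W E g /\ (forall v, V v -> g v = f v).

(* j : A -> IA realizes IA as the injective envelope I(A), which is determined
   by A up to a *-isomorphism fixing A. *)
Definition injective_envelope (R : realType) (A IA : cstarAlgType R)
    (j : {lrmorphism A -> IA}) : Prop :=
  [/\ cstar_inclusion j,
      injective_opsys [set: IA] &
      forall V : set IA, range j `<=` V -> injective_opsys V -> V = [set: IA]].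

Section Inclusion.
Context {R : realType} {A B : cstarAlgType R} (iota : {lrmorphism A -> B}).

Definition extends_uniquely (phi : A -> R[i]) : Prop :=
  exists! psi : B -> R[i], pure_state psi /\ (forall a, psi (iota a) = phi a).

Definition PEP : Prop := forall phi : A -> R[i], pure_state phi ->
  extends_uniquely phi.

(* The weak* topology is the topology of pointwise convergence on A. *)
Definition AEP : Prop :=
  [set phi | pure_state phi] `<=`
  closure ([set phi | pure_state phi /\ extends_uniquely phi]
             : set {ptws A -> R[i]^o}).

Definition aperiodic : Prop :=
  forall (b : B) (D : set A) (eps : R),
    hereditary_subalg D -> (exists2 d, D d & d <> 0) -> 0 < eps ->
    exists d a : A, [/\ D d, cpos d, cnorm d = 1 &
      cnorm (iota d * b * iota d - iota a) < eps].

Definition unique_pseudo_expectation : Prop :=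
  exists (IA : cstarAlgType R) (j : {lrmorphism A -> IA}),
    injective_envelope j /\
    exists! Psi : B -> IA,
      ucp [set: B] [set: IA] Psi /\ (forall a, Psi (iota a) = j a).

Definition unique_conditional_expectation : Prop :=
  exists! E : B -> A, ucp [set: B] [set: A] E /\ (forall a, E (iota a) = a).

Definition relative_commutant : set B :=
  [set b | forall a, b * iota a = iota a * b].

End Inclusion.

(* Main.v *)
(* Write 1 = sum_i u_i u_i^* with matrix units u_i of A, and let e be a minimal
   projection of A.  All six conditions are equivalent to e B e = C e for every
   such e, which also forces each corner e B f to be at most one-dimensional and
   hence B to be finite-dimensional.

   If some e B e contains a self-adjoint b outside C e, the Krein extension
   theorem gives two states of B extending the pure state a |-> e a e of A and
   differing at b.  They induce two conditional expectations B -> A, and composing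
   these with a pure state of A that does not vanish on the block of e gives two
   distinct extensions, so that uniqueness fails in (i), (ii) and (v).  Applied to
   the hereditary subalgebra C e, (iii) puts e B e inside A; and (vi) applies to
   sum_i u_i b u_i^*, which commutes with A for b in e B e.  Conversely,
   if all the corners are scalar, then an extension of a pure state, or a
   conditional expectation (an A-bimodule map), is determined by its values on
   the elements u_i^* b u_j with u_i, u_j in the same block, which lie in A.  A
   finite-dimensional A is injective, hence its own injective envelope, so (iv)
   is (v).

   The existence of enough states on B rests on the Fukamiya-Kaplansky theorem
   that y^* y is positive, proved here without spectral theory. *)

(* The order of a C*-algebra is defined by factorizations y^* y, which hide even its stability under
   sums. It is traded for the convex condition |t - x| <= t, which involves only the norm, the star
   and the unit, so that an element of A is positive in A as soon as it is in B.

   Finite dimension enters through linear dependence: powers of an element of A, or of a matrix over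
   A, are dependent, which gives spectral projections, and orthogonal projections are bounded in
   number. Matrix units and a scalar test of complete positivity follow, without a structure
   theorem.

   The delicate condition is (ii), which grants unique extension only on a dense set of pure states.
   The two expectations are therefore made to differ, at a suitable element, by a nonzero multiple
   of a central projection p of A: phi p <> 0 is weak* open in phi, so some state of the dense set
   separates them. Their composites with phi need not be pure, so uniqueness among pure extensions
   must first become uniqueness among all; this is why Krein's functional is taken both extreme and
   maximal at a given point. *)
Require Import Defs.
From mathcomp Require Import all_boot all_order all_algebra.
From mathcomp Require Import all_classical all_reals all_analysis.
From mathcomp Require Import complex.
From mathcomp Require Import ring lra.
Set Implicit Arguments.
Unset Strict Implicit.
Unset Printing Implicit Defensive.
Import Order.TTheory GRing.Theory Num.Theory.
Import numFieldNormedType.Exports.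
Local Open Scope classical_set_scope.
Local Open Scope ring_scope.
Local Open Scope complex_scope.


(** * Identities in noncommutative algebras *)

(* Reflection: an expression is normalised to a linear combination of words in
   its atoms, and the coefficients are compared by ring or field. *)
Section NoncommutativeNormalForm.
Context {K : comNzRingType} {A : algType K}.

Inductive ncexp :=
  | NCVar of nat | NC0 | NC1
  | NCAdd of ncexp & ncexp | NCOpp of ncexp
  | NCMul of ncexp & ncexp | NCScale of K & ncexp | NCMuln of ncexp & nat.

Fixpoint nceval (env : seq A) (e : ncexp) : A :=
  match e with
  | NCVar i => nth 0 env i
  | NC0 => 0
  | NC1 => 1
  | NCAdd a b => nceval env a + nceval env b
  | NCOpp a => - nceval env a
  | NCMul a b => nceval env a * nceval env b
  | NCScale c a => c *: nceval env a
  | NCMuln a n => nceval env a *+ n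
  end.

Fixpoint nc_word_eq (v w : seq nat) : bool :=
  match v, w with
  | [::], [::] => true
  | i :: v', j :: w' => if Nat.eqb i j then nc_word_eq v' w' else false
  | _, _ => false
  end.

Fixpoint nc_word_cat (v w : seq nat) : seq nat :=
  if v is i :: v' then i :: nc_word_cat v' w else w.

Fixpoint nc_ins (c : K) (w : seq nat) (l : seq (K * seq nat)) :=
  match l with
  | [::] => [:: (c, w)]
  | (c', w') :: l' =>
      if nc_word_eq w w' then (c' + c, w') :: l' else (c', w') :: nc_ins c w l'
  end.

Fixpoint nc_scale (c : K) (w : seq nat) (l acc : seq (K * seq nat)) :=
  match l with
  | [::] => acc
  | (c', w') :: l' => nc_ins (c * c') (nc_word_cat w w') (nc_scale c w l' acc)
  end.

Fixpoint nc_mul (l m acc : seq (K * seq nat)) :=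
  match l with
  | [::] => acc
  | (c, w) :: l' => nc_scale c w m (nc_mul l' m acc)
  end.

Fixpoint nc_norm (e : ncexp) : seq (K * seq nat) :=
  match e with
  | NCVar i => [:: (1, [:: i])]
  | NC0 => [::]
  | NC1 => [:: (1, [::])]
  | NCAdd a b => nc_scale 1 [::] (nc_norm a) (nc_norm b)
  | NCOpp a => nc_scale (- 1) [::] (nc_norm a) [::]
  | NCMul a b => nc_mul (nc_norm a) (nc_norm b) [::]
  | NCScale c a => nc_scale c [::] (nc_norm a) [::]
  | NCMuln a n => nc_scale n%:R [::] (nc_norm a) [::]
  end.

Fixpoint nc_coefs0 (l : seq (K * seq nat)) : Prop :=
  match l with [::] => True | (c, _) :: l' => c = 0 /\ nc_coefs0 l' end.

Let word env (w : seq nat) : A := \prod_(i <- w) nth 0 env i.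
Let poly env (l : seq (K * seq nat)) : A := \sum_(p <- l) p.1 *: word env p.2.

Lemma nc_word_eqP v w : nc_word_eq v w -> v = w.
Proof.
elim: v w => [|i v IH] [|j w] //=.
by case E: (Nat.eqb i j) => // /IH ->; rewrite (PeanoNat.Nat.eqb_eq i j).1.
Qed.

Lemma nc_word_catE v w : nc_word_cat v w = v ++ w.
Proof. by elim: v => //= i v ->. Qed.

Lemma nc_insE env c w l : poly env (nc_ins c w l) = c *: word env w + poly env l.
Proof.
elim: l => [|[c' w'] l IH] /=; first by rewrite /poly big_seq1 big_nil addr0.
case: ifP => [/nc_word_eqP ->|_]; rewrite /poly !big_cons /=.
  by rewrite scalerDl -addrA addrCA addrA.
by rewrite -!/(poly _ _) IH addrCA.
Qed.

Lemma nc_scaleE env c w l acc :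
  poly env (nc_scale c w l acc) = c *: (word env w * poly env l) + poly env acc.
Proof.
elim: l => [|[c' w'] l IH] /=; first by rewrite /poly big_nil mulr0 scaler0 add0r.
rewrite nc_insE IH /poly big_cons -/(poly _ _) mulrDr scalerDr nc_word_catE /word.
by rewrite big_cat /= -scalerAr scalerA addrA.
Qed.

Lemma nc_mulE env l m acc :
  poly env (nc_mul l m acc) = poly env l * poly env m + poly env acc.
Proof.
elim: l => [|[c w] l IH] /=; first by rewrite {2}/poly big_nil mul0r add0r.
have -> : poly env ((c, w) :: l) = c *: word env w + poly env l by rewrite /poly big_cons.
by rewrite nc_scaleE IH mulrDl addrA scalerAl.
Qed.

Lemma nc_normE env e : poly env (nc_norm e) = nceval env e.
Proof.
elim: e => [i|||a IHa b IHb|a IHa|a IHa b IHb|c a IHa|a IHa n] /=.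
- by rewrite /poly big_seq1 /word big_seq1 scale1r.
- by rewrite /poly big_nil.
- by rewrite /poly big_seq1 /word big_nil scale1r.
- by rewrite nc_scaleE scale1r /word big_nil mul1r IHa IHb.
- by rewrite nc_scaleE {2}/poly big_nil addr0 /word big_nil mul1r scaleN1r IHa.
- by rewrite nc_mulE {3}/poly big_nil addr0 IHa IHb.
- by rewrite nc_scaleE {2}/poly big_nil addr0 /word big_nil mul1r IHa.
- by rewrite nc_scaleE {2}/poly big_nil addr0 /word big_nil mul1r IHa scaler_nat.
Qed.

Lemma nc_eq env e1 e2 :
  nc_coefs0 (nc_norm (NCAdd e1 (NCOpp e2))) -> nceval env e1 = nceval env e2.
Proof.
move=> H; apply/eqP; rewrite -subr_eq0; apply/eqP.
rewrite -[LHS]/(nceval env (NCAdd e1 (NCOpp e2))) -nc_normE.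
elim: nc_norm H => [|[c w] l IH] /=; first by rewrite /poly big_nil.
by move=> [-> /IH]; rewrite /poly big_cons scale0r add0r.
Qed.

End NoncommutativeNormalForm.

Ltac nc_find x l :=
  lazymatch l with
  | x :: _ => constr:(O)
  | ?y :: ?l' => let n := nc_find x l' in constr:(S n)
  end.
Ltac nc_mem x l :=
  lazymatch l with
  | [::] => constr:(false)
  | x :: _ => constr:(true)
  | _ :: ?l' => nc_mem x l'
  end.
Ltac nc_vars e l :=
  lazymatch e with
  | @GRing.add _ ?a ?b => let l1 := nc_vars a l in nc_vars b l1
  | @GRing.opp _ ?a => nc_vars a l
  | @GRing.mul _ ?a ?b => let l1 := nc_vars a l in nc_vars b l1
  | @GRing.scale _ _ ?c ?a => nc_vars a l
  | @GRing.natmul _ ?a ?n => nc_vars a l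
  | @GRing.exp _ ?a 2 => nc_vars a l
  | @GRing.zero _ => l
  | @GRing.one _ => l
  | _ => lazymatch nc_mem e l with true => l | false => constr:(e :: l) end
  end.
Ltac nc_reify K e l :=
  lazymatch e with
  | @GRing.add _ ?a ?b =>
      let a' := nc_reify K a l in let b' := nc_reify K b l in constr:(@NCAdd K a' b')
  | @GRing.opp _ ?a => let a' := nc_reify K a l in constr:(@NCOpp K a')
  | @GRing.mul _ ?a ?b =>
      let a' := nc_reify K a l in let b' := nc_reify K b l in constr:(@NCMul K a' b')
  | @GRing.scale _ _ ?c ?a => let a' := nc_reify K a l in constr:(@NCScale K c a')
  | @GRing.natmul _ ?a ?n =>
      let a' := nc_reify K a l in constr:(@NCMuln K a' n)
  | @GRing.exp _ ?a 2 => let a' := nc_reify K a l in constr:(@NCMul K a' a')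
  | @GRing.zero _ => constr:(@NC0 K)
  | @GRing.one _ => constr:(@NC1 K)
  | _ => let n := nc_find e l in constr:(@NCVar K n)
  end.
Ltac nc_step K T :=
  lazymatch goal with
  | |- @eq _ ?a ?b =>
      let l0 := nc_vars a (@nil T) in let l := nc_vars b l0 in
      let a' := nc_reify K a l in let b' := nc_reify K b l in
      transitivity (nceval l a');
      [reflexivity|];
      transitivity (nceval l b');
      [|reflexivity]
  end; apply: nc_eq;
  (* Only the normal form functions are unfolded, so that the coefficients remain terms of the
     scalar ring that [ring] and [field] recognise. *)
  cbv [nc_norm nc_mul nc_scale nc_ins nc_word_cat nc_word_eq Nat.eqb nc_coefs0];
  repeat lazymatch goal with |- _ /\ _ => apply: conj | |- True => exact I end.
Ltac ncring :=
  match goal with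
  | A : CStarAlgebra.type ?R |- @eq ?T ?a ?b =>
    change (@eq (CStarAlgebra.sort A) a b);
    nc_step (complex_complex__canonical__GRing_ComNzRing R) (CStarAlgebra.sort A)
  end; try first [ring | by field].

(** * Square roots and the positive cone of a C*-algebra *)

Section CStarBasics.
Context {R : realType} {A : cstarAlgType R}.
Implicit Types (x y z k h r : A) (t : R) (c : R[i]).

Lemma cnormZr t x : cnorm (t%:C *: x) = `|t| * cnorm x.
Proof.
apply: (@complexI R); rewrite cnormZ normc_def /= expr0n /= addr0 sqrtr_sqr.
by rewrite rmorphM.
Qed.

Lemma cnormZi x : cnorm ('i *: x) = cnorm x.
Proof.
apply: (@complexI R); rewrite cnormZ normc_def /= expr0n /= add0r expr1n sqrtr1.
by rewrite mul1r.
Qed.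

Lemma cnorm0 : cnorm (0 : A) = 0.
Proof. by rewrite -(scale0r (0 : A)) (cnormZr 0 0) normr0 mul0r. Qed.

Lemma cnormN x : cnorm (- x) = cnorm x.
Proof.
have -> : - x = (-1 : R)%:C *: x by rewrite rmorphN1 scaleN1r.
by rewrite cnormZr normrN1 mul1r.
Qed.

Lemma cnorm_ge0 x : 0 <= cnorm x.
Proof.
have := cnormD_le x (- x); rewrite subrr cnorm0 cnormN; lra.
Qed.

Lemma cnormB_le x y : cnorm (x - y) <= cnorm x + cnorm y.
Proof. by rewrite -(cnormN y) cnormD_le. Qed.

Lemma cnormBC x y : cnorm (x - y) = cnorm (y - x).
Proof. by rewrite -cnormN opprB. Qed.

Lemma star0 : star (0 : A) = 0.
Proof. by apply: (@addrI _ (star 0)); rewrite -starD !addr0. Qed.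

Lemma starN x : star (- x) = - star x.
Proof. by apply/eqP; rewrite -addr_eq0 -starD addNr star0. Qed.

Lemma starB x y : star (x - y) = star x - star y.
Proof. by rewrite starD starN. Qed.

Lemma star_inj : injective (@star R A).
Proof. exact: inv_inj (@starK R A). Qed.

Lemma star1 : star (1 : A) = 1.
Proof. by rewrite -[LHS]mulr1 -[X in _ * X]starK -starM mulr1 starK. Qed.

Lemma starZc c x : star (c *: x) = conjc c *: star x.
Proof. exact: starZ. Qed.

Lemma starZr t x : star (t%:C *: x) = t%:C *: star x.
Proof. by rewrite starZc conjc_real. Qed.

Lemma starZi x : star ('i *: x) = - ('i *: star x).
Proof.
by rewrite starZc -scaleNr; congr (_ *: _); apply/eqP; rewrite eq_complex /= oppr0 !eqxx.
Qed.

Lemma star_sum (I : Type) (s : seq I) (Q : pred I) (F : I -> A) :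
  star (\sum_(i <- s | Q i) F i) = \sum_(i <- s | Q i) star (F i).
Proof. by elim/big_rec2: _ => [|i a b _ <-]; rewrite ?star0 ?starD. Qed.

Lemma cnorm_eq0 x : (cnorm x == 0) = (x == 0).
Proof. by apply/eqP/eqP => [/cnorm0_eq0//|->]; rewrite cnorm0. Qed.

(** The C*-identity and submultiplicativity give |y|^2 <= |y^* | |y|, hence one inequality for every
    y; the involution gives the other. *)
Lemma cnorm_star x : cnorm (star x) = cnorm x.
Proof.
have le_star y : cnorm y <= cnorm (star y).
  have [->|y0] := eqVneq y 0; first by rewrite star0.
  have y_gt0 : 0 < cnorm y by rewrite lt_neqAle eq_sym cnorm_eq0 y0 cnorm_ge0.
  by rewrite -(ler_pM2r y_gt0) -expr2 -cnorm_starM cnormM_le.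
by apply/eqP; rewrite eq_le le_star andbT -{2}(starK x) le_star.
Qed.

Lemma cnorm1 : cnorm (1 : A) = 1.
Proof.
have := cnorm_starM (1 : A); rewrite star1 mulr1 expr2 => /eqP.
rewrite -{1}[cnorm 1]mulr1 -subr_eq0 -mulrBr mulf_eq0 cnorm_eq0 oner_eq0 /=.
by rewrite subr_eq0 => /eqP.
Qed.

Lemma cnorm_sa x : star x = x -> cnorm (x * x) = cnorm x ^+ 2.
Proof. by move=> xs; rewrite -cnorm_starM xs. Qed.

Lemma starM_eq0 x : star x * x = 0 -> x = 0.
Proof.
move=> x0; have := cnorm_starM x; rewrite x0 cnorm0 => /esym/eqP.
by rewrite expf_eq0 /= cnorm_eq0 => /eqP.
Qed.

Lemma cnorm_small_eq0 x : (forall eps, 0 < eps -> cnorm x <= eps) -> x = 0.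
Proof.
move=> H; apply: cnorm0_eq0; apply/eqP; rewrite eq_le cnorm_ge0 andbT.
by apply/ler_addgt0Pl => e /H; rewrite addr0.
Qed.

Lemma cnorm_cvgP (u : nat -> A) (l : A) :
  cnorm (u n - l) @[n --> \oo] --> (0 : R) <->
  (forall eps, 0 < eps -> exists N, forall n, (N <= n)%N -> cnorm (u n - l) < eps).
Proof.
split=> [/cvgr0Pnorm_lt H e e0|H].
  have [N _ HN] := H e e0; exists N => n Nn.
  by have := HN n Nn; rewrite /= ger0_norm // cnorm_ge0.
apply/cvgr0Pnorm_lt => e e0; have [N HN] := H e e0; exists N => // n /= Nn.
by rewrite ger0_norm ?cnorm_ge0 ?HN.
Qed.

Lemma cnorm_cvg_unique (u : nat -> A) (l l' : A) :
  cnorm (u n - l) @[n --> \oo] --> (0 : R) ->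
  cnorm (u n - l') @[n --> \oo] --> (0 : R) -> l = l'.
Proof.
move=> /cnorm_cvgP ul /cnorm_cvgP ul'; apply/eqP; rewrite -subr_eq0; apply/eqP.
apply: cnorm_small_eq0 => e e0; have e20 : 0 < e / 2 by lra.
have [N HN] := ul _ e20; have [M HM] := ul' _ e20.
have := HN _ (leq_maxl N M); have := HM _ (leq_maxr N M).
set n := maxn N M; rewrite cnormBC => h1 h2.
have -> : l - l' = - (u n - l - (u n - l')) by ncring.
rewrite cnormN; have := cnormB_le (u n - l) (u n - l'); rewrite (cnormBC (u n) l'); lra.
Qed.

Lemma cnorm_cvg_lin (u : nat -> A) (l : A) (f : A -> A) (C : R) :
  (forall x y, cnorm (f x - f y) <= C * cnorm (x - y)) ->
  cnorm (u n - l) @[n --> \oo] --> (0 : R) ->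
  cnorm (f (u n) - f l) @[n --> \oo] --> (0 : R).
Proof.
move=> fC /cnorm_cvgP ul; apply/cnorm_cvgP => e e0.
(* [C] may be zero or negative, hence the divisor [|C| + 1]. *)
have C0 : 0 < `|C| + 1 by rewrite ltr_wpDl ?normr_ge0.
have [N HN] := ul (e / (`|C| + 1)) (divr_gt0 e0 C0); exists N => n /HN.
rewrite ltr_pdivlMr// => h; apply: le_lt_trans (fC _ _) _; apply: le_lt_trans h.
rewrite mulrC ler_wpM2l ?cnorm_ge0//; have := ler_norm C; lra.
Qed.


(* The iteration z <- (k + z ^ 2) / 2 is dominated term by term by the scalar
   iteration s <- (1 + s ^ 2) / 2, which is increasing and bounded. *)
Fixpoint sqrt_iter (k : A) (n : nat) : A :=
  if n is n'.+1 then (2^-1 : R)%:C *: (k + sqrt_iter k n' * sqrt_iter k n') else 0.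

Fixpoint sqrt_iterR (n : nat) : R :=
  if n is n'.+1 then 2^-1 * (1 + sqrt_iterR n' * sqrt_iterR n') else 0.

Lemma sqrt_iterR_bound n : 0 <= sqrt_iterR n <= 1.
Proof. by elim: n => [|n /andP[h1 h2]] /=; apply/andP; split; nra. Qed.

Lemma sqrt_iterR_cauchy eps : 0 < eps ->
  exists N, forall n, (N <= n)%N -> sqrt_iterR n - sqrt_iterR N < eps.
Proof.
move=> e0; pose S := range sqrt_iterR.
have S_sup : has_sup S.
  split; first by exists (sqrt_iterR 0), 0%N.
  by exists 1 => _ [n _ <-]; case/andP: (sqrt_iterR_bound n).
have [_ [N _ <-] HN] := sup_adherent e0 S_sup.
exists N => n Nn; have : sqrt_iterR n <= sup S.
  by apply: sup_upper_bound => //; exists n.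
lra.
Qed.

Lemma sqrt_iter_norm k n : cnorm k <= 1 -> cnorm (sqrt_iter k n) <= sqrt_iterR n.
Proof.
move=> k1; elim: n => [|n IH]; first by rewrite /= cnorm0.
rewrite [sqrt_iter _ _]/= cnormZr [sqrt_iterR _]/= ger0_norm ?invr_ge0//.
rewrite ler_wpM2l ?invr_ge0//; apply: le_trans (cnormD_le _ _) _; apply: lerD => //.
apply: le_trans (cnormM_le _ _) _.
by apply: ler_pM => //; exact: cnorm_ge0.
Qed.

(** Induction on z z - w w = z (z - w) + (z - w) w: if |z| <= s, |w| <= t and |z - w| <= s - t, its
    norm is at most (s + t)(s - t), the matching scalar difference. *)
Lemma sqrt_iter_dist k m n : cnorm k <= 1 -> (m <= n)%N ->
  cnorm (sqrt_iter k n - sqrt_iter k m) <= sqrt_iterR n - sqrt_iterR m.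
Proof.
move=> k1; elim: m n => [|m IH] [|n] //.
- by move=> _; rewrite !subr0 /= cnorm0.
- by move=> _; rewrite !subr0; exact: sqrt_iter_norm.
move=> /IH {}IH; have hn := sqrt_iter_norm n k1; have hm := sqrt_iter_norm m k1.
rewrite [sqrt_iter _ _]/= [sqrt_iter _ m.+1]/= [sqrt_iterR _]/= [sqrt_iterR m.+1]/=.
move: (sqrt_iter k n) (sqrt_iter k m) (sqrt_iterR n) (sqrt_iterR m) IH hn hm.
move=> z w s t h hz hw.
have -> : 2^-1%:C *: (k + z * z) - 2^-1%:C *: (k + w * w) =
    2^-1%:C *: (z * (z - w) + (z - w) * w) by ncring.
rewrite cnormZr ger0_norm ?invr_ge0//.
have h1 := cnormD_le (z * (z - w)) ((z - w) * w).
have h2 := cnormM_le z (z - w); have h3 := cnormM_le (z - w) w.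
have := cnorm_ge0 z; have := cnorm_ge0 w; have := cnorm_ge0 (z - w).
nra.
Qed.

(** The limit l of the iteration satisfies 2 l = k + l^2, so r = 1 - l squares to 1 - k.
    Self-adjointness, |l| <= 1 and commutation hold for every iterate and pass to the limit. *)
Lemma sqrt1B_exists k : star k = k -> cnorm k <= 1 ->
  exists r, [/\ star r = r, r * r = 1 - k, cnorm (1 - r) <= 1 &
                forall y, y * k = k * y -> y * r = r * y].
Proof.
move=> ks k1; have [|l ul] := @cnorm_complete R A (sqrt_iter k).
  move=> e e0; have [N HN] := sqrt_iterR_cauchy (divr_gt0 e0 (ltr0n _ 2)).
  exists N => m n Nm Nn; have hm := sqrt_iter_dist k1 Nm; have hn := sqrt_iter_dist k1 Nn.
  have := HN _ Nm; have := HN _ Nn.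
  have -> : sqrt_iter k m - sqrt_iter k n =
    (sqrt_iter k m - sqrt_iter k N) - (sqrt_iter k n - sqrt_iter k N) by ncring.
  have := cnormB_le (sqrt_iter k m - sqrt_iter k N) (sqrt_iter k n - sqrt_iter k N); lra.
have itn n : cnorm (sqrt_iter k n) <= 1.
  by apply: le_trans (sqrt_iter_norm n k1) _; case/andP: (sqrt_iterR_bound n).
have eqlim (f : A -> A) (C : R) :
    (forall x y, cnorm (f x - f y) <= C * cnorm (x - y)) ->
    (forall n, f (sqrt_iter k n) = sqrt_iter k n) -> f l = l.
  move=> fC fu; have := cnorm_cvg_lin fC ul.
  by under eq_fun do rewrite fu; move=> /cnorm_cvg_unique; apply.
have ls : star l = l.
  apply: (eqlim _ 1) => [x y|n]; first by rewrite -starB cnorm_star mul1r.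
  by elim: n => [|n IH] /=; rewrite ?star0 // starZr starD starM ks !IH.
have l1 : cnorm l <= 1.
  apply/ler_addgt0Pr => e e0; have /cnorm_cvgP/(_ e e0)[N /(_ N (leqnn _))] := ul.
  rewrite cnormBC => h; have := cnormD_le (l - sqrt_iter k N) (sqrt_iter k N).
  by rewrite subrK; have := itn N; lra.
have lE : (2^-1 : R)%:C *: (k + l * l) = l.
  apply: (@cnorm_cvg_unique (fun n => sqrt_iter k n.+1)).
    apply/cnorm_cvgP => e e0; have /cnorm_cvgP/(_ e e0)[N HN] := ul.
    exists N => n /HN /=; set z := sqrt_iter k n => h.
    have -> : 2^-1%:C *: (k + z * z) - 2^-1%:C *: (k + l * l) =
      2^-1%:C *: (z * (z - l) + (z - l) * l) by ncring.
    rewrite cnormZr ger0_norm ?invr_ge0//.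
    have h1 := cnormD_le (z * (z - l)) ((z - l) * l).
    have h2 := cnormM_le z (z - l); have h3 := cnormM_le (z - l) l.
    have := cnorm_ge0 (z - l); have := itn n; rewrite -/z; nra.
  by apply/cnorm_cvgP => e e0; have /cnorm_cvgP/(_ e e0)[N HN] := ul; exists N => n Nn; apply: HN; rewrite leqW.
exists (1 - l); split=> [|||y yk].
- by rewrite starB star1 ls.
- have -> : k = l + l - l * l by rewrite -{1 2}lE; ncring.
  ncring.
- by have -> : 1 - (1 - l) = l by ncring.
suff yl : y * l = l * y by rewrite mulrBr mulrBl mulr1 mul1r yl.
have yu n : y * sqrt_iter k n = sqrt_iter k n * y.
  elim: n => [|n IH] /=; first by rewrite mulr0 mul0r.
  by rewrite -scalerAr -scalerAl mulrDr mulrDl yk mulrA IH -mulrA IH mulrA.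
apply: (@cnorm_cvg_unique (fun n => y * sqrt_iter k n)).
  apply: (cnorm_cvg_lin (C := cnorm y)) ul => x z; rewrite -mulrBr; exact: cnormM_le.
under eq_fun do rewrite yu.
apply: (cnorm_cvg_lin (f := fun x => x * y) (C := cnorm y)) ul => x z.
by rewrite -mulrBl mulrC; exact: cnormM_le.
Qed.

End CStarBasics.

(** * The norm condition for positivity *)

Section CStarPositivity.
Context {R : realType} {A : cstarAlgType R}.
Implicit Types (x y z k h r v : A) (t : R) (c : R[i]).

(* For a self-adjoint element, |t - x| <= t for some t says that its spectrum
   lies in [0, 2t]. *)
Definition normpos x := star x = x /\ exists t, cnorm (t%:C *: 1 - x) <= t.

Lemma normpos_large x t :
  cnorm (t%:C *: 1 - x) <= t -> forall s, t <= s -> cnorm (s%:C *: 1 - x) <= s.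
Proof.
move=> h s ts; have -> : s%:C *: 1 - x = (s - t)%:C *: 1 + (t%:C *: 1 - x) by ncring.
apply: le_trans (cnormD_le _ _) _; rewrite cnormZr cnorm1 mulr1 ger0_norm ?subr_ge0//; lra.
Qed.

Lemma normposD x y : normpos x -> normpos y -> normpos (x + y).
Proof.
move=> [xs [t ht]] [ys [s hs]]; split; first by rewrite starD xs ys.
exists (t + s); have -> : (t + s)%:C *: 1 - (x + y) = (t%:C *: 1 - x) + (s%:C *: 1 - y) by ncring.
by apply: le_trans (cnormD_le _ _) _; rewrite lerD.
Qed.

Lemma normposZ x t : 0 <= t -> normpos x -> normpos (t%:C *: x).
Proof.
move=> t0 [xs [s hs]]; split; first by rewrite starZr xs.
exists (t * s); have -> : (t * s)%:C *: 1 - t%:C *: x = t%:C *: (s%:C *: 1 - x) by ncring.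
by rewrite cnormZr ger0_norm// ler_wpM2l.
Qed.

Lemma mulii : 'i * 'i = -1 :> R[i].
Proof. by rewrite -expr2 sqr_i. Qed.

Lemma scaleii x : 'i *: ('i *: x) = - x.
Proof. by rewrite scalerA mulii scaleN1r. Qed.

(* (1 - i) y is larger than y in norm, so that iterating this step from the
   bounds for n < 4 forces y = 0. *)
Lemma rootsof1_step y : (forall n, cnorm (1 + 'i ^+ n *: y) <= 1) ->
  forall n, cnorm (1 + 'i ^+ n *: ((1 - 'i) *: y)) <= 1.
Proof.
move=> H n.
(* With w = i^n y these are 1 + w and 1 - i w: the square terms cancel in a^2 + b^2, leaving 2 (1 +
   (1 - i) w). *)
pose a := 1 + 'i ^+ n *: y; pose b := 1 + 'i ^+ n.+3 *: y.
have -> : 1 + 'i ^+ n *: ((1 - 'i) *: y) = (2^-1 : R)%:C *: (a * a + b * b).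
  have -> : b = 1 - 'i *: ('i ^+ n *: y).
    by rewrite /b !exprS !mulrA mulii mulN1r mulNr scaleNr scalerA.
  have -> : 'i ^+ n *: ((1 - 'i) *: y) = 'i ^+ n *: y - 'i *: ('i ^+ n *: y) by ncring.
  rewrite /a; move: ('i ^+ n *: y) => u; have := scaleii (u * u).
  rewrite scalerAr scalerAl; move: ('i *: u) => v vv.
  have -> : (1 - v) * (1 - v) = 1 - v - v - u * u by rewrite -vv; ncring.
  ncring.
rewrite cnormZr ger0_norm ?invr_ge0// ler_pdivrMl// mulr1.
apply: le_trans (cnormD_le _ _) _.
have h1 := cnormM_le a a; have h2 := cnormM_le b b.
have := H n; have := H n.+3; rewrite -/a -/b.
have := cnorm_ge0 a; have := cnorm_ge0 b; nra.
Qed.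

(** After scaling, |1 + y| and |1 - y| are at most 1. Averaging the squares gives |1 + y^2| <= 1,
    which is |1 + i y|^2 by the C*-identity. So [rootsof1_step] applies repeatedly, and (1 - i)^m y
    has norm 2^(m/2) |y| but never more than 2. *)
Lemma normpos_antisym x : normpos x -> normpos (- x) -> x = 0.
Proof.
move=> [xs [t ht]] [_ [s hs]].
pose m := Num.max 1 (Num.max t s).
have m1 : 1 <= m by rewrite le_max lexx.
have m0 : 0 < m by lra.
pose y := m^-1%:C *: x.
have E (e : R) : `|e| = 1 -> cnorm (m%:C *: 1 + e%:C *: x) <= m -> cnorm (1 + e%:C *: y) <= 1.
  move=> e1 h; have -> : 1 + e%:C *: y = m^-1%:C *: (m%:C *: 1 + e%:C *: x).
    rewrite /y scalerDr !scalerA -!rmorphM mulVf ?gt_eqF// scale1r.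
    by rewrite mulrC.
  by rewrite cnormZr ger0_norm ?invr_ge0 ?(ltW m0)// ler_pdivrMl// mulr1.
have hp : cnorm (1 + y) <= 1.
  rewrite -[y]scale1r -(rmorph1 (real_complex R)); apply: E; rewrite ?normr1//.
  have := normpos_large hs (s := m); rewrite opprK rmorph1 scale1r; apply.
  by rewrite !le_max lexx !orbT.
have hm : cnorm (1 - y) <= 1.
  rewrite -scaleN1r -(rmorphN1 (real_complex R)); apply: E; rewrite ?normrN1//.
  have := normpos_large ht (s := m); rewrite rmorphN1 scaleN1r; apply.
  by rewrite !le_max lexx !orbT.
have ys : star y = y by rewrite starZr xs.
have h1y2 : cnorm (1 + y * y) <= 1.
  have -> : 1 + y * y = (2^-1 : R)%:C *: ((1 + y) * (1 + y) + (1 - y) * (1 - y)) by ncring.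
  rewrite cnormZr ger0_norm ?invr_ge0// ler_pdivrMl// mulr1.
  apply: le_trans (cnormD_le _ _) _.
  have := cnormM_le (1 + y) (1 + y); have := cnormM_le (1 - y) (1 - y).
  have := cnorm_ge0 (1 + y); have := cnorm_ge0 (1 - y); nra.
have hpi : cnorm (1 + 'i *: y) <= 1.
  have : cnorm (1 + 'i *: y) ^+ 2 <= 1.
    rewrite -cnorm_starM starD star1 starZi ys.
    suff -> : (1 - 'i *: y) * (1 + 'i *: y) = 1 + y * y by [].
    have := scaleii (y * y); rewrite scalerAr scalerAl; move: ('i *: y) => v vv.
    have -> : y * y = - (v * v) by rewrite vv opprK.
    ncring.
  by rewrite expr_le1 ?cnorm_ge0.
have hmi : cnorm (1 - 'i *: y) <= 1.
  have -> : 1 - 'i *: y = star (1 + 'i *: y) by rewrite starD star1 starZi ys.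
  by rewrite cnorm_star.
have H0 n : cnorm (1 + 'i ^+ n *: y) <= 1.
  have [H1 H2 H3] : [/\ cnorm (1 + 'i ^+ n *: y) <= 1, cnorm (1 - 'i ^+ n *: y) <= 1 &
     cnorm (1 + 'i ^+ n.+1 *: y) <= 1 /\ cnorm (1 - 'i ^+ n.+1 *: y) <= 1].
    elim: n => [|n [IH1 IH2 [IH3 IH4]]]; first by rewrite expr0 expr1 scale1r.
    by split=> //; rewrite !exprS mulrA mulii mulN1r scaleNr opprK.
  by [].
have H m' n : cnorm (1 + 'i ^+ n *: ((1 - 'i) ^+ m' *: y)) <= 1.
  elim: m' n => [|m' IH] n; first by rewrite expr0 scale1r.
  by rewrite exprS -(scalerA (1 - 'i)); exact: rootsof1_step.
have H2 m' : 2 ^+ m' * cnorm y ^+ 2 <= 4.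
  have Hn : cnorm ((1 - 'i) ^+ m' *: y) <= 2.
    have := H m' 0%N; rewrite expr0 scale1r; set z := _ *: y => hz.
    have := cnormB_le (1 + z) 1; have -> : 1 + z - 1 = z by ncring.
    rewrite cnorm1; lra.
  have -> : 2 ^+ m' * cnorm y ^+ 2 = cnorm ((1 - 'i) ^+ m' *: y) ^+ 2.
    apply: (@complexI R); rewrite [RHS](rmorphXn (real_complex R)) /= cnormZ exprMn normrX.
    rewrite -exprM mulnC exprM -add_Re2_Im2 /= subr0 add0r sqrrN expr1n.
    by rewrite (rmorphM (real_complex R)) !(rmorphXn (real_complex R)).
  have := cnorm_ge0 ((1 - 'i) ^+ m' *: y); nra.
suff y0 : y = 0.
  by move: y0 => /eqP; rewrite scaler_eq0 -(rmorph0 (real_complex R)) (inj_eq (@complexI R)) invr_eq0 gt_eqF//= => /eqP.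
apply/eqP; rewrite -cnorm_eq0; apply/negPn/negP => y0.
have yp : 0 < cnorm y ^+ 2 by rewrite exprn_gt0// lt_neqAle eq_sym y0 cnorm_ge0.
have := archi_boundP (ltW (divr_gt0 (ltr0n R 4) yp)); set N := Num.bound _ => hN.
have h2N : N%:R <= 2 ^+ N :> R by rewrite -natrX ler_nat ltnW// ltn_expl.
have := H2 N; rewrite ltr_pdivrMr// in hN; move: hN h2N yp; nra.
Qed.

End CStarPositivity.

(** * The Fukamiya-Kaplansky theorem and the resulting order *)

Section CStarCone.
Context {R : realType} {A : cstarAlgType R}.
Implicit Types (x y z k h r v : A) (t : R) (c : R[i]).

(** Writing x = t (1 - k) makes k a self-adjoint contraction; the root of x is sqrt t times that of
    1 - k, and its positivity is the bound |1 - r| <= 1. *)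
Lemma normpos_sqrt x : normpos x ->
  exists r, [/\ normpos r, r * r = x & forall y, y * x = x * y -> y * r = r * y].
Proof.
move=> [xs [t0 ht0]]; pose t := Num.max 1 t0.
have t1 : 1 <= t by rewrite le_max lexx.
have tp : 0 < t by lra.
have ht : cnorm (t%:C *: 1 - x) <= t.
  by apply: normpos_large ht0 _ _; rewrite le_max lexx orbT.
pose k := 1 - t^-1%:C *: x.
have ks : star k = k by rewrite starB star1 starZr xs.
have k1 : cnorm k <= 1.
  have -> : k = t^-1%:C *: (t%:C *: 1 - x).
    by rewrite /k scalerBr scalerA -rmorphM mulVf ?gt_eqF// scale1r.
  by rewrite cnormZr ger0_norm ?invr_ge0 ?(ltW tp)// ler_pdivrMl// mulr1.
have [r [rs rr r1 rc]] := sqrt1B_exists ks k1.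
pose u := Num.sqrt t; have uu : u * u = t by rewrite -expr2 sqr_sqrtr// ltW.
have u0 : 0 <= u by rewrite sqrtr_ge0.
exists (u%:C *: r); split.
- split; first by rewrite starZr rs.
  exists u; have -> : u%:C *: 1 - u%:C *: r = u%:C *: (1 - r) by ncring.
  by rewrite cnormZr ger0_norm// ler_piMr.
- rewrite -scalerAl -scalerAr scalerA rr -rmorphM uu /k opprB addrC subrK scalerA.
  by rewrite -rmorphM divff ?gt_eqF// scale1r.
- move=> y yx; rewrite -scalerAl -scalerAr rc// /k mulrBr mulrBl mulr1 mul1r.
  by rewrite -scalerAl -scalerAr yx.
Qed.

(* With s = sqrt (1 - h ^ 2), the element u = h + i s is unitary and s = Im u. *)
Lemma cnorm_sq_contr h : star h = h -> cnorm h <= 1 -> cnorm (1 - h * h) <= 1.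
Proof.
move=> hs h1; have ks : star (h * h) = h * h by rewrite starM hs.
have k1 : cnorm (h * h) <= 1.
  by apply: le_trans (cnormM_le _ _) _; have := cnorm_ge0 h; nra.
have [s [ss sE _ sc]] := sqrt1B_exists ks k1.
have hcs : h * s = s * h by apply: sc; rewrite mulrA.
pose u := h + 'i *: s; have us : star u = h - 'i *: s by rewrite starD starZi hs ss.
have uu : star u * u = 1.
  have E : 'i *: s * ('i *: s) = - (s * s) by rewrite -scalerAl -scalerAr scaleii.
  rewrite us /u mulrDr !mulrBl E -scalerAr -scalerAl hcs opprK sE; ncring.
have u1 : cnorm u = 1.
  by apply/eqP; rewrite -(@eqrXn2 _ 2) ?cnorm_ge0// -cnorm_starM uu cnorm1 expr1n.
have s1 : cnorm s <= 1.
  have : (2 : R)%:C *: ('i *: s) = u - star u by rewrite us /u; ncring.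
  move=> /(congr1 cnorm); rewrite cnormZr cnormZi ger0_norm// => E.
  have := cnormB_le u (star u); rewrite cnorm_star u1; lra.
by rewrite -sE; apply: le_trans (cnormM_le _ _) _; have := cnorm_ge0 s; nra.
Qed.

Lemma sq_normpos h : star h = h -> normpos (h * h).
Proof.
move=> hs; split; first by rewrite starM hs.
pose t := cnorm h + 1; have t0 : 0 < t by rewrite ltr_wpDl ?cnorm_ge0.
pose g := t^-1%:C *: h; have gs : star g = g by rewrite starZr hs.
have g1 : cnorm g <= 1.
  by rewrite cnormZr ger0_norm ?invr_ge0 ?(ltW t0)// ler_pdivrMl// mulr1 /t; lra.
exists (t ^+ 2); have -> : (t ^+ 2)%:C *: 1 - h * h = (t ^+ 2)%:C *: (1 - g * g).
  rewrite scalerBr /g -scalerAl -scalerAr !scalerA -!rmorphM.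
  by rewrite expr2 mulfK ?gt_eqF// divff ?gt_eqF// scale1r.
by rewrite cnormZr ger0_norm ?exprn_ge0 ?(ltW t0)// ler_piMr ?exprn_ge0 ?(ltW t0)// cnorm_sq_contr.
Qed.

(** The witness in [normpos] can be any bound of the norm: x = r r with |x| = |r|^2, and r / |r|
    falls under [cnorm_sq_contr]. *)
Lemma normpos_le x t : normpos x -> cnorm x <= t -> cnorm (t%:C *: 1 - x) <= t.
Proof.
move=> /normpos_sqrt[r [[rs _] rr _]] xt.
apply: (@normpos_large _ _ _ (cnorm x)) => //.
have [x0|x0] := eqVneq (cnorm x) 0.
  by rewrite (cnorm0_eq0 _ x0) cnorm0 rmorph0 scale0r subr0 cnorm0.
have xp : 0 < cnorm x by rewrite lt_neqAle eq_sym x0 cnorm_ge0.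
have np : 0 < cnorm r.
  rewrite lt_neqAle cnorm_ge0 andbT eq_sym cnorm_eq0; apply: contra_neq x0 => r0.
  by rewrite -rr r0 mul0r cnorm0.
pose g := (cnorm r)^-1%:C *: r; have gs : star g = g by rewrite starZr rs.
have g1 : cnorm g <= 1 by rewrite cnormZr ger0_norm ?invr_ge0 ?(ltW np)// mulVf// gt_eqF.
have -> : (cnorm x)%:C *: 1 - x = (cnorm x)%:C *: (1 - g * g).
  rewrite scalerBr /g -scalerAl -scalerAr !scalerA -!rmorphM rr -{4}rr cnorm_sa//.
  by rewrite expr2 mulfK ?gt_eqF// divff ?gt_eqF// scale1r.
by rewrite cnormZr ger0_norm ?(ltW xp)// ler_piMr ?(ltW xp)// cnorm_sq_contr.
Qed.

Lemma star_real_imag z : exists a b, [/\ star a = a, star b = b,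
  z = a + 'i *: b & star z = a - 'i *: b].
Proof.
pose a := (2^-1 : R)%:C *: (z + star z); pose b := (2^-1 : R)%:C *: ('i *: (star z - z)).
have as_ : star a = a by rewrite starZr starD starK addrC.
have bs : star b = b by rewrite starZr starZi starB starK -scalerN opprB.
have E : z = a + 'i *: b.
  rewrite /a /b scalerA mulrC -scalerA scaleii; ncring.
by exists a, b; split=> //; rewrite E starD starZi as_ bs.
Qed.

(** The cross terms of z = a + i b cancel, leaving 2 (a^2 + b^2). *)
Lemma star_sum_normpos z : normpos (star z * z + z * star z).
Proof.
have [a [b [as_ bs -> ->]]] := star_real_imag z.
have E : 'i *: b * ('i *: b) = - (b * b) by rewrite -scalerAl -scalerAr scaleii.
have -> : (a - 'i *: b) * (a + 'i *: b) + (a + 'i *: b) * (a - 'i *: b) =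
    (a * a + a * a) + (b * b + b * b).
  rewrite !mulrDl !mulrDr !mulrN !mulNr E; ncring.
by do 2?apply: normposD; exact: sq_normpos.
Qed.

(* If z^* z = - q^2 with q self-adjoint, then y = z q satisfies
   y^* y = - q^4 and y y^* = - (z z^* )^2, so that y^* y + y y^* is both
   positive and negative. *)
Lemma star_mul_neg_sq z q : star q = q -> star z * z = - (q * q) -> z = 0.
Proof.
move=> qs zz; pose y := z * q; pose w := z * star z.
have ws : star w = w by rewrite /w starM starK.
have y1 : star y * y = - ((q * q) * (q * q)).
  have -> : star y * y = q * (star z * z) * q by rewrite /y starM qs; ncring.
  by rewrite zz; ncring.
have y2 : y * star y = - (w * w).
  have -> : w * w = z * (star z * z) * star z by rewrite /w; ncring.
  by rewrite zz /y starM qs; ncring.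
have q2s : star (q * q) = q * q by rewrite starM qs.
have q40 : (q * q) * (q * q) + w * w = 0.
  apply: normpos_antisym; first by apply: normposD; apply: sq_normpos.
  by rewrite opprD -y1 -y2; exact: star_sum_normpos.
have q4 : (q * q) * (q * q) = 0.
  apply: normpos_antisym; first exact: sq_normpos.
  have -> : - (q * q * (q * q)) = w * w by apply/eqP; rewrite eq_sym -addr_eq0 addrC q40.
  exact: sq_normpos.
have q2 : q * q = 0 by apply: starM_eq0; rewrite q2s.
by apply: starM_eq0; rewrite zz q2 oppr0.
Qed.

(* Write h = y^* y; the negative part v of h is such that y v falls under
   star_mul_neg_sq. *)
Lemma starM_normpos y : normpos (star y * y).
Proof.
pose h := star y * y; have hs : star h = h by rewrite /h starM starK.
have [r [rP rr rc]] := normpos_sqrt (sq_normpos hs).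
have hr : h * r = r * h by apply: rc; rewrite mulrA.
have [s [sP sr sc]] := normpos_sqrt rP.
have [[rs _] [ss _]] := (rP, sP).
pose v := r - h; have vs : star v = v by rewrite starB rs hs.
have rv : r * v = r * r - r * h by rewrite mulrBr.
have hv : h * v = - (r * v) by rewrite /v !mulrBr opprB rr hr.
have vs_comm : v * s = s * v by apply: sc; rewrite mulrBl mulrBr hr.
have z0 : y * v = 0.
  apply: (@star_mul_neg_sq _ (s * v)); first by rewrite starM vs ss vs_comm.
  have -> : star (y * v) * (y * v) = v * (h * v) by rewrite starM vs /h; ncring.
  rewrite hv -sr; have -> : s * v * (s * v) = (v * s) * (s * v) by rewrite vs_comm.
  ncring.
have hv0 : h * v = 0 by rewrite /h -mulrA z0 mulr0.
have rv0 : r * v = 0 by apply/eqP; rewrite -oppr_eq0 -hv hv0.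
have v0 : v = 0 by apply: starM_eq0; rewrite vs {1}/v mulrBl hv0 rv0 subr0.
have -> : star y * y = r by apply/esym/eqP; rewrite -subr_eq0 -/h -/v v0.
exact: rP.
Qed.

(** Factorizations and the norm condition define the same cone: sums and limits are handled by the
    latter, conjugations y^* x y by the former. *)
Lemma cposP x : cpos x <-> normpos x.
Proof.
split=> [[y ->]|/normpos_sqrt[r [[rs _] <- _]]]; first exact: starM_normpos.
by exists r; rewrite rs.
Qed.

Lemma cpos_sa x : cpos x -> star x = x.
Proof. by move=> /cposP[]. Qed.

Lemma cposD x y : cpos x -> cpos y -> cpos (x + y).
Proof. by move=> /cposP px /cposP py; apply/cposP/normposD. Qed.

Lemma cpos0 : cpos (0 : A).
Proof. by exists 0; rewrite mulr0. Qed.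

Lemma cpos1 : cpos (1 : A).
Proof. by exists 1; rewrite star1 mulr1. Qed.

Lemma cpos_sum (I : Type) (s : seq I) (Q : pred I) (F : I -> A) :
  (forall i, Q i -> cpos (F i)) -> cpos (\sum_(i <- s | Q i) F i).
Proof. move=> H; apply: big_ind => //; [exact: cpos0|exact: cposD]. Qed.

Lemma cposZr x t : 0 <= t -> cpos x -> cpos (t%:C *: x).
Proof. by move=> t0 /cposP px; apply/cposP/normposZ. Qed.

Lemma cpos_antisym x : cpos x -> cpos (- x) -> x = 0.
Proof. by move=> /cposP px /cposP py; apply: normpos_antisym. Qed.

Lemma cpos_conj x y : cpos x -> cpos (star y * x * y).
Proof. by move=> [z ->]; exists (z * y); rewrite starM !mulrA. Qed.

Lemma cpos_add_eq0 x y : cpos x -> cpos y -> x + y = 0 -> x = 0.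
Proof.
move=> px py /eqP; rewrite addr_eq0 => /eqP xy; apply: cpos_antisym => //.
by rewrite xy opprK.
Qed.

Lemma cpos_sum_eq0 (I : finType) (F : I -> A) :
  (forall i, cpos (F i)) -> \sum_i F i = 0 -> forall i, F i = 0.
Proof.
move=> H H0 i; rewrite (bigD1 i)//= in H0.
by apply: cpos_add_eq0 H0 => //; apply: cpos_sum.
Qed.

Lemma cpos_norm_sub x : star x = x -> cpos ((cnorm x)%:C *: 1 - x).
Proof.
move=> xs; apply/cposP; split; first by rewrite starB starZr star1 xs.
exists (cnorm x); have -> : (cnorm x)%:C *: 1 - ((cnorm x)%:C *: 1 - x) = x by ncring.
exact: lexx.
Qed.

(** By [normpos_le], x + eps / 2 satisfies the norm condition with witness |x| + eps / 2, which is
    controlled uniformly as eps tends to 0. *)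
Lemma cpos_archi x : (forall eps : R, 0 < eps -> cpos (x + eps%:C *: 1)) -> cpos x.
Proof.
move=> H; apply/cposP; split.
  have /cpos_sa := H 1 ltr01; rewrite starD starZr star1; exact: addIr.
exists (cnorm x); apply/ler_addgt0Pr => e e0.
have e2 : 0 < e / 2 by lra.
have := @normpos_le _ (cnorm x + e / 2) ((cposP _).1 (H _ e2)).
have -> : (cnorm x + e / 2)%:C *: 1 - (x + (e / 2)%:C *: 1) = (cnorm x)%:C *: 1 - x.
  ncring.
move=> h; apply: le_trans (h _) _; last lra.
apply: le_trans (cnormD_le _ _) _; rewrite cnormZr cnorm1 ger0_norm; lra.
Qed.

(** c is real because c x is self-adjoint, and a negative c would make - x positive too. *)
Lemma cpos_unscale x (c : R[i]) : cpos x -> x != 0 -> cpos (c *: x) -> 0 <= c.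
Proof.
move=> px x0 pcx; have xs := cpos_sa px.
have : c *: x = conjc c *: x by rewrite -{1}(cpos_sa pcx) starZc xs.
move/eqP; rewrite -subr_eq0 -scalerBl scaler_eq0 (negPf x0) orbF subr_eq0 => /eqP cE.
have cr : c = (complex.Re c)%:C.
  move: cE; case: (c) => a b /eqP; rewrite eq_complex /= => /andP[_ /eqP h].
  by apply/eqP; rewrite eq_complex /= eqxx; apply/eqP; lra.
rewrite cr ler0c leNgt; apply/negP => c0; move/eqP: x0; apply.
apply: cpos_antisym => //; have -> : - x = (- complex.Re c)^-1%:C *: (c *: x).
  by rewrite {2}cr scalerA -rmorphM invrN mulNr mulVf ?lt_eqF// rmorphN1 scaleN1r.
by apply: cposZr => //; rewrite invr_ge0; lra.
Qed.

End CStarCone.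

Section Inclusions.
Context {R : realType} {A B : cstarAlgType R} (iota : {lrmorphism A -> B}).
Implicit Types (x y a : A).

Lemma lrmD x y : iota (x + y) = iota x + iota y. Proof. exact: raddfD. Qed.
Lemma lrmB x y : iota (x - y) = iota x - iota y. Proof. exact: raddfB. Qed.
Lemma lrm0 : iota 0 = 0. Proof. exact: raddf0. Qed.
Lemma lrm1 : iota 1 = 1. Proof. exact: rmorph1. Qed.
Lemma lrmM x y : iota (x * y) = iota x * iota y. Proof. exact: rmorphM. Qed.
Lemma lrmZ (c : R[i]) x : iota (c *: x) = c *: iota x. Proof. exact: linearZ. Qed.
Lemma lrm_sum (I : Type) (s : seq I) (Q : pred I) (F : I -> A) :
  iota (\sum_(i <- s | Q i) F i) = \sum_(i <- s | Q i) iota (F i).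
Proof. exact: raddf_sum. Qed.

Hypothesis hiota : cstar_inclusion iota.

Lemma lrm_star x : iota (star x) = star (iota x).
Proof. exact: hiota.1. Qed.

Lemma lrm_inj : injective iota.
Proof.
move=> x y /eqP; rewrite -subr_eq0 -lrmB => /eqP h; apply/eqP; rewrite -subr_eq0.
by apply/eqP/cnorm0_eq0; rewrite -hiota.2 h cnorm0.
Qed.

(** A factorization of [iota a] in B need not come from A, but the norm condition is preserved by
    [iota] in both directions. *)
Lemma lrm_cpos a : cpos (iota a) <-> cpos a.
Proof.
split=> [/cposP[as_ [t ht]]|[y ->]]; last by exists (iota y); rewrite lrmM lrm_star.
apply/cposP; split; first by apply: lrm_inj; rewrite lrm_star.
by exists t; rewrite -hiota.2 lrmB lrmZ lrm1.
Qed.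

End Inclusions.

(** * Extreme extensions of positive functionals *)

Section Sublinear.
Context {R : realType} {X : lmodType R[i]}.
Implicit Types (x y : X) (t : R) (f q p : X -> R).

Definition real_linear f :=
  (forall x y, f (x + y) = f x + f y) /\ (forall t x, f (t%:C *: x) = t * f x).

Definition sublinear q :=
  (forall x y, q (x + y) <= q x + q y) /\
  (forall t x, 0 < t -> q (t%:C *: x) = t * q x).

Definition below f q := forall x, f x <= q x.

Definition proper_convex f f1 f2 t :=
  0 < t < 1 /\ forall x, f x = t * f1 x + (1 - t) * f2 x.

(* The linear functionals below q form a face of those below p. *)
Definition facial p q := forall f f1 f2 t,
  real_linear f1 -> real_linear f2 -> below f1 p -> below f2 p ->
  proper_convex f f1 f2 t -> below f q -> below f1 q /\ below f2 q.

Lemma sublinear0 q : sublinear q -> q 0 = 0.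
Proof. move=> [_ qZ]; have := qZ 2 0 (ltr0n _ 2); rewrite scaler0; lra. Qed.

Lemma sublinear_ge q x : sublinear q -> - q (- x) <= q x.
Proof. move=> qs; have := qs.1 x (- x); rewrite subrr sublinear0//; lra. Qed.

Lemma real_linear0 f : real_linear f -> f 0 = 0.
Proof. by move=> [_ fZ]; have := fZ 0 0; rewrite scaler0 mul0r. Qed.

Lemma real_linearN f x : real_linear f -> f (- x) = - f x.
Proof.
by move=> fl; apply/eqP; rewrite -addr_eq0 -fl.1 addNr real_linear0.
Qed.

Lemma real_linearB f x y : real_linear f -> f (x - y) = f x - f y.
Proof. by move=> fl; rewrite fl.1 real_linearN. Qed.

Lemma odd_sublinear q : sublinear q -> (forall x, q (- x) <= - q x) -> real_linear q.
Proof.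
move=> qs qN; have qNE x : q (- x) = - q x.
  by apply/eqP; rewrite eq_le qN/=; have := sublinear_ge x qs; lra.
split=> [x y|t x].
  apply/eqP; rewrite eq_le qs.1 /=; have := qs.1 (- x) (- y).
  by rewrite -opprD !qNE; lra.
have [t0|t0|->] := ltgtP t 0; last by rewrite rmorph0 scale0r mul0r sublinear0.
  rewrite -[t]opprK rmorphN scaleNr qNE qs.2 ?oppr_gt0//; lra.
exact: qs.2.
Qed.

(* The linear functionals below it are those below q with f x0 = q x0. *)
Definition sharpen q x0 x : R :=
  inf [set y | exists2 t, 0 <= t & y = q (x + t%:C *: x0) - t * q x0].

Section Sharpen.
Variables (q : X -> R) (x0 : X).
Hypothesis qs : sublinear q.

Let qZ t : 0 <= t -> q (t%:C *: x0) = t * q x0.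
Proof.
rewrite le_eqVlt => /orP[/eqP<-|/qs.2//].
by rewrite rmorph0 scale0r mul0r sublinear0.
Qed.

Lemma sharpen_lb x t : 0 <= t -> - q (- x) <= q (x + t%:C *: x0) - t * q x0.
Proof.
move=> t0; have := qs.1 (x + t%:C *: x0) (- x).
by rewrite (addrC x) addrK qZ//; lra.
Qed.

Lemma sharpen_le x t : 0 <= t -> sharpen q x0 x <= q (x + t%:C *: x0) - t * q x0.
Proof.
move=> t0; apply: ge_inf; last by exists t.
by exists (- q (- x)) => _ [s s0 ->]; exact: sharpen_lb.
Qed.

Lemma sharpen_ge x (b : R) :
  (forall t, 0 <= t -> b <= q (x + t%:C *: x0) - t * q x0) -> b <= sharpen q x0 x.
Proof.
move=> H; apply: lb_le_inf; first by exists (q (x + 0%:C *: x0) - 0 * q x0), 0.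
by move=> _ [t t0 ->]; exact: H.
Qed.

Lemma sharpen_below : below (sharpen q x0) q.
Proof.
by move=> x; have := @sharpen_le x 0 (lexx _); rewrite rmorph0 scale0r addr0 mul0r subr0.
Qed.

Lemma sharpen_sublinear : sublinear (sharpen q x0).
Proof.
split=> [x y|s x s0].
  rewrite -lerBlDl; apply: sharpen_ge => t t0; rewrite lerBlDl -lerBlDr.
  apply: sharpen_ge => u u0; have := @sharpen_le (x + y) (u + t) (addr_ge0 u0 t0).
  have := qs.1 (x + u%:C *: x0) (y + t%:C *: x0).
  by rewrite addrACA -scalerDl -rmorphD; lra.
have E t z : q (s%:C *: z + (s * t)%:C *: x0) - s * t * q x0 = s * (q (z + t%:C *: x0) - t * q x0).
  by rewrite rmorphM -scalerA -scalerDr qs.2//; ring.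
apply/eqP; rewrite eq_le; apply/andP; split.
  rewrite mulrC -ler_pdivrMr//; apply: sharpen_ge => t t0.
  rewrite ler_pdivrMr// mulrC -E; apply: sharpen_le; rewrite mulr_ge0 ?(ltW s0)//.
apply: sharpen_ge => t t0; have -> : t = s * (s^-1 * t) by rewrite mulrA divff ?mul1r// gt_eqF.
rewrite E ler_pM2l//; apply: sharpen_le; rewrite mulr_ge0 ?invr_ge0 ?(ltW s0)//.
Qed.

Lemma sharpen_at : sharpen q x0 (- x0) <= - q x0.
Proof.
have := @sharpen_le (- x0) 1 ler01.
by rewrite rmorph1 scale1r addNr sublinear0// mul1r sub0r.
Qed.

Lemma below_sharpen f : real_linear f ->
  below f (sharpen q x0) <-> below f q /\ q x0 <= f x0.
Proof.
move=> fl; split=> [fq|[fq fx0] x].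
  split=> [x|]; first exact: le_trans (fq x) (sharpen_below x).
  by have := le_trans (fq (- x0)) sharpen_at; rewrite real_linearN//; lra.
apply: sharpen_ge => t t0; have := fq (x + t%:C *: x0); rewrite fl.1 fl.2.
by have := ler_wpM2l t0 fx0; lra.
Qed.

(** A proper convex combination of two values at most q x0 reaches q x0 only if both do. *)
Lemma facial_sharpen p : facial p q -> below q p -> facial p (sharpen q x0).
Proof.
move=> qf qp f f1 f2 t l1 l2 p1 p2 cf fs.
have fl : real_linear f.
  split=> [x y|s x]; rewrite !cf.2 ?l1.1 ?l2.1 ?l1.2 ?l2.2; lra.
have [fq fx0] := (below_sharpen fl).1 fs.
have [q1 q2] := qf _ _ _ _ l1 l2 p1 p2 cf fq.
have [/andP[t0 t1] fE] := cf; move: fx0; rewrite fE => fx0.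
have := q1 x0; have := q2 x0 => h2 h1.
split; apply/below_sharpen => //; split=> //; nra.
Qed.

End Sharpen.

(* Minimal facial sublinear functionals are linear, and their face of linear
   functionals below them is a point: Zorn's lemma gives the Hahn-Banach and
   the Krein-Milman theorems at once. *)
Lemma sublinear_extreme p x0 : sublinear p ->
  exists f, [/\ real_linear f, below f p, f x0 = p x0 &
    forall f1 f2 t, real_linear f1 -> real_linear f2 -> below f1 p -> below f2 p ->
      proper_convex f f1 f2 t -> f1 = f /\ f2 = f].
Proof.
move=> ps; pose p0 := sharpen p x0.
have p0p : below p0 p by exact: sharpen_below.
pose good q := [/\ sublinear q, facial p q & below q p0].
pose T := {q : X -> R | good q}.
have p0good : good p0.
  split=> //; first exact: sharpen_sublinear.
  exact: facial_sharpen.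
(* The order is reversed, so that Zorn's maximal elements are minimal functionals. *)
pose leT (q1 q2 : T) := `[< below (sval q2) (sval q1) >].
have [||||[q [qs qf qp0]] qmin] := @Zorn T leT.
- by move=> q; apply/asboolP.
- move=> q1 q2 q3 /asboolP h /asboolP h'; apply/asboolP => x; exact: le_trans (h' x) (h x).
- move=> [q1 g1] [q2 g2] /asboolP /= h /asboolP /= h'; apply: eq_exist => /=.
  by apply/funext => x; apply/eqP; rewrite eq_le h h'.
- move=> C Ctot; have [[q1 Cq1]|C0] := pselect (exists q : T, C q); last first.
    by exists (exist _ p0 p0good) => s Cs; case: C0; exists s.
  pose I x := [set y | exists2 q : T, C q & y = sval q x]; pose m x := inf (I x).
  have Ib x : has_lbound (I x).
    exists (- p0 (- x)) => _ [[q [gs gf gp]] Cq ->] /=.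
    by have := sublinear_ge x gs; have := gp (- x); lra.
  have m_le (q : T) x : C q -> m x <= sval q x by move=> Cq; apply: ge_inf => //; exists q.
  have m_ge (b : R) x : (forall q : T, C q -> b <= sval q x) -> b <= m x.
    by move=> H; apply: lb_le_inf => [|_ [q Cq ->]]; [exists (sval q1 x), q1|exact: H].
  have mgood : good m.
    split.
    + split=> [x y|s x s0].
        rewrite -lerBlDl; apply: (m_ge) => q Cq; rewrite lerBlDl -lerBlDr.
        apply: (m_ge) => r Cr; rewrite lerBlDr.
        (* Of two members of the chain the smaller one bounds the infimum at x + y and is itself
           below the other, so its subadditivity suffices. *)
        have [/asboolP qr|/asboolP rq] := Ctot q r Cq Cr.
          apply: le_trans (m_le r _ Cr) _.
          by case: (svalP r) => -[h _] _ _; apply: le_trans (h _ _) _; rewrite lerD2l.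
        apply: le_trans (m_le q _ Cq) _.
        by case: (svalP q) => -[h _] _ _; apply: le_trans (h _ _) _; rewrite lerD2r.
      apply/eqP; rewrite eq_le; apply/andP; split.
        rewrite mulrC -ler_pdivrMr//; apply: (m_ge) => q Cq; rewrite ler_pdivrMr// mulrC.
        by case: (svalP q) => -[_ h] _ _; rewrite -h//; exact: m_le.
      apply: (m_ge) => q Cq; case: (svalP q) => -[_ h] _ _; rewrite h// ler_pM2l//.
      exact: m_le.
    + move=> f f1 f2 t l1 l2 b1 b2 cf fm.
      have H (q : T) : C q -> below f1 (sval q) /\ below f2 (sval q).
        move=> Cq; case: (svalP q) => _ h _; apply: h cf _ => // x.
        exact: le_trans (fm x) (m_le _ _ Cq).
      by split=> x; apply: (m_ge) => q /H[].
    + move=> x; apply: le_trans (m_le q1 x Cq1) _.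
      by case: (svalP q1) => _ _; apply.
  by exists (exist _ m mgood) => q Cq; apply/asboolP => x /=; exact: m_le.
have qp : below q p by move=> x; exact: le_trans (qp0 x) (p0p x).
have ql : real_linear q.
  (* By minimality q equals its sharpening at x, whose value at - x is at most - q x; hence q is
     odd. *)
  apply: odd_sublinear => // x; have sg : good (sharpen q x).
    split; [exact: sharpen_sublinear|exact: facial_sharpen|].
    by move=> y; apply: le_trans (qp0 y); exact: sharpen_below.
  have E : exist good (sharpen q x) sg = exist good q (And3 qs qf qp0).
    by apply: qmin; apply/asboolP => /=; exact: sharpen_below.
  have /= {1}<- := congr1 sval E; exact: sharpen_at.
have [_ px0] := (below_sharpen x0 ps ql).1 qp0.
exists q; split=> //; first by apply/eqP; rewrite eq_le qp px0.
move=> f1 f2 t l1 l2 b1 b2 cf.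
have [h1 h2] := qf _ _ _ _ l1 l2 b1 b2 cf (fun x => lexx _).
have lin_eq f : real_linear f -> below f q -> f = q.
  move=> fl fq; apply/funext => x; apply/eqP; rewrite eq_le fq /=.
  by have := fq (- x); rewrite !real_linearN//; lra.
by split; apply: lin_eq.
Qed.

End Sublinear.

(** * Extension of positive functionals from a cofinal subspace *)

Section KreinExtension.
Context {R : realType} {X : lmodType R[i]}.
Variables (K X0 : set X) (s : X -> R).
Implicit Types (x y v : X) (t : R) (f : X -> R).

Definition pos_extension f :=
  [/\ real_linear f, forall v, X0 v -> f v = s v & forall k, K k -> 0 <= f k].

Hypotheses (K0 : K 0) (KD : forall x y, K x -> K y -> K (x + y))
  (KZ : forall t x, 0 <= t -> K x -> K (t%:C *: x)).
Hypotheses (X00 : X0 0) (X0D : forall x y, X0 x -> X0 y -> X0 (x + y))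
  (X0Z : forall t x, X0 x -> X0 (t%:C *: x)).
Hypotheses (sD : forall x y, X0 x -> X0 y -> s (x + y) = s x + s y)
  (sZ : forall t x, X0 x -> s (t%:C *: x) = t * s x).
Hypotheses (s_ge0 : forall v, X0 v -> K v -> 0 <= s v)
  (cofinal : forall x, exists2 v, X0 v & K (v - x)).

(** [p x] is the infimum of [s] over the elements of [X0] that dominate x for the order of [K].
    Lying below this gauge encodes extending [s] and being positive on [K] at once. *)
Let V x := [set y | exists2 v, X0 v /\ K (v - x) & y = s v].
Let p x := inf (V x).

Let p_lb x v v' : X0 v -> K (v - x) -> X0 v' -> K (v' + x) -> - s v' <= s v.
Proof.
move=> v0 vx v'0 v'x; have := KD vx v'x.
rewrite addrACA addNr addr0 => /(s_ge0 (X0D v0 v'0)); rewrite sD//; lra.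
Qed.

Let V_inf x : has_inf (V x).
Proof.
split; first by have [v v0 vx] := cofinal x; exists (s v), v.
have [v' v'0 v'x] := cofinal (- x); rewrite opprK in v'x.
by exists (- s v') => _ [v [v0 vx] ->]; exact: p_lb v0 vx v'0 v'x.
Qed.

Let p_le x v : X0 v -> K (v - x) -> p x <= s v.
Proof. by move=> v0 vx; apply: ge_inf; [exact: (V_inf x).2|exists v]. Qed.

Let p_ge x (b : R) : (forall v, X0 v -> K (v - x) -> b <= s v) -> b <= p x.
Proof.
by move=> H; apply: lb_le_inf; [exact: (V_inf x).1|move=> _ [v [v0 vx] ->]; exact: H].
Qed.

Let p_sublinear : sublinear p.
Proof.
split=> [x y|t x t0].
  rewrite -lerBlDl; apply: (p_ge) => v v0 vx; rewrite lerBlDl -lerBlDr.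
  apply: (p_ge) => w w0 wx; rewrite lerBlDr -sD//; apply: (p_le); first exact: X0D.
  by rewrite opprD addrACA; exact: KD.
apply/eqP; rewrite eq_le; apply/andP; split.
  rewrite mulrC -ler_pdivrMr//; apply: (p_ge) => v v0 vx; rewrite ler_pdivrMr// mulrC -sZ//.
  by apply: (p_le); [exact: X0Z|rewrite -scalerBr; apply: KZ => //; exact: ltW].
apply: (p_ge) => v v0 vx; have -> : s v = t * s (t^-1%:C *: v).
  by rewrite sZ// mulrA divff ?mul1r// gt_eqF.
rewrite ler_pM2l//; apply: (p_le); first exact: X0Z.
have -> : t^-1%:C *: v - x = t^-1%:C *: (v - t%:C *: x).
  by rewrite scalerBr scalerA -rmorphM mulVf ?gt_eqF// scale1r.
by apply: KZ => //; rewrite invr_ge0 ltW.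
Qed.

(** Evaluating f <= p at v and - v in [X0] gives f v = s v; evaluating it at - k, which 0 dominates,
    gives f k >= 0. *)
Let p_below f : real_linear f -> below f p <-> pos_extension f.
Proof.
move=> fl; split=> [fp|[_ fs fK] x]; last first.
  by apply: (p_ge) => v v0 vx; have := fK _ vx; rewrite real_linearB// fs//; lra.
have le_s v : X0 v -> f v <= s v.
  by move=> v0; apply: le_trans (fp v) _; apply: (p_le) => //; rewrite subrr.
split=> // [v v0|k Kk].
  apply/eqP; rewrite eq_le le_s//=; have := le_s _ (X0Z (-1) v0).
  by rewrite fl.2 sZ//; lra.
have := fp (- k); rewrite real_linearN// => h.
have : p (- k) <= s 0 by apply: (p_le) => //; rewrite sub0r opprK.
by have := sZ 0 X00; rewrite scaler0 mul0r; lra.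
Qed.

(* M. Krein's extension theorem, with an extreme extension taking the largest
   possible value at x0. *)
Lemma krein_extreme x0 : exists f, [/\ pos_extension f,
  forall eps, 0 < eps -> exists v, [/\ X0 v, K (v - x0) & s v < f x0 + eps] &
  forall f1 f2 t, pos_extension f1 -> pos_extension f2 ->
    proper_convex f f1 f2 t -> f1 = f /\ f2 = f].
Proof.
have [f [fl fp fx0 fext]] := sublinear_extreme x0 p_sublinear.
exists f; split; first exact/p_below.
  move=> e e0; have [_ [v [v0 vx] ->] h] := inf_adherent e0 (V_inf x0).
  by exists v; split=> //; rewrite fx0.
move=> f1 f2 t e1 e2 cf; have [[l1 _ _] [l2 _ _]] := (e1, e2).
by apply: fext cf => //; apply/p_below.
Qed.

End KreinExtension.

Section ComplexLinear.
Context {R : realType} {X : lmodType R[i]}.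
Implicit Types (x y : X) (c : R[i]).

Lemma linD (phi : X -> R[i]) : linear phi -> forall x y, phi (x + y) = phi x + phi y.
Proof. by move=> l x y; have := l 1 x y; rewrite !scale1r. Qed.

Lemma lin0 (phi : X -> R[i]) : linear phi -> phi 0 = 0.
Proof. by move=> l; apply: (@addrI _ (phi 0)); rewrite -(linD l) !addr0. Qed.

Lemma linZ (phi : X -> R[i]) : linear phi -> forall c x, phi (c *: x) = c * phi x.
Proof. by move=> l c x; have := l c x 0; rewrite (lin0 l) !addr0. Qed.

Lemma linN (phi : X -> R[i]) : linear phi -> forall x, phi (- x) = - phi x.
Proof. by move=> l x; rewrite -scaleN1r (linZ l) mulN1r. Qed.

Lemma linB (phi : X -> R[i]) : linear phi -> forall x y, phi (x - y) = phi x - phi y.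
Proof. by move=> l x y; rewrite (linD l) (linN l). Qed.

Lemma lin_sum (phi : X -> R[i]) : linear phi ->
  forall (I : Type) (s : seq I) (Q : pred I) (F : I -> X),
  phi (\sum_(i <- s | Q i) F i) = \sum_(i <- s | Q i) phi (F i).
Proof. by move=> l I s Q F; elim/big_rec2: _ => [|i a b _ <-]; rewrite ?(lin0 l) ?(linD l). Qed.

(** For a real-linear [f], the complex-linear functional with real part [f]; Krein's theorem is used
    over the reals. *)
Definition complexify (f : X -> R) x : R[i] := f x +i* - f ('i *: x).

Lemma complexify_linear f : real_linear f -> linear (complexify f).
Proof.
move=> [fD fZ] [a b] x y; rewrite /complexify scalerDr !fD.
have H u : (a +i* b) *: u = a%:C *: u + b%:C *: ('i *: u).
  rewrite scalerA -scalerDl; congr (_ *: _).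
  by apply/eqP; rewrite eq_complex /=; apply/andP; split; apply/eqP; ring.
have H' u : 'i *: ((a +i* b) *: u) = a%:C *: ('i *: u) + b%:C *: (- u).
  rewrite -scaleN1r !scalerA -scalerDl; congr (_ *: _).
  by apply/eqP; rewrite eq_complex /=; apply/andP; split; apply/eqP; ring.
have fN u : f (- u) = - f u by rewrite real_linearN.
rewrite H' H !fD !fZ fN.
by apply/eqP; rewrite eq_complex /=; apply/andP; split; apply/eqP; ring.
Qed.

Lemma Re_linear (phi : X -> R[i]) : linear phi -> real_linear (fun x => complex.Re (phi x)).
Proof.
move=> l; split=> [x y|t x]; first by rewrite (linD l); case: (phi x) (phi y) => [a b] [c d].
by rewrite (linZ l); case: (phi x) => a b /=; ring.
Qed.

Lemma complexify_Re (phi : X -> R[i]) : linear phi ->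
  complexify (fun x => complex.Re (phi x)) = phi.
Proof.
move=> l; apply/funext => x; rewrite /complexify (linZ l); case: (phi x) => a b /=.
by apply/eqP; rewrite eq_complex /=; apply/andP; split; apply/eqP; ring.
Qed.

End ComplexLinear.

Lemma complex_ge0P (R : realType) (z : R[i]) : 0 <= z <-> 0 <= complex.Re z /\ complex.Im z = 0.
Proof. by rewrite lecE /=; split=> [/andP[/eqP ? ?]|[? ->]]; rewrite ?eqxx. Qed.

Lemma ge0_line (R : realType) (q w : R[i]) :
  (forall s : R, 0 <= q + s%:C * w) -> w = 0.
Proof.
case: q w => [a b] [c d] H.
have H' s : 0 <= a + s * c /\ b + s * d = 0.
  by have /complex_ge0P := H s; rewrite /= !mul0r subr0 addr0.
have b0 : b = 0 by have [_] := H' 0; lra.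
have d0 : d = 0 by have [_] := H' 1; rewrite b0; lra.
rewrite d0; suff -> : c = 0 by [].
apply/eqP/negPn/negP => c0; have [h _] := H' (- (a + 1) / c).
by rewrite mulfVK// in h; lra.
Qed.

(** * Cauchy-Schwarz consequences for states *)

Section States.
Context {R : realType} {A : cstarAlgType R}.
Implicit Types (x y a b e : A) (phi : A -> R[i]).

Lemma state_sa phi x : is_state phi -> star x = x -> complex.Im (phi x) = 0.
Proof.
move=> [l pos _] xs; have h1 : cpos ((cnorm x)%:C *: (1 : A)).
  by apply: cposZr (cnorm_ge0 x) (cpos1).
have := pos _ (cpos_norm_sub xs); rewrite (linB l) => /complex_ge0P[_].
have /complex_ge0P[_] := pos _ h1; move: (phi (_ *: 1)) (phi x) => [a b] [c d] /=; lra.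
Qed.

Lemma state_star phi x : is_state phi -> phi (star x) = conjc (phi x).
Proof.
move=> st; have [l _ _] := st; have [a [b [as_ bs -> ->]]] := star_real_imag x.
have := state_sa st as_; have := state_sa st bs.
rewrite (linB l) (linD l) (linZ l); move: (phi a) (phi b) => [u v] [w z] /= -> ->.
by apply/eqP; rewrite eq_complex /=; apply/andP; split; apply/eqP; ring.
Qed.

(** The null case of Cauchy-Schwarz: phi is nonnegative on the square of y + c x, which is affine in
    c up to a term that phi kills. The lines c = s and c = i s, with s real, make the sum and the
    difference of the two cross terms vanish. *)
Lemma state_null phi x y : is_state phi -> phi (star x * x) = 0 ->
  phi (star y * x) = 0 /\ phi (star x * y) = 0.
Proof.
move=> [l pos _] x0.
have E c : 0 <= phi (star y * y) + (c * phi (star y * x) + conjc c * phi (star x * y)).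
  have := pos _ (ex_intro _ (y + c *: x) erefl).
  rewrite starD starZc.
  have -> : (star y + c^* *: star x) * (y + c *: x) = star y * y +
     (c *: (star y * x) + c^* *: (star x * y)) + (c * c^*) *: (star x * x) by ncring.
  by rewrite !(linD l) !(linZ l) x0 mulr0 addr0.
have h1 : phi (star y * x) + phi (star x * y) = 0.
  apply: (@ge0_line _ (phi (star y * y))) => s; rewrite mulrDr.
  by have := E s%:C; rewrite conjc_real.
have h2 : 'i * (phi (star y * x) - phi (star x * y)) = 0.
  apply: (@ge0_line _ (phi (star y * y))) => s; have := E (s%:C * 'i).
  have -> : (s%:C * 'i)^* = - (s%:C * 'i) :> R[i].
    by apply/eqP; rewrite eq_complex /=; apply/andP; split; apply/eqP; ring.
  by rewrite mulrA mulrBr mulNr.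
have i0 : 'i != 0 :> R[i] by rewrite eq_complex /= oner_eq0 andbF.
move/eqP: h2; rewrite mulf_eq0 (negPf i0) subr_eq0 => /eqP h2.
move: h1; rewrite h2 -mulr2n => /eqP; rewrite mulrn_eq0 /= => /eqP h1.
by rewrite h1.
Qed.

(** phi (1 - e) = 0, so by [state_null] phi kills the parts of b with a factor 1 - e on either
    side. *)
Lemma state_compress phi e b : is_state phi -> star e = e -> e * e = e -> phi e = 1 ->
  phi b = phi (e * b * e).
Proof.
move=> st es ee e1; have [l _ phi1] := st.
have fs : star (1 - e) = 1 - e by rewrite starB star1 es.
have ff : star (1 - e) * (1 - e) = 1 - e by rewrite fs mulrBl mul1r mulrBr mulr1 ee subrr subr0.
have f0 : phi (star (1 - e) * (1 - e)) = 0 by rewrite ff (linB l) phi1 e1 subrr.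
have [h1 _] := state_null (star b) st f0.
have [_ h2] := state_null (b * e) st f0.
have E : b = star (star b) * (1 - e) + star (1 - e) * (b * e) + e * b * e.
  by rewrite starK fs; ncring.
by rewrite {1}E !(linD l) h1 h2 !add0r.
Qed.

Lemma state_le1 phi e : is_state phi -> star e = e -> e * e = e ->
  0 <= complex.Re (phi e) <= 1 /\ complex.Im (phi e) = 0.
Proof.
move=> [l pos phi1] es ee.
have /complex_ge0P[h1 h2] : 0 <= phi e by apply: pos; exists e; rewrite es ee.
have /complex_ge0P[] : 0 <= phi (1 - e).
  apply: pos; exists (1 - e).
  by rewrite starB star1 es mulrBl mul1r mulrBr mulr1 ee subrr subr0.
rewrite (linB l) phi1 /= => h3 _; split=> //; apply/andP; split=> //.
by move: h3; case: (phi e) => a b /=; lra.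
Qed.

End States.

(** * Pure extensions of pure states *)

Section StateExtension.
Context {R : realType} {A B : cstarAlgType R} (iota : {lrmorphism A -> B}).
Hypothesis hiota : cstar_inclusion iota.
Implicit Types (phi : A -> R[i]) (psi : B -> R[i]).

(** Positive real part rather than positivity: skew elements then lie in [K] with their opposites,
    so functionals nonnegative on [K] vanish on them, and multiples of 1 dominate every element of
    B. *)
Let K : set B := [set x | cpos (x + star x)].
Let X0 : set B := range iota.
Let s phi (x : B) : R := complex.Re (phi (xget 0 [set a | iota a = x])).

Let sE phi a : s phi (iota a) = complex.Re (phi a).
Proof.
rewrite /s; congr (complex.Re (phi _)); apply: (lrm_inj hiota).
by case: xgetP => [x -> //|/(_ a) []].
Qed.

Let KE (x : B) : star x = x -> K x <-> cpos x.
Proof.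
move=> xs; rewrite /K /= xs; split=> [h|h]; last exact: cposD.
have -> : x = (2^-1 : R)%:C *: (x + x) by ncring.
by apply: cposZr h; rewrite invr_ge0.
Qed.

Let state_pos_extension phi psi : is_state phi -> is_state psi ->
  (forall a, psi (iota a) = phi a) ->
  pos_extension K X0 (s phi) (fun x => complex.Re (psi x)).
Proof.
move=> _ st ext; have [l pos _] := st; split.
- exact: Re_linear.
- by move=> _ [a _ <-]; rewrite sE ext.
- move=> k /pos; rewrite (linD l) state_star// => /complex_ge0P[+ _].
  by case: (psi k) => a b /=; lra.
Qed.

Let pos_extension_state phi f : is_state phi -> pos_extension K X0 (s phi) f ->
  is_state (complexify f) /\ forall a, complexify f (iota a) = phi a.
Proof.
move=> [l pos phi1] [fl fs fK].
have ext a : complexify f (iota a) = phi a.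
  have := complexify_Re l => /(congr1 (@^~ a)) <-; rewrite /complexify.
  by rewrite -lrmZ !fs ?sE//; [exists ('i *: a)|exists a].
split=> //; split; first exact: complexify_linear.
  move=> x px; apply/complex_ge0P; have xs := cpos_sa px.
  have Ki : K ('i *: x) by rewrite /K /= starZi xs subrr; exact: cpos0.
  have Kmi : K (- ('i *: x)) by rewrite /K /= starN starZi xs opprK addNr; exact: cpos0.
  split; first by apply: fK; apply/KE.
  by have := fK _ Ki; have := fK _ Kmi; rewrite real_linearN//=; lra.
by rewrite -(lrm1 iota) ext.
Qed.

(** If psi is a convex combination of two states, both restrict to phi because phi is pure; they are
    then extensions, and extremality makes them equal to psi. By the last clause no extension of phi
    is larger than psi at b. *)
Lemma pure_extension phi (b : B) : pure_state phi -> star b = b ->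
  exists psi, [/\ pure_state psi, forall a, psi (iota a) = phi a &
    forall eps : R, 0 < eps -> exists a, [/\ star a = a, cpos (iota a - b) &
      complex.Re (phi a) < complex.Re (psi b) + eps]].
Proof.
move=> [st pure] bs; have [l pos phi1] := st.
have Rl := Re_linear l.
have [||||||||||f [fe feps fext]] := @krein_extreme R B K X0 (s phi) _ _ _ _ _ _ _ _ _ _ b.
- by rewrite /K /= star0 addr0; exact: cpos0.
- by move=> x y; rewrite /K /= starD addrACA => hx hy; exact: cposD.
- by move=> t x t0; rewrite /K /= starZr -scalerDr => hx; exact: cposZr.
- by exists 0 => //; rewrite lrm0.
- by move=> _ _ [x _ <-] [y _ <-]; exists (x + y) => //; rewrite lrmD.
- by move=> t _ [x _ <-]; exists (t%:C *: x) => //; rewrite lrmZ.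
- by move=> _ _ [x _ <-] [y _ <-]; rewrite -lrmD !sE Rl.1.
- by move=> t _ [x _ <-]; rewrite -lrmZ !sE Rl.2.
- move=> _ [x _ <-]; rewrite /K /= -(lrm_star hiota) -lrmD => /(lrm_cpos hiota)/pos.
  rewrite (linD l) state_star// => /complex_ge0P[+ _]; rewrite sE.
  by case: (phi x) => a c /=; lra.
- move=> x; exists (iota ((cnorm (x + star x))%:C *: 1)); first by exists ((cnorm (x + star x))%:C *: 1).
  rewrite /K /= lrmZ lrm1; set n := cnorm _.
  have -> : n%:C *: 1 - x + star (n%:C *: 1 - x) = n%:C *: 1 + (n%:C *: 1 - (x + star x)) :> B.
    by rewrite starB starZr star1; ncring.
  apply: cposD; first exact: cposZr (cnorm_ge0 _) cpos1.
  by apply: cpos_norm_sub; rewrite starD starK addrC.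
have [fst fphi] := pos_extension_state st fe; exists (complexify f); split=> //.
- split=> // psi1 psi2 t st1 st2 t01 E.
  have [r1 r2] : psi1 \o iota = phi /\ psi2 \o iota = phi.
    have stc psi : is_state psi -> is_state (psi \o iota).
      move=> [pl pp p1]; split=> [c x y|x px|] /=; first by rewrite lrmD lrmZ pl.
        by apply: pp; apply/(lrm_cpos hiota).
      by rewrite lrm1.
    apply: (pure _ _ t) => //; [exact: stc|exact: stc|].
    by move=> x /=; rewrite -fphi E.
  have e1 := state_pos_extension st st1 (fun a => congr1 (@^~ a) r1).
  have e2 := state_pos_extension st st2 (fun a => congr1 (@^~ a) r2).
  have [|h1 h2] := fext _ _ t e1 e2.
    split=> // x; have := E x; rewrite /complexify.
    case: (psi1 x) (psi2 x) => [a c] [a' c'] /eqP; rewrite eq_complex /= => /andP[/eqP -> _].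
    ring.
  by split; [rewrite -h1|rewrite -h2]; rewrite complexify_Re//; [case: st1|case: st2].
- move=> eps e0; have [_ [[a _ <-] av lt]] := feps eps e0.
  (* The dominating element need not be self-adjoint; its real part dominates b as well. *)
  exists ((2^-1 : R)%:C *: (a + star a)); split.
  + by rewrite starZr starD starK addrC.
  + move: av; rewrite /K /= starB bs => av; rewrite lrmZ lrmD (lrm_star hiota).
    have -> : (2^-1 : R)%:C *: (iota a + star (iota a)) - b =
       (2^-1 : R)%:C *: (iota a - b + (star (iota a) - b)) by ncring.
    by apply: cposZr => //; rewrite invr_ge0.
  + rewrite (linZ l) (linD l) state_star//; move: lt; rewrite sE.
    by rewrite /complexify; case: (phi a) => u v /=; lra.
Qed.

(** The pure extension largest at b and the one largest at - b coincide by uniqueness, so its value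
    at b bounds that of every extension from above and from below. *)
Lemma unique_pure_extension phi : pure_state phi -> extends_uniquely iota phi ->
  forall psi1 psi2, is_state psi1 -> is_state psi2 ->
    (forall a, psi1 (iota a) = phi a) -> (forall a, psi2 (iota a) = phi a) ->
  psi1 = psi2.
Proof.
move=> pure [psi0 [_ uniq]].
have key psi1 psi2 b : is_state psi1 -> is_state psi2 ->
    (forall a, psi1 (iota a) = phi a) -> (forall a, psi2 (iota a) = phi a) ->
    star b = b -> complex.Re (psi1 b) <= complex.Re (psi2 b).
  move=> st1 st2 e1 e2 bs; have nbs : star (- b) = - b by rewrite starN bs.
  have [psi [p e H]] := pure_extension pure bs.
  have [psi' [p' e' H']] := pure_extension pure nbs.
  have E : psi' = psi by rewrite -(uniq psi)// -(uniq psi').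
  apply/ler_addgt0Pr => eps e0; have e20 : 0 < eps / 2 by lra.
  have [a [_ a1 a2]] := H _ e20; have [a' [_ a'1 a'2]] := H' _ e20.
  have [[l1 pos1 _] [l2 pos2 _]] := (st1, st2).
  have /complex_ge0P[+ _] := pos1 _ a1; have /complex_ge0P[+ _] := pos2 _ a'1.
  have lp : linear psi by case: p => -[].
  rewrite (linB l1) (linB l2) e1 e2 (linN l2); move: a'2; rewrite E (linN lp); move: a2.
  case: (psi1 b) (psi2 b) (phi a) (phi a') (psi b) => [? ?] [? ?] [? ?] [? ?] [? ?] /=; lra.
move=> psi1 psi2 st1 st2 e1 e2.
have sa b : star b = b -> psi1 b = psi2 b.
  move=> bs; have := key _ _ _ st1 st2 e1 e2 bs; have := key _ _ _ st2 st1 e2 e1 bs.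
  have := state_sa st1 bs; have := state_sa st2 bs.
  case: (psi1 b) (psi2 b) => [? ?] [? ?] /= -> -> h1 h2.
  by apply/eqP; rewrite eq_complex /= eqxx andbT eq_le h1 h2.
apply/funext => x; have [a [b [as_ bs -> _]]] := star_real_imag x.
have [[l1 _ _] [l2 _ _]] := (st1, st2).
by rewrite (linD l1) (linD l2) (linZ l1) (linZ l2) !sa.
Qed.

End StateExtension.

(** * Finite-dimensional C*-algebras *)

Lemma uniq_no_rem (T : eqType) (s : seq T) : (forall z, z \in s -> z \notin rem z s) -> uniq s.
Proof.
elim: s => //= a s IH H; have as_ : a \notin s by have := H a (mem_head _ _); rewrite eqxx.
rewrite as_ IH// => z zs; have := H z; rewrite inE zs orbT => /(_ isT).
have /negPf -> : a != z by apply: contraNneq as_ => ->.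
by rewrite inE negb_or => /andP[].
Qed.

(* A spectral theorem for algebraic self-adjoint elements of a *-algebra in
   which x^* x = 0 implies x = 0; k is the structure map of the scalars. *)
Section Spectral.
Context {R : realType} {T : nzRingType} (k : {rmorphism R[i] -> T}) (st : T -> T).
Hypotheses (stK : involutive st) (kC : forall c x, k c * x = x * k c)
  (stD : forall x y, st (x + y) = st x + st y)
  (stM : forall x y, st (x * y) = st y * st x)
  (stk : forall c, st (k c) = k (conjc c))
  (st_proper : forall x, st x * x = 0 -> x = 0).
Variable (x : T).
Hypotheses (xs : st x = x).

Let xk : commr_rmorph k x.
Proof. by move=> c; rewrite /GRing.comm kC. Qed.

Let ev : {poly R[i]} -> T := horner_morph xk.

Let evX : ev 'X = x. Proof. exact: horner_morphX. Qed.
Let evC c : ev c%:P = k c. Proof. exact: horner_morphC. Qed.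
Let evM p q : ev (p * q) = ev p * ev q. Proof. exact: rmorphM. Qed.
Let evD p q : ev (p + q) = ev p + ev q. Proof. exact: rmorphD. Qed.
Let evB p q : ev (p - q) = ev p - ev q. Proof. exact: rmorphB. Qed.

Let ev_comm p q : ev p * ev q = ev q * ev p.
Proof. by rewrite -!evM mulrC. Qed.

Let st_ev p : st (ev p) = ev (map_poly (@conjc R) p).
Proof.
elim/poly_ind: p => [|p c IH].
  by rewrite rmorph0 -(rmorph0 (@polyC _)) evC stk conjc0.
rewrite rmorphD rmorphM /= map_polyX map_polyC /= !evD !evM evX !evC stD stM stk xs IH.
by rewrite -evX ev_comm.
Qed.

Let ev_eval q c y : ev ('X - c%:P) * y = 0 -> ev q * y = k q.[c] * y.
Proof.
move=> y0; have /factor_theorem[q' E] : root (q - q.[c]%:P) c.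
  by rewrite rootE !hornerE subrr.
have -> : q = q' * ('X - c%:P) + q.[c]%:P by rewrite -E subrK.
rewrite evD evM evC mulrDl -mulrA y0 mulr0 add0r hornerD hornerM !hornerE.
by rewrite subrr mulr0 add0r.
Qed.

(** Take p annihilating x of least degree and q = p / (X - z), so that y = q(x) is nonzero and x y =
    z y. A nonreal z contradicts the self-adjointness of y^* x y; for a double root y^* y contains
    p(x) as a factor, hence vanishes. *)
Lemma spectral_annihilator : (exists2 p : {poly R[i]}, p != 0 & ev p = 0) ->
  exists2 r : seq R, uniq r & ev (\prod_(z <- r) ('X - z%:C%:P)) = 0.
Proof.
move=> [p0 p0n p00].
pose Q n := `[< exists p : {poly R[i]}, [/\ p != 0, ev p = 0 & size p = n] >].
have exQ : exists n, Q n by exists (size p0); apply/asboolP; exists p0.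
case: (ex_minnP exQ) => n /asboolP[p [pn pe sp]] nmin.
have small (q : {poly R[i]}) : q != 0 -> (size q < size p)%N -> ev q != 0.
  move=> qn sq; apply/eqP => q0; have : Q (size q) by apply/asboolP; exists q.
  by move=> /nmin; rewrite leqNgt -sp sq.
have fac z (q : {poly R[i]}) : p = q * ('X - z%:P) -> ev q != 0.
  move=> E; have qn : q != 0 by apply: contraNneq pn => q0; rewrite E q0 mul0r.
  by apply: small => //; rewrite E size_Mmonic ?monicXsubC// size_XsubC addn2.
have real_root z : root p z -> z = conjc z.
  move=> /factor_theorem[q E]; apply/eqP; apply: contraNT (fac _ _ E) => zz.
  apply/eqP/st_proper; set y := ev q.
  have xy : x * y = k z * y.
    apply/eqP; rewrite -subr_eq0 -mulrBl -evX -evC -evB -evM mulrC -E pe.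
    exact: eqxx.
  have h1 : st y * x * y = k z * (st y * y) by rewrite -mulrA xy mulrA -kC mulrA.
  have h2 : k (conjc z) * (st y * y) = k z * (st y * y).
    have <- : st (st y * x * y) = k z * (st y * y) by rewrite !stM stK xs mulrA h1.
    by rewrite h1 stM stk stM stK kC.
  have nz : z - conjc z != 0 by rewrite subr_eq0.
  have : k (z - conjc z) * (st y * y) = 0 by rewrite rmorphB mulrBl h2 subrr.
  by move=> /(congr1 ( *%R (k (z - conjc z)^-1))); rewrite mulrA -rmorphM mulVf// rmorph1 mul1r mulr0.
have simple_root z q : p = q * ('X - z%:P) -> ~~ root q z.
  move=> E; apply/negP => /factor_theorem[q' E']; have := fac _ _ E; apply/negP.
  rewrite negbK; apply/eqP/st_proper; set y := ev q.
  have zr : z = conjc z by apply: real_root; rewrite E rootM root_XsubC eqxx orbT.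
  have sx : st (ev ('X - z%:P)) = ev ('X - z%:P).
    by rewrite st_ev rmorphB /= map_polyX map_polyC /= -zr.
  by rewrite {1}/y E' evM stM sx st_ev ev_comm -mulrA /y -evM (mulrC _ q) -E pe mulr0.
have [r pE] := closed_field_poly_normal p.
have r_uniq : uniq r.
  apply: uniq_no_rem => z zr; apply/negP => zr'.
  have E : p = (lead_coef p *: \prod_(w <- rem z r) ('X - w%:P)) * ('X - z%:P).
    rewrite {1}pE (perm_big _ (perm_to_rem zr)) big_cons /= -scalerAl.
    by rewrite mulrC.
  have := simple_root _ _ E; rewrite rootZ ?lead_coef_eq0// root_prod_XsubC.
  by rewrite zr'.
have r_real z : z \in r -> (complex.Re z)%:C = z.
  move=> zr; have /real_root : root p z.
    by rewrite pE rootZ ?lead_coef_eq0// root_prod_XsubC.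
  case: (z) => a b /eqP; rewrite eq_complex /= => /andP[_ /eqP h].
  by apply/eqP; rewrite eq_complex /= eqxx; apply/eqP; lra.
exists [seq complex.Re z | z <- r].
  rewrite map_inj_in_uniq// => z w zr wr E; rewrite -(r_real z)// -(r_real w)// E.
  by [].
rewrite big_map; under eq_big_seq => z zr do rewrite r_real//.
have := congr1 ev pE; rewrite pe -mul_polyC evM evC.
have ln : lead_coef p != 0 by rewrite lead_coef_eq0.
move=> /(congr1 ( *%R (k (lead_coef p)^-1))).
by rewrite mulr0 mulrA -rmorphM mulVf// rmorph1 mul1r => <-.
Qed.

(** The projections are the Lagrange polynomials of the roots, evaluated at x. They sum to 1 because
    the sum of the polynomials minus 1 has more roots than its degree allows. *)
Lemma spectral : (exists2 p : {poly R[i]}, p != 0 & ev p = 0) ->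
  exists (r : seq R) (P : R -> T),
  [/\ uniq r, forall z, st (P z) = P z,
      forall z w, z \in r -> w \in r -> P z * P w = if z == w then P z else 0,
      \sum_(z <- r) P z = 1 & forall z, z \in r -> x * P z = k z%:C * P z].
Proof.
move=> /spectral_annihilator[r ru r0]; exists r.
pose D z : {poly R[i]} := \prod_(w <- rem z r) ('X - w%:C%:P).
pose L z := (D z).[z%:C]^-1 *: D z.
exists (fun z => ev (L z)).
have Dz z : (D z).[z%:C] != 0.
  rewrite -rootE /root/= -/(root _ _) /D -(big_map (real_complex R) xpredT (fun w => 'X - w%:P)).
  rewrite root_prod_XsubC (mem_map (@complexI R)).
  by rewrite mem_rem_uniq// inE eqxx.
have LD z w : z \in r -> w \in r -> (L z).[w%:C] = (z == w)%:R.
  move=> zr wr; rewrite /L hornerZ; have [<-|zw] := eqVneq z w; first by rewrite mulVf.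
  suff /rootP -> : root (D z) w%:C by rewrite mulr0.
  rewrite /D -(big_map (real_complex R) xpredT (fun w => 'X - w%:P)) root_prod_XsubC.
  by rewrite (mem_map (@complexI R)) mem_rem_uniq// inE eq_sym zw.
have annih z : z \in r -> ev ('X - z%:C%:P) * ev (L z) = 0.
  move=> zr; rewrite -evM /L -scalerAr -mul_polyC evM.
  have -> : ('X - z%:C%:P) * D z = \prod_(z <- r) ('X - z%:C%:P).
    by rewrite (perm_big _ (perm_to_rem zr)) big_cons.
  by rewrite r0 mulr0.
split=> // [z|z w zr wr||z zr].
- have DJ : map_poly (@conjc R) (D z) = D z.
    rewrite rmorph_prod; apply: eq_bigr => w _.
    by rewrite rmorphB /= map_polyX map_polyC /= oppr0.
  have DzJ : conjc (D z).[z%:C] = (D z).[z%:C].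
    have := horner_map (@conjc R) (D z) z%:C; rewrite DJ => h.
    exact: etrans (esym h) (congr1 (horner (D z)) (conjc_real z)).
  by rewrite st_ev /L map_polyZ /= DJ conjc_inv DzJ.
- by rewrite (ev_eval _ (annih w wr)) LD//; case: eqVneq => [->|_]; rewrite ?rmorph1 ?mul1r ?rmorph0 ?mul0r.
- suff E : \sum_(z <- r) L z = 1.
    by rewrite -(rmorph_sum (horner_morph xk)) E rmorph1.
  apply/eqP; rewrite -subr_eq0; apply/eqP.
  apply: (@roots_geq_poly_eq0 _ _ (map (real_complex R) r)).
  + apply/allP => _ /mapP[z zr ->]; rewrite /root !hornerE horner_sum.
    rewrite (bigD1_seq z)//= LD// eqxx big1_seq ?addr0 ?subrr// => w /andP[wz wr].
    by rewrite LD// (negPf wz).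
  + by rewrite (map_inj_uniq (@complexI R)).
  + rewrite size_map; apply: leq_trans (size_polyD _ _) _.
    rewrite size_polyN size_poly1 geq_max; apply/andP; split; last first.
      case: (r) r0 => //=; by rewrite big_nil -polyC1 evC rmorph1 => /eqP; rewrite oner_eq0.
    apply: leq_trans (size_sum _ _ _) _; apply/bigmax_leqP_seq => z zr _.
    apply: leq_trans (size_scale_leq _ _) _; rewrite size_prod_XsubC size_rem//.
    by case: (r) zr.
- by have := annih z zr; rewrite evB evX evC mulrBl => /eqP; rewrite subr_eq0 => /eqP.
Qed.

End Spectral.

Lemma finite_dim_fin (K : fieldType) (V : lmodType K) (I : finType) (e : I -> V) :
  (forall v, exists c : I -> K, v = \sum_i c i *: e i) -> finite_dim V.
Proof.
move=> H; exists #|I|, (fun i => e (enum_val i)) => v; have [c ->] := H v.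
exists (fun i => c (enum_val i)).
by rewrite (reindex (@enum_val I I)) //=; exact: onW_bij (@enum_val_bij I).
Qed.

Lemma finite_dim_dependent (K : fieldType) (V : lmodType K) : finite_dim V ->
  exists n, forall v : 'I_n.+1 -> V, exists c : 'I_n.+1 -> K,
    (exists i, c i != 0) /\ \sum_i c i *: v i = 0.
Proof.
move=> [n [e H]]; exists n => v.
have [C HC] := choice (fun i => H (v i)).
pose M := \matrix_(i < n.+1, j < n) C i j.
have : kermx M != 0.
  by rewrite -mxrank_eq0 mxrank_ker subn_eq0 -ltnNge ltnS rank_leq_col.
move=> /rowV0Pn[w /sub_kermxP wM w0]; have [i wi] := rV0Pn _ w0.
exists (w 0); split; first by exists i.
under eq_bigr => j _ do rewrite HC scaler_sumr.
rewrite exchange_big big1//= => l _.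
under eq_bigr => j _ do rewrite scalerA.
rewrite -scaler_suml; have /rowP/(_ l) := wM; rewrite !mxE.
by under eq_bigr => j _ do rewrite mxE; move=> ->; rewrite scale0r.
Qed.

Lemma finite_dim_ffun (K : fieldType) (V : lmodType K) (I : finType) :
  finite_dim V -> finite_dim {ffun I -> V}.
Proof.
move=> [n [e H]].
apply: (@finite_dim_fin _ _ (I * 'I_n)%type (fun p => [ffun i => if i == p.1 then e p.2 else 0])) => v.
have [c Hc] := choice (fun i => H (v i)); exists (fun p => c p.1 p.2).
apply/ffunP => i; rewrite Hc sum_ffunE -(pair_bigA _ (fun i0 j => (c i0 j *: [ffun i1 => if i1 == i0 then e j else 0]) i)) /=.
rewrite (bigD1 i)//= [X in _ + X]big1 ?addr0 => [|j ji].
  by apply: eq_bigr => l _; rewrite !ffunE eqxx.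
by rewrite big1// => l _; rewrite !ffunE eq_sym (negPf ji) scaler0.
Qed.

(** [T] is only required to embed in a finite-dimensional module through [phi], which covers both A
    and the matrix rings over A. *)
Lemma finite_dim_algebraic (K : fieldType) (V : lmodType K) (T : nzRingType)
    (k : {rmorphism K -> T}) (phi : T -> V) (x : T) (xk : commr_rmorph k x) :
  finite_dim V -> (forall a b, phi (a + b) = phi a + phi b) ->
  (forall c a, phi (k c * a) = c *: phi a) -> injective phi ->
  exists2 p : {poly K}, p != 0 & horner_morph xk p = 0.
Proof.
move=> /finite_dim_dependent[n H] phiD phiZ phiI.
have [c [[i ci] c0]] := H (fun i => phi (x ^+ i)).
exists (\poly_(j < n.+1) c (inord j)).
  by apply: contraNneq ci => /polyP/(_ i); rewrite coef_poly ltn_ord coef0 inord_val => ->.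
have phi0 : phi 0 = 0 by apply: (@addrI _ (phi 0)); rewrite -phiD !addr0.
apply: phiI; rewrite phi0 -c0 poly_def rmorph_sum /=.
rewrite (big_morph phi phiD phi0); apply: eq_bigr => j _.
by rewrite -mul_polyC rmorphM rmorphXn /= horner_morphX horner_morphC phiZ inord_val.
Qed.

Section FiniteDimensional.
Context {R : realType} {A : cstarAlgType R}.
Hypothesis hA : finite_dim A.
Implicit Types (a x y e q : A) (c : R[i]).

Lemma cstar_spectral x : star x = x -> exists (r : seq R) (P : R -> A),
  [/\ uniq r, forall z, star (P z) = P z,
      forall z w, z \in r -> w \in r -> P z * P w = if z == w then P z else 0,
      \sum_(z <- r) P z = 1 & forall z, z \in r -> x * P z = z%:C *: P z].
Proof.
move=> xs; pose k : {rmorphism R[i] -> A} := in_alg A.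
have kC c y : k c * y = y * k c by rewrite /k /= -scalerAl -scalerAr mul1r mulr1.
have stk c : star (k c) = k c^* by rewrite /k /= starZc star1.
have xk : commr_rmorph k x by move=> c; rewrite /GRing.comm kC.
have := @spectral R A k star (@starK R A) kC (@starD R A) (@starM R A) stk
  (@starM_eq0 R A) x xs.
case.
  have [p p0 pe] := @finite_dim_algebraic _ _ A k id x xk hA (fun _ _ => erefl)
    (fun c a => mulr_algl c a) (fun _ _ => id).
  (* [horner_morph] takes a proof of commutation as an argument, and the two proofs at hand are
     identified by proof irrelevance. *)
  by exists p => //; rewrite -[RHS]pe; congr (horner_morph _ p); exact: Prop_irrelevance.
move=> r [P [h1 h2 h3 h4 h5]]; exists r, P; split=> // z zr; rewrite h5//.
by rewrite /k /= mulr_algl.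
Qed.

Definition is_proj e := star e = e /\ e * e = e.

Definition minproj e := [/\ is_proj e, e != 0 & forall a, exists c, e * a * e = c *: e].

Lemma projB e q : is_proj e -> is_proj q -> e * q = q -> is_proj (e - q).
Proof.
move=> [es ee] [qs qq] eq; have qe : q * e = q by rewrite -qs -es -starM eq.
by split; [rewrite starB es qs|rewrite mulrBr !mulrBl ee eq qe qq subrr subr0].
Qed.

(** Some self-adjoint a has e a e outside C e. The spectral projections of e a e at nonzero
    eigenvalues lie under e; if each were 0 or e, then e a e would be a multiple of e. *)
Lemma split_proj e : is_proj e -> ~ (forall a, exists c, e * a * e = c *: e) ->
  exists q, [/\ is_proj q, q != 0, q != e & e * q = q].
Proof.
move=> [es ee] /existsNP[a0 a0n].
have [a [as_ an]] : exists a, star a = a /\ ~ exists c, e * a * e = c *: e.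
  have [b [d [bs ds E _]]] := star_real_imag a0.
  have [[c bc]|nb] := pselect (exists c, e * b * e = c *: e); last by exists b.
  exists d; split=> // -[c' dc]; apply: a0n; exists (c + 'i * c').
  by rewrite E mulrDr mulrDl bc -scalerAr -scalerAl dc scalerDl scalerA.
pose x := e * a * e; have xs : star x = x by rewrite /x !starM es as_ mulrA.
have [r [P [ru Ps PP P1 Px]]] := cstar_spectral xs.
have ex : e * x = x by rewrite /x !mulrA ee.
have xe : x * e = x by rewrite /x -!mulrA ee.
have eP z : z \in r -> z != 0 -> e * P z = P z.
  move=> zr z0; have zc : z%:C != 0 :> R[i] by rewrite -(rmorph0 (real_complex R)) (inj_eq (@complexI R)).
  have -> : P z = z%:C^-1 *: (x * P z) by rewrite Px// scalerA mulVf// scale1r.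
  by rewrite -scalerAr mulrA ex.
have xE : x = \sum_(z <- r) z%:C *: P z.
  rewrite -[LHS]mulr1 -P1 mulr_sumr; apply: eq_big_seq => z zr; exact: Px.
apply: contrapT => nq.
have H z : z \in r -> z != 0 -> P z = 0 \/ P z = e.
  move=> zr z0; have [|P0] := eqVneq (P z) 0; first by left.
  have [|Pe] := eqVneq (P z) e; first by right.
  case: nq; exists (P z); split=> //; last exact: eP.
  by split=> //; rewrite PP// eqxx.
have [[z [zr z0 Pz]]|no] := pselect (exists z, [/\ z \in r, z != 0 & P z = e]).
  apply: an; exists z%:C; rewrite -/x xE (bigD1_seq z)//= Pz.
  rewrite big1_seq ?addr0// => w /andP[wz wr]; have [->|w0] := eqVneq w 0.
    by rewrite rmorph0 scale0r.
  by rewrite -(eP w)// -Pz PP// eq_sym (negPf wz) scaler0.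
apply: an; exists 0; rewrite -/x scale0r xE big1_seq// => z /andP[_ zr].
have [->|z0] := eqVneq z 0; first by rewrite rmorph0 scale0r.
have [->|Pe] := H z zr z0; first by rewrite scaler0.
by case: no; exists z.
Qed.

Let orth_family N (p : 'I_N -> A) e := [/\ forall i, is_proj (p i), forall i, p i != 0,
  forall i j, i != j -> p i * p j = 0 & \sum_i p i = e].

(** Nonzero orthogonal projections are linearly independent, so a family of largest size exists;
    splitting a non-minimal member would give a larger one. *)
Lemma minproj_decomp e : is_proj e -> exists N (p : 'I_N -> A),
  [/\ forall i, minproj (p i), forall i j, i != j -> p i * p j = 0 & \sum_i p i = e].
Proof.
move=> pe; have [n dep] := finite_dim_dependent hA.
pose Q N := `[< exists p : 'I_N -> A, orth_family p e >].
have Qb N : Q N -> (N <= n)%N.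
  move=> /asboolP[p [pp p0 po _]]; rewrite leqNgt; apply/negP => nN.
  have [c [[i ci] c0]] := dep (fun j => p (widen_ord nN j)).
  have := congr1 ( *%R (p (widen_ord nN i))) c0.
  rewrite mulr0 mulr_sumr (bigD1 i)//= big1 => [|j ji].
    rewrite addr0 -scalerAr (pp _).2 => /eqP.
    by rewrite scaler_eq0 (negPf ci) (negPf (p0 _)).
  rewrite -scalerAr po ?scaler0//; apply: contra_neq ji => E.
  by apply: ord_inj; have := congr1 val E.
have exQ : exists N, Q N.
  have [e0|e0] := eqVneq e 0.
    exists 0%N; apply/asboolP; exists (fun=> 0); split=> [[]|[]|[]|] //.
    by rewrite big_ord0.
  exists 1%N; apply/asboolP; exists (fun=> e); split=> // [i j|].
    by rewrite !ord1 eqxx.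
  by rewrite big_ord1.
case: (ex_maxnP exQ Qb) => N /asboolP[p [pp p0 po ps]] Nmax.
exists N, p; split=> // i; split=> //; apply: contrapT => /(split_proj (pp i)).
move=> [q [qp q0 qn piq]].
have qpi : q * p i = q by rewrite -(pp i).1 -qp.1 -starM piq.
(* p i is replaced by q at its own index, and p i - q goes to the new index [ord0]. *)
pose g (j : 'I_N.+1) := oapp (fun j' => if j' == i then q else p j') (p i - q) (unlift ord0 j).
suff : Q N.+1 by move=> /Nmax; rewrite ltnn.
have piqp : is_proj (p i - q) by exact: projB.
have qpj j : j != i -> q * p j = 0.
  by move=> ji; rewrite -qpi -mulrA po ?mulr0// eq_sym.
have pjq j : j != i -> p j * q = 0.
  by move=> ji; rewrite -piq mulrA po ?mul0r.
apply/asboolP; exists g; split.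
- by move=> j; rewrite /g; case: unliftP => [j' _|_] //=; case: ifP.
- move=> j; rewrite /g; case: unliftP => [j' _|_] /=; first by case: ifP.
  by rewrite subr_eq0 eq_sym.
- move=> j l; rewrite /g; case: unliftP => [j' ->|->]; case: unliftP => [l' ->|->] /=.
  + rewrite (inj_eq lift_inj) => jl.
    case: ifPn => [/eqP ji|ji]; case: ifPn => [/eqP li|li].
    * by rewrite ji li eqxx in jl.
    * exact: qpj.
    * exact: pjq.
    * exact: po.
  + move=> _; case: ifPn => [/eqP _|ji].
      by rewrite mulrBr qpi qp.2 subrr.
    by rewrite mulrBr po// pjq// subrr.
  + move=> _; case: ifPn => [/eqP _|li].
      by rewrite mulrBl piq qp.2 subrr.
    by rewrite mulrBl po ?qpj ?subrr// eq_sym.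
  + by [].
- rewrite big_ord_recl {1}/g unlift_none /= -ps (bigD1 i)//= [RHS](bigD1 i)//=.
  rewrite /g liftK /= eqxx addrA subrK; congr (_ + _).
  by apply: eq_bigr => j ji; rewrite liftK /= (negPf ji).
Qed.

End FiniteDimensional.

(** * Minimal projections, their pure states and their equivalence *)

Section MinimalProjectionState.
Context {R : realType} {A : cstarAlgType R}.
Implicit Types (a x y e : A) (c : R[i]).

(* The state given by compression to a minimal projection e; a junk value when
   e * a * e is not a multiple of e. *)
Definition mps e a : R[i] := xget 0 [set c | e * a * e = c *: e].

Lemma mpsE e a : minproj e -> e * a * e = mps e a *: e.
Proof.
move=> [_ _ /(_ a)[c ec]]; rewrite /mps.
by case: xgetP => [x -> //|/(_ c) []].
Qed.

Lemma scale_inj e c c' : e != 0 -> c *: e = c' *: e -> c = c'.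
Proof.
move=> e0 /eqP; rewrite -subr_eq0 -scalerBl scaler_eq0 (negPf e0) orbF subr_eq0.
by move/eqP.
Qed.

Lemma mps_eq e a c : minproj e -> e * a * e = c *: e -> mps e a = c.
Proof. by move=> me; rewrite mpsE//; case: me => _ e0 _; exact: scale_inj. Qed.

Lemma proj_cpos e : is_proj e -> cpos e.
Proof. by move=> [es ee]; exists e; rewrite es ee. Qed.

Lemma mps_state e : minproj e -> is_state (mps e).
Proof.
move=> me; have [[es ee] e0 _] := me; split=> [c x y|x px|].
- apply: mps_eq => //; rewrite mulrDr mulrDl -scalerAr -scalerAl !mpsE//.
  by rewrite scalerA -scalerDl.
- apply: (@cpos_unscale _ _ e) => //; first exact: proj_cpos.
  by rewrite -mpsE// -{1}es; exact: cpos_conj.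
- by apply: mps_eq; rewrite // mulr1 ee scale1r.
Qed.

Lemma mps_proj e : minproj e -> mps e e = 1.
Proof. by move=> me; apply: mps_eq => //; case: me => -[_ ee] _ _; rewrite !ee scale1r. Qed.

(** In a convex decomposition the values at e lie in [0, 1] and average to 1, so both are 1;
    [state_compress] then makes each component the compression to e. *)
Lemma mps_pure e : minproj e -> pure_state (mps e).
Proof.
move=> me; have st := mps_state me; have [[es ee] e0 _] := me.
split=> // psi1 psi2 t st1 st2 /andP[t0 t1] E.
have uniq psi : is_state psi -> psi e = 1 -> psi = mps e.
  move=> stp pe; apply/funext => a; have [l _ _] := stp.
  by rewrite (state_compress a stp es ee pe) mpsE// linZ// pe mulr1.
have := E e; rewrite mps_proj//.
have [/andP[_ h1] i1] := state_le1 st1 es ee; have [/andP[_ h2] i2] := state_le1 st2 es ee.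
move=> /(congr1 (@complex.Re R)); move: i1 i2 h1 h2.
case E1: (psi1 e) => [a b]; case E2: (psi2 e) => [c d] /= b0 d0 h1 h2 h3.
have a1 : a = 1 by nra.
have c1 : c = 1 by nra.
by split; apply: uniq => //; rewrite ?E1 ?E2 ?a1 ?c1 ?b0 ?d0.
Qed.

(** For x = e a f nonzero, x^* x is a positive multiple of f, so a rescaling w has w^* w = f; then w
    w^* is a nonzero idempotent in C e. *)
Lemma minproj_partial_isometry e f a : minproj e -> minproj f -> e * a * f != 0 ->
  exists w, [/\ e * w = w, w * f = w, star w * w = f & w * star w = e].
Proof.
move=> me mf x0; set x := e * a * f in x0.
have [[es ee] e0 _] := me; have [[fs ff] f0 _] := mf.
have ex : e * x = x by rewrite /x !mulrA ee.
have xf : x * f = x by rewrite /x -!mulrA ff.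
have fxs : f * star x = star x by rewrite -[in LHS]fs -starM xf.
have xx : star x * x = mps f (star x * x) *: f.
  by rewrite -mpsE// mulrA fxs -mulrA xf.
have px : cpos (star x * x) by exists x.
have c0 : mps f (star x * x) != 0.
  by apply: contra_neq x0 => c0; apply: starM_eq0; rewrite xx c0 scale0r.
have /complex_ge0P[] : 0 <= mps f (star x * x) by case: (mps_state mf) => _ h _; exact: h.
move: c0 xx; case: (mps f _) => t s /= c0 + t0 s0; rewrite {}s0 in c0 *.
rewrite -/(t%:C) => xx; have tp : 0 < t.
  rewrite lt_neqAle t0 andbT; apply: contra_neq c0 => <-.
  by [].
pose w := (Num.sqrt t)^-1%:C *: x.
have ww : star w * w = f.
  rewrite /w starZr -scalerAl -scalerAr xx !scalerA -!rmorphM.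
  by rewrite -{3}(sqr_sqrtr t0) expr2 mulrA mulfVK ?mulVf ?scale1r// gt_eqF// sqrtr_gt0.
have ew : e * w = w by rewrite /w -scalerAr ex.
have wf : w * f = w by rewrite /w -scalerAl xf.
exists w; split=> //.
have wwe : w * star w = mps e (w * star w) *: e.
  by rewrite -mpsE// -{2}es mulrA ew -mulrA -starM ew.
have idem : (w * star w) * (w * star w) = w * star w.
  by rewrite mulrA -(mulrA w) ww wf.
have w0 : w != 0 by apply: contra_neq f0 => w0; rewrite -ww w0 mulr0.
move: idem; rewrite wwe -scalerAl -scalerAr ee scalerA => /(scale_inj e0).
move=> /eqP; rewrite -{3}[mps _ _]mulr1 -subr_eq0 -mulrBr mulf_eq0 => /orP[/eqP c'0|].
  move: wwe; rewrite c'0 scale0r -{1}(starK w) => /starM_eq0 /(congr1 star).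
  by rewrite starK star0 => /eqP; rewrite (negPf w0).
by rewrite subr_eq0 => /eqP ->; rewrite scale1r.
Qed.

End MinimalProjectionState.

(** * Matrix units *)

Section Frames.
Context {R : realType} {A : cstarAlgType R}.

(* A system of matrix units of A = sum_k M_{n_k}, without the bookkeeping: the
   u i with kap i = k play the role of the first column e_{i1} of the k-th
   summand, and e k that of its corner e_{11}. *)
Definition is_frame N (u : 'I_N -> A) (kap : 'I_N -> 'I_N) (e : 'I_N -> A) : Prop :=
  [/\ forall k, minproj (e k),
      \sum_i u i * star (u i) = 1,
      forall i, star (u i) * u i = e (kap i),
      forall i j, i != j -> star (u i) * u j = 0 &
      forall i j a, kap i != kap j -> star (u i) * a * u j = 0].

(** Decompose 1 into minimal projections p_i. By the partial isometries, p_i A p_j <> 0 is an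
    equivalence relation, whose classes are the blocks; u_i links p_i to the representative of its
    class. *)
Lemma frame_exists : finite_dim A -> exists N u kap e, @is_frame N u kap e.
Proof.
move=> hA; have p1 : is_proj (1 : A) by split; rewrite ?star1 ?mulr1.
have [N [p [pm po ps]]] := minproj_decomp hA p1.
pose r i j := `[< exists a, p i * a * p j <> 0 >].
have rxx i : r i i.
  apply/asboolP; exists 1; have [[_ pp] p0 _] := pm i.
  by rewrite mulr1 pp; apply/eqP.
have rW i j : r i j -> exists w, [/\ p i * w = w, w * p j = w, star w * w = p j & w * star w = p i].
  by move=> /asboolP[a /eqP]; exact: minproj_partial_isometry.
have rsym i j : r i j -> r j i.
  move=> /rW[w [w1 w2 w3 w4]]; apply/asboolP; exists (star w).
  have [[ps_ _] p0 _] := pm i; have [[pjs _] pj0 _] := pm j.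
  rewrite -[p j]pjs -starM w2 -[p i]ps_ -starM w1 => /(congr1 star).
  by rewrite starK star0 => w0; move: pj0; rewrite -w3 w0 mulr0 eqxx.
have rtrans i j l : r i j -> r j l -> r i l.
  move=> /rW[w [w1 w2 w3 w4]] /rW[v [v1 v2 v3 v4]]; apply/asboolP; exists (w * v).
  rewrite -!mulrA v2 mulrA w1 => /(congr1 ( *%R (star w))).
  rewrite mulr0 mulrA w3 v1 => v0; have [_ p0 _] := pm l.
  by move: p0; rewrite -v3 v0 mulr0 eqxx.
(* [pick] depends only on the predicate, so equivalent indices get the same representative; r i i
   holds, so the default is never taken. *)
pose kap i := odflt i [pick j | r i j].
have rkap i : r i (kap i).
  by rewrite /kap; case: pickP => [j //|/(_ i)]; rewrite rxx.
have kapE i j : r i j -> kap i = kap j.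
  move=> ij; have E : r i =1 r j.
    by move=> l; apply/idP/idP => h; [exact: rtrans (rsym _ _ ij) h|exact: rtrans ij h].
  rewrite /kap (eq_pick E); case: pickP => [//|/(_ j)]; by rewrite rxx.
have [u Hu] := choice (fun i => rW _ _ (rkap i)).
exists N, u, kap, p; split=> //.
- by rewrite -ps; apply: eq_bigr => i _; case: (Hu i).
- by move=> i; case: (Hu i).
- move=> i j ij; have [u1 _ _ _] := Hu i; have [v1 _ _ _] := Hu j.
  have [[ps_ _] _ _] := pm i.
  by rewrite -u1 -v1 starM ps_ mulrA -(mulrA (star (u i))) po// mulr0 mul0r.
- move=> i j a ij; apply: contra_neqP ij => /eqP h; apply: kapE.
  have [_ u1 _ _] := Hu i; have [_ v1 _ _] := Hu j.
  apply: (rtrans _ _ _ (rkap i)); apply: (rtrans _ (kap j)); last exact: rsym.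
  apply/asboolP; exists (star (u i) * a * u j).
  have [[ps_ _] _ _] := pm (kap i).
  by rewrite !mulrA -[p (kap i)]ps_ -starM u1 -(mulrA _ (u j)) v1; apply/eqP.
Qed.

Context {N : nat} {u : 'I_N -> A} {kap : 'I_N -> 'I_N} {e : 'I_N -> A}.
Hypothesis fr : is_frame u kap e.

Lemma frame_minproj k : minproj (e k). Proof. by case: fr. Qed.
Lemma frame_sum : \sum_i u i * star (u i) = 1. Proof. by case: fr. Qed.
Lemma frame_uu i : star (u i) * u i = e (kap i). Proof. by case: fr. Qed.
Lemma frame_orth i j : i != j -> star (u i) * u j = 0. Proof. by case: fr => _ _ _ h _; exact: h. Qed.
Lemma frame_disj i j a : kap i != kap j -> star (u i) * a * u j = 0.
Proof. by case: fr => _ _ _ _; exact. Qed.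
Lemma frame_proj k : is_proj (e k). Proof. by case: (frame_minproj k). Qed.
Lemma frame_ue i : u i * e (kap i) = u i.
Proof.
have [es ee] := frame_proj (kap i).
apply/eqP; rewrite -subr_eq0; apply/eqP/starM_eq0.
rewrite starB starM es mulrBl !mulrBr -!mulrA !(mulrA (star (u i))) frame_uu.
by rewrite !ee !subrr.
Qed.

Lemma frame_eu i : e (kap i) * star (u i) = star (u i).
Proof. by rewrite -[e _](frame_proj _).1 -starM frame_ue. Qed.

Lemma frame_coef i j a : kap i = kap j ->
  star (u i) * a * u j = mps (e (kap i)) (star (u i) * a * u j) *: e (kap i).
Proof.
move=> ij; rewrite -mpsE; last exact: frame_minproj.
by rewrite !mulrA frame_eu -!mulrA ij frame_ue.
Qed.

Lemma frame_mulr_sum l a : a * e (kap l) = a ->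
  a = \sum_(i | kap i == kap l) mps (e (kap l)) (star (u i) * a) *: u i.
Proof.
move=> al; rewrite -[LHS]mul1r -frame_sum mulr_suml [RHS]big_mkcond; apply: eq_bigr => i _.
case: eqP => [il|/eqP il]; last first.
  have z : star (u i) * a = 0.
    by rewrite -al -frame_uu !mulrA -(mulrA _ a) frame_disj.
  by rewrite -mulrA z mulr0.
have E : star (u i) * a = mps (e (kap l)) (star (u i) * a) *: e (kap l).
  by rewrite -(mpsE _ (frame_minproj (kap l))) -!mulrA al -il mulrA frame_eu.
by rewrite -mulrA {1}E -scalerAr -il frame_ue.
Qed.

End Frames.

(** * Positive matrices and completely positive maps *)

Section MatrixPositivity.
Context {R : realType} {A : cstarAlgType R}.
Implicit Types (n : nat) (c : R[i]).

Definition mxform n (M : 'M[A]_n) (x y : 'I_n -> A) : A :=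
  \sum_p \sum_q star (x p) * M p q * y q.

Lemma mxformDl n (M : 'M[A]_n) x x' y :
  mxform M (fun p => x p + x' p) y = mxform M x y + mxform M x' y.
Proof.
rewrite /mxform -big_split; apply: eq_bigr => p _; rewrite -big_split.
by apply: eq_bigr => q _; rewrite starD !mulrDl.
Qed.

Lemma mxformDr n (M : 'M[A]_n) x y y' :
  mxform M x (fun p => y p + y' p) = mxform M x y + mxform M x y'.
Proof.
rewrite /mxform -big_split; apply: eq_bigr => p _; rewrite -big_split.
by apply: eq_bigr => q _; rewrite mulrDr.
Qed.

Lemma mxformZl n (M : 'M[A]_n) c x y :
  mxform M (fun p => c *: x p) y = conjc c *: mxform M x y.
Proof.
rewrite /mxform scaler_sumr; apply: eq_bigr => p _; rewrite scaler_sumr.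
by apply: eq_bigr => q _; rewrite starZc -!scalerAl.
Qed.

Lemma mxformZr n (M : 'M[A]_n) c x y :
  mxform M x (fun p => c *: y p) = c *: mxform M x y.
Proof.
rewrite /mxform scaler_sumr; apply: eq_bigr => p _; rewrite scaler_sumr.
by apply: eq_bigr => q _; rewrite -!scalerAr.
Qed.

Lemma mxform_star n (M : 'M[A]_n) x y : star (mxform M x y) = mxform (mxstar M) y x.
Proof.
rewrite /mxform star_sum; under eq_bigr => p _ do rewrite star_sum.
rewrite exchange_big; apply: eq_bigr => p _; apply: eq_bigr => q _.
by rewrite !mxE !starM starK mulrA.
Qed.

(** With b and d the two cross terms, the last two hypotheses say b + d = 0 and i (b - d) = 0. *)
Lemma mxform_polar n (M : 'M[A]_n) x y :
  mxform M x x = 0 -> mxform M y y = 0 ->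
  mxform M (fun p => x p + y p) (fun p => x p + y p) = 0 ->
  mxform M (fun p => x p + 'i *: y p) (fun p => x p + 'i *: y p) = 0 ->
  mxform M x y = 0.
Proof.
rewrite !mxformDl !mxformDr !mxformZl !mxformZr => -> -> .
set b := mxform M x y; set d := mxform M y x.
rewrite !scaler0 !add0r !addr0 => h1 h2.
have E : 'i^* = - 'i :> R[i] by apply/eqP; rewrite eq_complex /= oppr0 !eqxx.
have db : d = - b by apply/eqP; rewrite -addr_eq0 addrC h1.
move: h2; rewrite E db scaleNr scalerN opprK => h2.
have := congr1 ( *:%R (- 'i)) h2; rewrite scaler0 scalerDr !scalerA mulNr mulii opprK scale1r.
by rewrite -mulr2n => /eqP; rewrite -scaler_nat scaler_eq0 pnatr_eq0 /= => /eqP.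
Qed.

Lemma mxform_gram n (Y : 'M[A]_n) x :
  mxform (mxstar Y *m Y) x x =
  \sum_r star (\sum_p Y r p * x p) * (\sum_p Y r p * x p).
Proof.
rewrite /mxform; under eq_bigr => p _ do under eq_bigr => q _ do rewrite !mxE mulr_sumr mulr_suml.
under eq_bigr => p _ do rewrite exchange_big.
rewrite exchange_big; apply: eq_bigr => r _.
rewrite star_sum mulr_suml; apply: eq_bigr => p _; rewrite mulr_sumr.
by apply: eq_bigr => q _; rewrite !mxE starM !mulrA.
Qed.

Lemma mxpos_form n (M : 'M[A]_n) x : mxpos M -> cpos (mxform M x x).
Proof.
by move=> [Y ->]; rewrite mxform_gram; apply: cpos_sum => r _; exists (\sum_p Y r p * x p).
Qed.

Lemma mxstarK n m (M : 'M[A]_(n, m)) : mxstar (mxstar M) = M.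
Proof. by apply/matrixP => i j; rewrite !mxE starK. Qed.

Lemma mxstarM m n p (M : 'M[A]_(m, n)) (N : 'M[A]_(n, p)) :
  mxstar (M *m N) = mxstar N *m mxstar M.
Proof.
apply/matrixP => i j; rewrite !mxE star_sum.
by apply: eq_bigr => l _; rewrite !mxE starM.
Qed.

Lemma mxstarM_eq0 n (X : 'M[A]_n) : mxstar X *m X = 0 -> X = 0.
Proof.
move=> X0; apply/matrixP => r q; rewrite mxE.
have := congr1 (fun M : 'M[A]_n => M q q) X0; rewrite !mxE => /cpos_sum_eq0 h.
apply: starM_eq0; have := h _ r; rewrite !mxE; apply=> i; rewrite !mxE.
by exists (X i q).
Qed.

Context {N : nat} {u : 'I_N -> A} {kap : 'I_N -> 'I_N} {e : 'I_N -> A}.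
Hypotheses (hA : finite_dim A) (fr : is_frame u kap e).

Lemma frame_eq0 (a : A) : (forall i, a * u i = 0) -> a = 0.
Proof.
move=> h; rewrite -[a]mulr1 -(frame_sum fr) mulr_sumr big1// => i _.
by rewrite mulrA h mul0r.
Qed.

(** A nonzero spectral projection at z < 0 has an entry not killed by some u_l; its column times u_l
    is a test vector x on which the form is z times the sum of the x_p^* x_p, which is not positive.
    Otherwise the square roots of the eigenvalues give a root of M. *)
Lemma mxpos_spectral n (M : 'M[A]_n) : mxstar M = M ->
  (forall l x, (forall p, x p * e (kap l) = x p) -> cpos (mxform M x x)) -> mxpos M.
Proof.
case: n M => [|n] M Ms Mpos; first by exists 0; apply/matrixP => -[].
pose k : {rmorphism R[i] -> 'M[A]_n.+1} := (@scalar_mx A n.+1) \o (in_alg A).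
have kE c : k c = (c *: 1)%:M by [].
have kZ c (X : 'M[A]_n.+1) i j : (k c * X) i j = c *: X i j.
  by rewrite kE -mulmxE mul_scalar_mx mxE mulr_algl.
have kC c X : k c * X = X * k c.
  apply/matrixP => i j; rewrite kZ kE mxE (bigD1 j)//= big1 ?addr0 => [|l lj].
    by rewrite !mxE eqxx mulr1n -scalerAr mulr1.
  by rewrite !mxE (negPf lj) mulr0n mulr0.
have stk c : mxstar (k c) = k c^*.
  apply/matrixP => i j; rewrite !kE !mxE eq_sym.
  by case: eqP => _; rewrite ?mulr1n ?mulr0n ?star0// starZc star1.
have stD (X Y : 'M[A]_n.+1) : mxstar (X + Y) = mxstar X + mxstar Y.
  by apply/matrixP => i j; rewrite !mxE starD.
have Mk : commr_rmorph k M by move=> c; rewrite /GRing.comm kC.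
have := @spectral R 'M[A]_n.+1 k (@mxstar R A n.+1 n.+1) (@mxstarK _ _) kC stD
  (@mxstarM _ _ _) stk (@mxstarM_eq0 _) M Ms.
case.
  have [||||p p0 pe] := @finite_dim_algebraic _ _ _ k
     (fun X : 'M[A]_n.+1 => [ffun p : 'I_n.+1 * 'I_n.+1 => X p.1 p.2]) M Mk.
  - exact: finite_dim_ffun.
  - by move=> a b; apply/ffunP => p; rewrite !ffunE mxE.
  - by move=> c a; apply/ffunP => p; rewrite !ffunE kZ.
  - move=> a b /ffunP ab; apply/matrixP => i j; have := ab (i, j).
    by rewrite !ffunE.
  by exists p => //; rewrite -[RHS]pe; congr (horner_morph _ p); exact: Prop_irrelevance.
move=> r [P [ru Ps PP P1 MP]].
have Pneg z : z \in r -> z < 0 -> P z = 0.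
  move=> zr z0; apply/matrixP => p0 p1; rewrite mxE.
  have PPE : P z *m P z = P z by rewrite mulmxE PP// eqxx.
  apply: frame_eq0 => l; apply/eqP/negPn/negP => Pn.
  pose x p := P z p p1 * u l.
  have xe p : x p * e (kap l) = x p by rewrite /x -mulrA (frame_ue fr).
  have xs p : star (x p) = star (u l) * P z p1 p.
    by rewrite /x starM -{2}(Ps z) !mxE.
  pose w := \sum_p star (x p) * x p.
  have w0 : w != 0.
    apply/eqP => /cpos_sum_eq0 h; move: Pn; rewrite -/(x p0) => /eqP; apply.
    by apply: starM_eq0; apply: h => i; exists (x i).
  have wpos : cpos w by apply: cpos_sum => p _; exists (x p).
  have E : mxform M x x = z%:C *: w.
    rewrite /w scaler_sumr /mxform; apply: eq_bigr => p _.
    have -> : z%:C *: (star (x p) * x p) = star (x p) * ((M * P z) p p1 * u l).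
      by rewrite MP// kZ -scalerAl -scalerAr.
    by rewrite mxE mulr_suml mulr_sumr; apply: eq_bigr => q _; rewrite /x !mulrA.
  have := Mpos l x xe; rewrite E => /(cpos_unscale wpos w0).
  by rewrite ler0c leNgt z0.
pose Y := \sum_(z <- r) k (Num.sqrt z)%:C * P z; exists Y.
have Ys : mxstar Y = Y.
  have st0 : mxstar (0 : 'M[A]_n.+1) = 0 by apply/matrixP => i j; rewrite !mxE star0.
  rewrite /Y (big_morph _ stD st0); apply: eq_bigr => z _.
  by rewrite -mulmxE mxstarM Ps stk conjc_real mulmxE kC.
have ME : M = \sum_(z <- r) k z%:C * P z.
  by rewrite -[LHS]mulr1 -P1 mulr_sumr; apply: eq_big_seq => z zr; exact: MP.
rewrite Ys mulmxE ME {1}/Y mulr_suml; apply: eq_big_seq => z zr.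
rewrite /Y mulr_sumr (bigD1_seq z)//= big1_seq ?addr0 => [|w /andP[wz wr]]; last first.
  by rewrite -mulrA (mulrA (P z)) -kC -mulrA PP// eq_sym (negPf wz) !mulr0.
rewrite -mulrA (mulrA (P z)) -kC -mulrA PP// eqxx mulrA.
have [z0|z0] := leP 0 z.
  by rewrite -(rmorphM k) -(rmorphM (real_complex R)) -[X in k X%:C * _](sqr_sqrtr z0).
by rewrite Pneg// !mulr0.
Qed.

(* Unlike in mxpos_spectral, that M is self-adjoint follows by polarization. *)
Lemma mxpos_frame n (M : 'M[A]_n) :
  (forall l x, (forall p, x p * e (kap l) = x p) -> cpos (mxform M x x)) -> mxpos M.
Proof.
move=> Mpos; apply: mxpos_spectral => //.
pose D := mxstar M - M.
have DE x y : mxform D x y = mxform (mxstar M) x y - mxform M x y.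
  rewrite /mxform -sumrB; apply: eq_bigr => p _; rewrite -sumrB; apply: eq_bigr => q _.
  by rewrite !mxE mulrBr mulrBl.
have D0 l x : (forall p, x p * e (kap l) = x p) -> mxform D x x = 0.
  by move=> /Mpos/cpos_sa h; rewrite DE -mxform_star h subrr.
have Dxy l x y : (forall p, x p * e (kap l) = x p) -> (forall p, y p * e (kap l) = y p) ->
    mxform D x y = 0.
  move=> hx hy; apply: mxform_polar; apply: (D0 l) => // p.
    by rewrite mulrDl hx hy.
  by rewrite mulrDl hx -scalerAl hy.
apply/eqP; rewrite -subr_eq0 -/D; apply/eqP/matrixP => p q; rewrite [RHS]mxE.
apply: frame_eq0 => j; apply: star_inj; rewrite star0; apply: frame_eq0 => i.
apply: star_inj; rewrite star0 starM starK mulrA.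
have [ij|ij] := eqVneq (kap i) (kap j); last exact: (frame_disj fr).
(* Vectors supported at one index isolate u_i^* D_pq u_j. *)
pose dl (r : 'I_n) (a : A) s := if s == r then a else 0.
have := Dxy i (dl p (u i)) (dl q (u j)).
rewrite /mxform (bigD1 p)//= (bigD1 q)//= /dl !eqxx !big1 ?addr0.
- move=> h; apply: h => s; case: eqP => _; rewrite ?mul0r ?(frame_ue fr)//.
  by rewrite ij (frame_ue fr).
- by move=> s sp; rewrite big1// => t _; rewrite (negPf sp) star0 !mul0r.
- by move=> s sq; rewrite (negPf sq) mulr0.
Qed.

End MatrixPositivity.

(** * Maps into A given by their matrix coefficients *)

Section FrameMap.
Context {R : realType} {A B : cstarAlgType R}.
Context {N : nat} {u : 'I_N -> A} {kap : 'I_N -> 'I_N} {e : 'I_N -> A}.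
Hypotheses (hA : finite_dim A) (fr : is_frame u kap e).
Implicit Types (S : 'I_N -> 'I_N -> 'I_N -> B -> R[i]) (b : B).

Definition frame_map S b : A :=
  \sum_i \sum_(j | kap j == kap i) S (kap i) i j b *: (u i * star (u j)).

Lemma cposZ (x : A) (c : R[i]) : 0 <= c -> cpos x -> cpos (c *: x).
Proof. by move=> /complex_ge0P[]; case: c => a b /= a0 ->; exact: cposZr. Qed.

Lemma frame_map_coef S b i j : kap i = kap j ->
  star (u i) * frame_map S b * u j = S (kap i) i j b *: e (kap i).
Proof.
move=> ij; rewrite /frame_map mulr_sumr mulr_suml (bigD1 i)//= [X in _ + X]big1 ?addr0 => [|i' i'i].
  rewrite mulr_sumr mulr_suml (bigD1 j) ?ij//= [X in _ + X]big1 ?addr0 => [|j' /andP[_ j'j]].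
    rewrite -scalerAr -scalerAl -ij; congr (_ *: _).
    rewrite !mulrA (frame_uu fr) -mulrA (frame_uu fr) -ij.
    exact: (frame_proj fr _).2.
  by rewrite -scalerAr -scalerAl -!mulrA (frame_orth fr)// !mulr0 scaler0.
rewrite mulr_sumr mulr_suml big1// => j' _.
by rewrite -scalerAr -scalerAl !mulrA (frame_orth fr) 1?eq_sym// !mul0r scaler0.
Qed.

Lemma frame_map_linear S : (forall k i j, linear (S k i j)) ->
  forall c x y, frame_map S (c *: x + y) = c *: frame_map S x + frame_map S y.
Proof.
move=> Sl c x y; rewrite /frame_map scaler_sumr -big_split; apply: eq_bigr => i _ /=.
rewrite scaler_sumr -big_split; apply: eq_bigr => j _ /=.
by rewrite Sl scalerDl scalerA.
Qed.

Lemma frame_expand (a : A) :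
  a = \sum_i \sum_(j | kap j == kap i) mps (e (kap i)) (star (u i) * a * u j) *: (u i * star (u j)).
Proof.
rewrite -{1}[a]mul1r -{1}(frame_sum fr) mulr_suml; apply: eq_bigr => i _.
rewrite -[LHS]mulr1 -(frame_sum fr) mulr_sumr [RHS]big_mkcond; apply: eq_bigr => j _.
case: eqP => [ji|/eqP ji].
  rewrite !mulrA -(mulrA (u i)) -(mulrA (u i)) {1}(frame_coef fr a (esym ji)).
  by rewrite -scalerAr -scalerAl (frame_ue fr).
by rewrite !mulrA -(mulrA (u i)) -(mulrA (u i)) (frame_disj fr) 1?eq_sym// mulr0 mul0r.
Qed.

(** By [mxpos_frame] only vectors in a column A e_k are tested. Expanding them in the u_i turns the
    form at Y^* Y into a multiple of e_k, whose factor sums the hypothesis over the rows r, at z_i =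
    sum_p c_pi Y_rp. *)
Lemma frame_map_cp S : (forall k i j, linear (S k i j)) ->
  (forall k (z : 'I_N -> B), 0 <=
     \sum_(i | kap i == k) \sum_(j | kap j == k) S k i j (star (z i) * z j)) ->
  forall n (M : 'M[B]_n), mxpos M -> mxpos (map_mx (frame_map S) M).
Proof.
move=> Sl Spos n M [Y ->]; apply: (mxpos_frame hA fr) => l x xl.
set k := kap l in xl *.
pose c p i := mps (e k) (star (u i) * x p).
have xE p : x p = \sum_(i | kap i == k) c p i *: u i by exact: (frame_mulr_sum fr (xl p)).
have term b p q : star (x p) * frame_map S b * x q =
    (\sum_(i | kap i == k) \sum_(j | kap j == k) conjc (c p i) * c q j * S k i j b) *: e k.
  rewrite (xE p) (xE q) star_sum !mulr_suml scaler_suml; apply: eq_bigr => i /eqP ik.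
  rewrite mulr_sumr scaler_suml; apply: eq_bigr => j /eqP jk.
  rewrite starZc -!scalerAl -scalerAr scalerA (frame_map_coef _ _ (etrans ik (esym jk))) ik.
  by rewrite scalerA -mulrA.
pose z r i := \sum_p c p i *: Y r p.
have -> : mxform (map_mx (frame_map S) (mxstar Y *m Y)) x x =
    (\sum_r \sum_(i | kap i == k) \sum_(j | kap j == k) S k i j (star (z r i) * z r j)) *: e k.
  rewrite /mxform; under eq_bigr => p _ do under eq_bigr => q _ do rewrite mxE term.
  under eq_bigr => p _ do rewrite -scaler_suml.
  rewrite -scaler_suml; congr (_ *: _).
  have E i j : \sum_r S k i j (star (z r i) * z r j) =
     \sum_p \sum_q conjc (c p i) * c q j * S k i j ((mxstar Y *m Y) p q).
    have l0 := Sl k i j; rewrite -(lin_sum l0).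
    under [RHS]eq_bigr => p _ do under eq_bigr => q _ do rewrite -(linZ l0).
    under [RHS]eq_bigr => p _ do rewrite -(lin_sum l0).
    rewrite -(lin_sum l0); congr (S k i j _).
    under [RHS]eq_bigr => p _ do under eq_bigr => q _ do rewrite mxE scaler_sumr.
    under [RHS]eq_bigr => p _ do rewrite exchange_big.
    rewrite exchange_big; apply: eq_bigr => r _.
    rewrite /z star_sum mulr_suml; apply: eq_bigr => p _.
    rewrite mulr_sumr; apply: eq_bigr => q _.
    by rewrite !mxE starZc -scalerAl -scalerAr scalerA.
  rewrite [RHS]exchange_big /=.
  under [RHS]eq_bigr => i _ do rewrite exchange_big /=.
  under [RHS]eq_bigr => i _ do under eq_bigr => j _ do rewrite E.
  under [RHS]eq_bigr => i _ do rewrite exchange_big /=.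
  rewrite [RHS]exchange_big /=; apply: eq_bigr => p _.
  under [RHS]eq_bigr => i _ do rewrite exchange_big /=.
  by rewrite [RHS]exchange_big.
apply: cposZ; last exact/proj_cpos/(frame_proj fr).
by apply: sumr_ge0 => r _; exact: Spos.
Qed.

End FrameMap.
Arguments frame_map {R A B N} u kap S b.

(** * Ucp maps on operator systems *)

Section Ucp.
Context {R : realType} {B C : cstarAlgType R} (V : set B) (f : B -> C).
Hypotheses (Vop : opsys V) (fucp : ucp V [set: C] f).

Lemma opsys0 : V 0.
Proof.
have [V1 VD _] := Vop; have := VD (-1) 1 1 V1 V1.
by rewrite scaleN1r addNr.
Qed.

Lemma opsysD x y : V x -> V y -> V (x + y).
Proof. by have [_ VD _] := Vop; move=> vx vy; have := VD 1 x y vx vy; rewrite scale1r. Qed.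

Lemma opsysZ c x : V x -> V (c *: x).
Proof. by have [_ VD _] := Vop; move=> vx; have := VD c x 0 vx opsys0; rewrite addr0. Qed.

Lemma ucpD x y : V x -> V y -> f (x + y) = f x + f y.
Proof. by have [_ fl _ _] := fucp; move=> vx vy; have := fl 1 x y vx vy; rewrite !scale1r. Qed.

Lemma ucp0 : f 0 = 0.
Proof. by apply: (@addrI _ (f 0)); rewrite -ucpD ?addr0//; exact: opsys0. Qed.

Lemma ucpZ c x : V x -> f (c *: x) = c *: f x.
Proof.
have [_ fl _ _] := fucp; move=> vx; have := fl c x 0 vx opsys0.
by rewrite ucp0 !addr0.
Qed.

(* Gram matrices of any number of rows are allowed: the positive matrix is
   padded with zeros to become a square one. *)
Lemma ucp_gram n (ys : seq ('I_n -> B)) (x : 'I_n -> C) :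
  (forall p q, V (\sum_(y <- ys) star (y p) * y q)) ->
  cpos (mxform (\matrix_(p, q) f (\sum_(y <- ys) star (y p) * y q)) x x).
Proof.
move=> VG; pose L := size ys.
pose Y0 : 'M[B]_(L, n) := \matrix_(l, p) tnth (in_tuple ys) l p.
pose Y : 'M[B]_(n + L) := block_mx 0 0 Y0 0.
pose G : 'M[B]_n := \matrix_(p, q) \sum_(y <- ys) star (y p) * y q.
have GE : mxstar Y0 *m Y0 = G.
  apply/matrixP => p q; rewrite !mxE [RHS]big_tnth; apply: eq_bigr => l _.
  by rewrite !mxE.
have st0 m' n' : mxstar (0 : 'M[B]_(m', n')) = 0 by apply/matrixP => i j; rewrite !mxE star0.
have YE : mxstar Y *m Y = block_mx G 0 0 0.
  have -> : mxstar Y = block_mx 0 (mxstar Y0) 0 0.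
    rewrite /Y /mxstar tr_block_mx map_block_mx.
    by have := st0 n n; have := st0 n L; have := st0 L L; rewrite /mxstar => -> -> ->.
  by rewrite mulmx_block !mul0mx !mulmx0 !addr0 !add0r GE.
have [_ _ _ fcp] := fucp.
have : mxpos (map_mx f (block_mx G 0 0 0 : 'M[B]_(n + L))).
  apply: fcp; last by exists Y.
  move=> i j; case: (split_ordP i) => i' ->; case: (split_ordP j) => j' ->.
  - by rewrite block_mxEul mxE.
  - by rewrite block_mxEur mxE; exact: opsys0.
  - by rewrite block_mxEdl mxE; exact: opsys0.
  - by rewrite block_mxEdr mxE; exact: opsys0.
pose x' (i : 'I_(n + L)) := if fintype.split i is inl p then x p else 0.
move=> /(mxpos_form x'); congr cpos.
have xl p : x' (lshift L p) = x p by rewrite /x' (unsplitK (inl p)).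
have xr p : x' (rshift n p) = 0 by rewrite /x' (unsplitK (inr p)).
rewrite /mxform big_split_ord /= [X in _ + X]big1 ?addr0 => [|p _]; last first.
  by rewrite big1// => q _; rewrite xr star0 !mul0r.
apply: eq_bigr => p _; rewrite big_split_ord /= [X in _ + X]big1 ?addr0 => [|q _]; last first.
  by rewrite xr mulr0.
by apply: eq_bigr => q _; rewrite !xl mxE [map_mx _ _ _ _]mxE block_mxEul mxE.
Qed.

Lemma ucp_cpos v : V v -> cpos v -> cpos (f v).
Proof.
move=> Vv [y vE]; have := @ucp_gram 1 [:: fun=> y] (fun=> 1).
rewrite /mxform !big_ord1 mxE star1 mul1r mulr1 big_seq1 -vE; apply=> p q.
by rewrite big_seq1 -vE.
Qed.

Lemma ucp_star v : V v -> f (star v) = star (f v).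
Proof.
have [V1 _ Vs] := Vop; have [_ _ f1 _] := fucp.
have sa a : V a -> star a = a -> star (f a) = f a.
  move=> Va as_; have Vna : V (- a) by rewrite -scaleN1r; exact: opsysZ.
  have Vt : V ((cnorm a)%:C *: 1) by exact: opsysZ.
  have /cpos_sa : cpos (f ((cnorm a)%:C *: 1 - a)).
    by apply: ucp_cpos; [exact: opsysD|exact: cpos_norm_sub].
  rewrite ucpD// -[- a]scaleN1r !ucpZ// f1 starD !starZr star1 scaleN1r starN.
  by move=> /addrI/oppr_inj.
move=> Vv; have Vs' := Vs _ Vv.
pose a := (2^-1 : R)%:C *: (v + star v).
pose b := (2^-1 : R)%:C *: ('i *: (star v - v)).
have Va : V a by apply/opsysZ/opsysD.
have Vb : V b by apply/opsysZ/opsysZ/opsysD => //; rewrite -scaleN1r; exact: opsysZ.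
have as_ : star a = a by rewrite starZr starD starK addrC.
have bs : star b = b by rewrite starZr starZi starB starK -scalerN opprB.
have E : v = a + 'i *: b by rewrite /a /b scalerA mulrC -scalerA scaleii; ncring.
have E' : star v = a + (- 'i) *: b by rewrite E starD starZi as_ bs scaleNr.
move: a b Va Vb as_ bs E E' => a b Va Vb as_ bs E E'.
rewrite E' [in RHS]E !ucpD ?ucpZ//; try exact: opsysZ.
by rewrite starD starZi !sa// scaleNr.
Qed.

End Ucp.

(** * Injectivity of finite-dimensional C*-algebras *)

(* With X the module of N x N matrices over B and K the cone of those whose real
   part is a sum of Gram matrices of rows, f induces on each block of A a positive
   functional on the matrices over V, which Krein's theorem extends to X. *)
Section Arveson.
Context {R : realType} {A B : cstarAlgType R} (V : set B) (f : B -> A).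
Hypotheses (Vop : opsys V) (fucp : ucp V [set: A] f).
Context {N : nat} {u : 'I_N -> A} {kap : 'I_N -> 'I_N} {e : 'I_N -> A}.
Hypotheses (hA : finite_dim A) (fr : is_frame u kap e).

Local Notation X := {ffun 'I_N * 'I_N -> B}.

Definition adj (M : X) : X := [ffun p => star (M (p.2, p.1))].

Definition gram (ys : seq ('I_N -> B)) : X :=
  [ffun p => \sum_(y <- ys) star (y p.1) * y p.2].

Definition entry i j (b : B) : X := [ffun p => if p == (i, j) then b else 0].

Let K : set X := [set M | exists ys, M + adj M = gram ys].
Let X0 : set X := [set M | forall p, V (M p)].

Lemma adjD (M M' : X) : adj (M + M') = adj M + adj M'.
Proof. by apply/ffunP => p; rewrite !ffunE starD. Qed.

Lemma adjZ (c : R[i]) (M : X) : adj (c *: M) = conjc c *: adj M.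
Proof. by apply/ffunP => p; rewrite !ffunE starZc. Qed.

Lemma adj0 : adj 0 = 0.
Proof. by apply/ffunP => p; rewrite !ffunE star0. Qed.

Lemma gram_cat ys ys' : gram ys + gram ys' = gram (ys ++ ys').
Proof. by apply/ffunP => p; rewrite !ffunE big_cat. Qed.

Lemma gramZ (t : R) ys : 0 <= t ->
  t%:C *: gram ys = gram [seq (fun i => (Num.sqrt t)%:C *: y i) | y <- ys].
Proof.
move=> t0; apply/ffunP => p; rewrite !ffunE big_map scaler_sumr.
apply: eq_bigr => y _; rewrite starZr -scalerAl -scalerAr scalerA -rmorphM.
by rewrite -expr2 sqr_sqrtr.
Qed.

Lemma entryD i j b b' : entry i j (b + b') = entry i j b + entry i j b'.
Proof. by apply/ffunP => p; rewrite !ffunE; case: eqP; rewrite ?addr0. Qed.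

Lemma entryZ i j c b : entry i j (c *: b) = c *: entry i j b.
Proof. by apply/ffunP => p; rewrite !ffunE; case: eqP; rewrite ?scaler0. Qed.

Lemma entry0 i j : entry i j 0 = 0.
Proof. by apply/ffunP => p; rewrite !ffunE; case: eqP. Qed.

Lemma sum_entry (M : X) : M = \sum_i \sum_j entry i j (M (i, j)).
Proof.
apply/ffunP => -[p q]; rewrite !sum_ffunE (bigD1 p)//= [X in _ + X]big1 ?addr0 => [|i ip].
  rewrite sum_ffunE (bigD1 q)//= [X in _ + X]big1 ?addr0 => [|j jq].
    by rewrite ffunE eqxx.
  by rewrite ffunE xpair_eqE eqxx eq_sym (negPf jq).
rewrite sum_ffunE big1// => j _.
by rewrite ffunE xpair_eqE eq_sym (negPf ip).
Qed.

Let KD M M' : K M -> K M' -> K (M + M').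
Proof. by move=> [ys h] [ys' h']; exists (ys ++ ys'); rewrite adjD addrACA h h' gram_cat. Qed.

Let KZ t M : 0 <= t -> K M -> K (t%:C *: M).
Proof.
move=> t0 [ys h]; exists [seq (fun i => (Num.sqrt t)%:C *: y i) | y <- ys].
by rewrite adjZ conjc_real -scalerDr h gramZ.
Qed.

Let K_skew M : adj M = - M -> K M.
Proof. by move=> h; exists [::]; rewrite h subrr; apply/ffunP => p; rewrite !ffunE big_nil. Qed.

Let K0 : K 0.
Proof. by apply: K_skew; rewrite adj0 oppr0. Qed.

Let K_gram ys : K (gram ys).
Proof.
exists (ys ++ ys); rewrite -gram_cat; congr (_ + _); apply/ffunP => p.
by rewrite !ffunE star_sum; apply: eq_bigr => y _; rewrite starM starK.
Qed.

Let diag (d : 'I_N -> B) : X := [ffun p => if p.1 == p.2 then d p.1 else 0].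

Let K_sum (F : 'I_N -> X) : (forall i, K (F i)) -> K (\sum_i F i).
Proof. by move=> h; apply: big_ind. Qed.

Let K_diag d : (forall i, cpos (d i)) -> K (diag d).
Proof.
move=> /choice[w dw]; have -> : diag d = \sum_i gram [:: fun p => if p == i then w i else 0].
  apply/ffunP => -[p q]; rewrite sum_ffunE ffunE /= (bigD1 p)//= big1 ?addr0 => [|i ip].
    rewrite ffunE big_seq1 /= eqxx eq_sym; case: eqP => _; last by rewrite mulr0.
    by rewrite dw.
  by rewrite ffunE big_seq1 /= eq_sym (negPf ip) star0 mul0r.
by apply: K_sum => i; exact: K_gram.
Qed.

Let K_half M : K (M + M) -> K M.
Proof.
move=> h; have -> : M = (2^-1 : R)%:C *: (M + M) by apply/ffunP => p; rewrite !ffunE; ncring.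
by apply: KZ; rewrite ?invr_ge0.
Qed.

Let one : X := diag (fun=> 1).

Let K_entry i j b : exists t : R, K (t%:C *: one - entry i j b).
Proof.
(* Completing a square: the row y with 1 at i and - b at j has - b at (i, j) of its Gram matrix. The
   positive diagonal d completes the diagonal to 1 + n, and the remaining difference is skew. *)
pose n := cnorm (star b * b); pose y p : B := (if p == i then 1 else 0) - (if p == j then b else 0).
pose d p : B := (if p == i then 0 else 1) + (n%:C *: 1 - if p == j then star b * b else 0).
exists ((1 + n) / 2); apply: K_half.
have -> : ((1 + n) / 2)%:C *: one - entry i j b + (((1 + n) / 2)%:C *: one - entry i j b) =
    gram [:: y] + diag d + (entry j i (star b) - entry i j b).
  apply/ffunP => -[p q]; rewrite !ffunE /= big_seq1 !xpair_eqE /y /d.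
  have [<-|pq] := eqVneq p q.
    case: (p == i); case: (p == j); rewrite /= ?starB ?star0 ?star1; ncring.
  have h l : (p == l) && (q == l) = false.
    by apply/negP => /andP[/eqP pl /eqP ql]; rewrite pl ql eqxx in pq.
  move: (h i) (h j); case: (p == i); case: (p == j); case: (q == i); case: (q == j) => //= _ _;
  rewrite ?starB ?star0 ?star1; ncring.
apply: KD; last first.
  apply: K_skew; apply/ffunP => -[p q]; rewrite !ffunE /= !xpair_eqE starB.
  by case: (p == i); case: (p == j); case: (q == i); case: (q == j); rewrite /= ?star0 ?starK; ncring.
apply: KD; first exact: K_gram.
apply: K_diag => p; apply: cposD; first by case: eqP => _; [exact: cpos0|exact: cpos1].
case: eqP => _; first by apply: cpos_norm_sub; rewrite starM starK.
by rewrite subr0; apply: cposZr (cnorm_ge0 _) cpos1.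
Qed.

Let K_cofinal M : exists t : R, K (t%:C *: one - M).
Proof.
rewrite (sum_entry M).
have H (F : 'I_N -> X) : (forall i, exists t : R, K (t%:C *: one - F i)) ->
    exists t : R, K (t%:C *: one - \sum_i F i).
  move=> h; apply: (big_ind (fun M => exists t : R, K (t%:C *: one - M))) => //.
    by exists 0; rewrite rmorph0 scale0r subrr; exact: K0.
  move=> M1 M2 [t1 h1] [t2 h2]; exists (t1 + t2).
  by rewrite rmorphD scalerDl opprD addrACA; exact: KD.
by apply: (H) => i; apply: (H) => j; exact: K_entry.
Qed.

Section Functional.
Variable k : 'I_N.

Let mask i : A := if kap i == k then u i else 0.
Let fmx (M : X) : 'M[A]_N := \matrix_(i, j) f (M (i, j)).
(** [mask] cuts down to the block k, so that this reads off in C e_k the sum of u_i^* f (M_ij) u_j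
    over i, j in that block. *)
Let s (M : X) : R[i] := mps (e k) (mxform (fmx M) mask mask).

Let stk : is_state (mps (e k)).
Proof. exact/mps_state/(frame_minproj fr). Qed.

Let s_lin c M M' : X0 M -> X0 M' -> s (c *: M + M') = c * s M + s M'.
Proof.
move=> VM VM'; have [l _ _] := stk; rewrite /s -(linZ l) -(linD l); congr (mps _ _).
rewrite /mxform scaler_sumr -big_split; apply: eq_bigr => i _ /=.
rewrite scaler_sumr -big_split; apply: eq_bigr => j _ /=.
rewrite !mxE !ffunE; have [_ fl _ _] := fucp.
by rewrite fl// mulrDr mulrDl -scalerAr -scalerAl.
Qed.

Let s_adj M : X0 M -> s (adj M) = conjc (s M).
Proof.
move=> VM; rewrite /s -(state_star _ stk) mxform_star; congr (mps _ (mxform _ _ _)).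
by apply/matrixP => i j; rewrite !mxE ffunE /= (ucp_star Vop fucp).
Qed.

Let X0_adj M : X0 M -> X0 (adj M).
Proof. by move=> VM p; rewrite ffunE; have [_ _ h] := Vop; exact: h. Qed.

Let X0D M M' : X0 M -> X0 M' -> X0 (M + M').
Proof. by move=> VM VM' p; rewrite ffunE; exact: (opsysD Vop). Qed.

Let X0Z c M : X0 M -> X0 (c *: M).
Proof. by move=> VM p; rewrite ffunE; exact: (opsysZ Vop). Qed.

Let s_gram ys : X0 (gram ys) -> 0 <= s (gram ys).
Proof.
move=> VG; have [_ pos _] := stk; apply: pos.
have -> : fmx (gram ys) = \matrix_(p, q) f (\sum_(y <- ys) star (y p) * y q).
  by apply/matrixP => i j; rewrite !mxE ffunE.
apply: (ucp_gram Vop fucp) => p q; have := VG (p, q); by rewrite ffunE.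
Qed.

Lemma arveson_functional : exists S : 'I_N -> 'I_N -> B -> R[i],
  [/\ forall i j, linear (S i j),
    forall z : 'I_N -> B, 0 <=
      \sum_(i | kap i == k) \sum_(j | kap j == k) S i j (star (z i) * z j) &
    forall i j v, V v -> kap i = k -> kap j = k ->
      S i j v = mps (e k) (star (u i) * f v * u j)].
Proof.
have V0 := opsys0 Vop; have [V1 _ _] := Vop.
have X0one (t : R) : X0 (t%:C *: one).
  apply: X0Z => p; rewrite ffunE; case: eqP => _ //.
have [||||||||||F [[Fl FX FK] _ _]] := @krein_extreme R X K X0 (fun M => complex.Re (s M)) _ _ _ _ _ _ _ _ _ _ 0.
- exact: K0.
- exact: KD.
- exact: KZ.
- by move=> p; rewrite ffunE.
- exact: X0D.
- by move=> t x; exact: X0Z.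
- move=> M M' VM VM'; have := s_lin 1 VM VM'; rewrite scale1r mul1r => ->.
  by case: (s M) (s M') => [? ?] [? ?].
- move=> t M VM; have VZ : X0 0 by move=> p; rewrite ffunE.
  have s0 : s 0 = 0 by have := s_lin (-1) VZ VZ; rewrite scaler0 addr0 mulN1r addNr.
  have := s_lin t%:C VM VZ; rewrite s0 !addr0 => ->.
  by case: (s M) => a b /=; ring.
- move=> M VM [ys h]; have := @s_gram ys; rewrite -h.
  have := s_lin 1 VM (X0_adj VM); rewrite scale1r mul1r => -> h1.
  have /complex_ge0P[+ _] := h1 (X0D VM (X0_adj VM)).
  by rewrite s_adj//; case: (s M) => a b /=; lra.
- by move=> M; have [t ht] := K_cofinal M; exists (t%:C *: one).
pose G := complexify F.
have Gl : linear G by exact: complexify_linear.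
have GX M : X0 M -> G M = s M.
  move=> VM; rewrite /G /complexify !FX//; last exact: X0Z.
  have VZ : X0 0 by move=> p; rewrite ffunE.
  have s0 : s 0 = 0 by have := s_lin (-1) VZ VZ; rewrite scaler0 addr0 mulN1r addNr.
  have := s_lin 'i VM VZ; rewrite s0 !addr0 => ->.
  by case: (s M) => a b; apply/eqP; rewrite eq_complex /=; apply/andP; split; apply/eqP; ring.
have Ggram ys : 0 <= G (gram ys).
  have adjg : adj (gram ys) = gram ys.
    apply/ffunP => p; rewrite !ffunE star_sum; apply: eq_bigr => y _.
    by rewrite starM starK.
  have conji : 'i^* = - 'i :> R[i] by apply/eqP; rewrite eq_complex /= oppr0 !eqxx.
  apply/complex_ge0P; split; first exact: FK.
  have h1 : 0 <= F ('i *: gram ys).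
    by apply/FK/K_skew; rewrite adjZ adjg conji scaleNr.
  have h2 : 0 <= F (- ('i *: gram ys)).
    apply/FK/K_skew; rewrite -scaleNr adjZ adjg scaleNr opprK; congr (_ *: _).
    by apply/eqP; rewrite eq_complex /= !oppr0 opprK !eqxx.
  by move: h2; rewrite real_linearN//=; lra.
exists (fun i j b => G (entry i j b)); split.
- by move=> i j c x y; rewrite entryD entryZ Gl.
(* Setting z to 0 outside the block turns the restricted double sum into the value of G at one Gram
   matrix. *)
- move=> z; pose z' i := if kap i == k then z i else 0.
  suff -> : \sum_(i | kap i == k) \sum_(j | kap j == k) G (entry i j (star (z i) * z j)) =
      G (gram [:: z']) by exact: Ggram.
  rewrite (sum_entry (gram _)) (lin_sum Gl) big_mkcond; apply: eq_bigr => i _.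
  rewrite (lin_sum Gl); case: ifPn => ik.
    rewrite big_mkcond; apply: eq_bigr => j _; rewrite ffunE big_seq1 /= /z' ik.
    case: ifP => // _; by rewrite mulr0 entry0 (lin0 Gl).
  rewrite big1// => j _; rewrite ffunE big_seq1 /= /z' (negPf ik) star0 mul0r.
  by rewrite entry0 (lin0 Gl).
- move=> i j v Vv ik jk; have Ve : X0 (entry i j v) by move=> p; rewrite ffunE; case: eqP.
  rewrite GX// /s /mxform; congr (mps _ _).
  have f0 := ucp0 Vop fucp.
  rewrite (bigD1 i)//= [X in _ + X]big1 ?addr0 => [|p pi].
    rewrite (bigD1 j)//= [X in _ + X]big1 ?addr0 => [|q qj].
      by rewrite /mask ik jk eqxx mxE ffunE eqxx.
    by rewrite mxE ffunE xpair_eqE eqxx (negPf qj) f0 mulr0 mul0r.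
  by rewrite big1// => q _; rewrite mxE ffunE xpair_eqE (negPf pi) f0 mulr0 mul0r.
Qed.

End Functional.

Lemma ucp_extension : exists g : B -> A,
  ucp [set: B] [set: A] g /\ forall v, V v -> g v = f v.
Proof.
have [S HS] := choice arveson_functional; exists (frame_map u kap S).
have gf v : V v -> frame_map u kap S v = f v.
  move=> Vv; rewrite (frame_expand fr (f v)) /frame_map; apply: eq_bigr => i _.
  by apply: eq_bigr => j /eqP ji; case: (HS (kap i)) => _ _ h; rewrite (h i j v Vv erefl ji).
split=> //; have [V1 _ _] := Vop; have [_ _ f1 _] := fucp; split=> //.
- by move=> c x y _ _; apply: frame_map_linear => k i j; case: (HS k).
- by rewrite gf.
- move=> n M _; apply: (frame_map_cp hA fr); first by move=> k i j; case: (HS k).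
  by move=> k z; case: (HS k).
Qed.

End Arveson.

Lemma finite_dim_injective (R : realType) (A : cstarAlgType R) :
  finite_dim A -> injective_opsys [set: A].
Proof.
move=> hA; split; first by split.
move=> B V W f Vop Wop VW fucp; have [N [u [kap [e fr]]]] := frame_exists hA.
have [g [[_ gl g1 gp] gf]] := ucp_extension Vop fucp hA fr.
exists g; split=> //; split=> //.
  by move=> c x y _ _; exact: gl.
by move=> n M _; exact: gp.
Qed.

(** * Conditional expectations and scalar corners *)

Section ConditionalExpectations.
Context {R : realType} {A B : cstarAlgType R} (iota : {lrmorphism A -> B}).
Hypothesis hiota : cstar_inclusion iota.

Definition cond_exp (E : B -> A) : Prop :=
  ucp [set: B] [set: A] E /\ (forall a, E (iota a) = a).

Lemma opsysT (C : cstarAlgType R) : opsys [set: C].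
Proof. by split. Qed.

Lemma mxpos_kernel n (M : 'M[A]_n) x q : mxpos M -> mxform M x x = 0 ->
  \sum_p M q p * x p = 0.
Proof.
move=> [Z ->]; rewrite mxform_gram => /cpos_sum_eq0 Z0.
have Zx r : \sum_p Z r p * x p = 0.
  by apply: starM_eq0; apply: Z0 => r'; exists (\sum_p Z r' p * x p).
under eq_bigr => p _ do rewrite mxE mulr_suml.
rewrite exchange_big big1// => r _; under eq_bigr => p _ do rewrite -mulrA.
by rewrite -mulr_sumr Zx mulr0.
Qed.

(* The vector (- a, 1, 0) is in the kernel of the image of the Gram matrix of
   (1, a, b), whose last row gives E (b^* a) = E (b^* ) a. *)
Lemma cond_exp_mulr E a b : cond_exp E -> E (b * iota a) = E b * a.
Proof.
move=> [Eucp Ea]; have [_ El E1 Ecp] := Eucp.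
pose y (p : 'I_3) : B := nth 0 [:: 1; iota a; star b] p.
pose x (p : 'I_3) : A := nth 0 [:: - a; 1; 0] p.
pose Y : 'M[B]_3 := \matrix_(r, p) if r == ord0 then y p else 0.
have YE : mxstar Y *m Y = \matrix_(p, q) (star (y p) * y q).
  apply/matrixP => p q; rewrite !mxE (bigD1 ord0)//= big1 ?addr0 => [|r r0].
    by rewrite !mxE eqxx.
  by rewrite !mxE (negPf r0) mulr0.
have Npos : mxpos (map_mx E (mxstar Y *m Y)) by apply: Ecp => //; exists Y.
have Ess : E (star (iota a)) = star a by rewrite -(lrm_star hiota) Ea.
have E2 : E (star (iota a) * iota a) = star a * a by rewrite -(lrm_star hiota) -lrmM Ea.
have := @mxpos_kernel _ _ x (inord 2) Npos; rewrite YE.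
rewrite /mxform !big_ord_recl !big_ord0 !mxE /y /x /= !inordK//=.
rewrite star1 star0 starN starK !mul1r !mulr1 !mul0r !mulr0 !addr0 E1 Ea Ess E2.
move=> h; have {}h := h _; apply/eqP; rewrite -subr_eq0 addrC -mulrN; apply/eqP; apply: h.
ncring.
Qed.

Lemma cond_exp_mull E a b : cond_exp E -> E (iota a * b) = a * E b.
Proof.
move=> hE; have [Eucp _] := hE; have es x := ucp_star (@opsysT B) Eucp (I : [set: B] x).
apply: star_inj; rewrite -es starM -(lrm_star hiota) (cond_exp_mulr _ _ hE).
by rewrite es starM.
Qed.

(** The inverse of [iota] on its range is ucp on that operator system, and injectivity of A extends
    it to B. *)
Lemma cond_exp_exists : finite_dim A -> exists E, cond_exp E.
Proof.
move=> hA; have [_ inj] := finite_dim_injective hA.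
have [N [u [kap [e fr]]]] := frame_exists hA.
pose f (b : B) : A := xget 0 [set a | iota a = b].
have fE a : f (iota a) = a.
  rewrite /f; apply: (lrm_inj hiota); case: xgetP => [x _ ->//|/(_ a)].
  by move=> /(_ erefl).
have Vop : opsys (range iota).
  split; first by exists 1; rewrite ?lrm1.
    by move=> c _ _ [x _ <-] [y _ <-]; exists (c *: x + y); rewrite // lrmD lrmZ.
  by move=> _ [x _ <-]; exists (star x); rewrite // (lrm_star hiota).
have fucp : ucp (range iota) [set: A] f.
  split=> //.
  - by move=> c _ _ [x _ <-] [y _ <-]; rewrite -lrmZ -lrmD !fE.
  - by rewrite -(lrm1 iota) fE.
  (* A factor of M in B need not have entries in the range of [iota]; positivity is tested on forms
     instead, which [iota] carries to forms of M. *)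
  - move=> n M VM Mpos; apply: (mxpos_frame hA fr) => l x _; apply/(lrm_cpos hiota).
    suff -> : iota (mxform (map_mx f M) x x) = mxform M (iota \o x) (iota \o x).
      exact: mxpos_form.
    rewrite /mxform lrm_sum; apply: eq_bigr => p _; rewrite lrm_sum; apply: eq_bigr => q _.
    rewrite !lrmM (lrm_star hiota) mxE; have [a _ <-] := VM p q.
    by rewrite fE.
have [g [gucp gf]] := inj B _ _ f Vop (@opsysT B) (fun _ _ => I) fucp.
by exists g; split=> // a; rewrite gf ?fE.
Qed.

Context {N : nat} {u : 'I_N -> A} {kap : 'I_N -> 'I_N} {e : 'I_N -> A}.
Hypotheses (hA : finite_dim A) (fr : is_frame u kap e).

(** Tested on one representative [e (kap i)] per block; [scalar_corners_minproj] carries it to every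
    minimal projection. *)
Definition scalar_corners := forall i b, exists c,
  iota (e (kap i)) * b * iota (e (kap i)) = c *: iota (e (kap i)).

(** The unit of the block k, a central projection of A. *)
Definition block_proj k : A := \sum_(i | kap i == k) u i * star (u i).

Lemma scalar_corners_coef : scalar_corners -> forall i j b, kap i = kap j ->
  exists c, star (iota (u i)) * b * iota (u j) = c *: iota (e (kap i)).
Proof.
move=> H i j b ij; have [c hc] := H i (star (iota (u i)) * b * iota (u j)).
exists c; rewrite -hc -!(lrm_star hiota) !mulrA -lrmM (frame_eu fr) -!mulrA -lrmM.
by rewrite ij (frame_ue fr).
Qed.

Lemma cond_exp_coef E i j b : cond_exp E ->
  star (u i) * E b * u j = E (star (iota (u i)) * b * iota (u j)).
Proof.
by move=> hE; rewrite (cond_exp_mulr _ _ hE) -(lrm_star hiota) (cond_exp_mull _ _ hE).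
Qed.

Lemma cond_exp_unique E E' : scalar_corners -> cond_exp E -> cond_exp E' -> E = E'.
Proof.
move=> H hE hE'; apply/funext => b; rewrite (frame_expand fr (E b)) (frame_expand fr (E' b)).
apply: eq_bigr => i _; apply: eq_bigr => j /eqP ji; congr (mps _ _ *: _).
rewrite !cond_exp_coef//; have [c ->] := scalar_corners_coef H b (esym ji).
by rewrite -lrmZ; have [[_ ->] [_ ->]] := (hE, hE').
Qed.

(* The conditional expectation is b |-> sum psi_k (u_i^* b u_j) u_i u_j^*, over
   the i, j in a common block k. *)
Lemma cond_exp_of_states (psi : 'I_N -> B -> R[i]) :
  (forall k, is_state (psi k)) -> (forall k a, psi k (iota a) = mps (e k) a) ->
  exists2 E, cond_exp E & forall l b, iota (e (kap l)) * b * iota (e (kap l)) = b ->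
    E (\sum_(i | kap i == kap l) iota (u i) * b * star (iota (u i))) =
      psi (kap l) b *: block_proj (kap l).
Proof.
move=> st ext; pose S k i j b := psi k (star (iota (u i)) * b * iota (u j)).
have Sl k i j : linear (S k i j).
  by move=> c x y; rewrite /S; have [l _ _] := st k; rewrite mulrDr mulrDl -scalerAr -scalerAl l.
exists (frame_map u kap S).
  have hE a : frame_map u kap S (iota a) = a.
    rewrite [RHS](frame_expand fr) /frame_map; apply: eq_bigr => i _; apply: eq_bigr => j _.
    by rewrite /S -(lrm_star hiota) -!lrmM ext.
  split=> //; split=> //.
  - by move=> c x y _ _; exact: frame_map_linear.
  - by rewrite -{1}(lrm1 iota) hE.
  - move=> n M _; apply: (frame_map_cp hA fr) => // k z.
    have [l pos _] := st k; rewrite /S.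
    under eq_bigr => i _ do rewrite -(lin_sum l).
    rewrite -(lin_sum l); apply: pos; exists (\sum_(i | kap i == k) z i * iota (u i)).
    rewrite star_sum mulr_suml; apply: eq_bigr => i _; rewrite mulr_sumr.
    by apply: eq_bigr => j _; rewrite starM !mulrA.
move=> l b bE; set c := \sum_(i | _) _.
have cE i j : kap i = kap j -> star (iota (u i)) * c * iota (u j) =
    if (i == j) && (kap i == kap l) then b else 0.
  move=> ij; rewrite /c mulr_sumr mulr_suml big_mkcond (bigD1 i)//= [X in _ + X]big1 ?addr0; last first.
    move=> i' i'i; case: ifP => // _; rewrite !mulrA -(lrm_star hiota) -lrmM.
    by rewrite (frame_orth fr) 1?eq_sym// lrm0 !mul0r.
  case: eqP => [il|_]; last by rewrite andbF.
  rewrite andbT !mulrA -!(lrm_star hiota) -lrmM (frame_uu fr) -mulrA -lrmM.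
  case: eqVneq => [<-|ij']; last by rewrite (frame_orth fr)// lrm0 mulr0.
  by rewrite (frame_uu fr) il.
rewrite /frame_map /block_proj scaler_sumr [RHS]big_mkcond; apply: eq_bigr => i _.
rewrite (bigD1 i)//= [X in _ + X]big1 ?addr0 => [|j /andP[/eqP ji jni]].
  rewrite /S cE// eqxx /=; case: eqP => [->//|_].
  by have [ll _ _] := st (kap i); rewrite (lin0 ll) scale0r.
rewrite /S cE// eq_sym (negPf jni) /=.
by have [ll _ _] := st (kap i); rewrite (lin0 ll) scale0r.
Qed.

(** The extensions are those largest at b and at - b. If they agreed at b with value t, compressing
    the dominating elements of A by E would give t E - b >= 0 and b - t E >= 0, so b = t E. *)
Lemma nonscalar_corner_states l (b : B) : star b = b ->
  iota (e (kap l)) * b * iota (e (kap l)) = b -> (forall c, b <> c *: iota (e (kap l))) ->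
  exists psi psi', [/\ is_state psi, is_state psi',
    forall a, psi (iota a) = mps (e (kap l)) a,
    forall a, psi' (iota a) = mps (e (kap l)) a & psi b != psi' b].
Proof.
move=> bs bE bn; set k := kap l in bE bn *; pose E := iota (e k).
have mk := frame_minproj fr k; have [es ee] := frame_proj fr k.
have Es : star E = E by rewrite /E -(lrm_star hiota) es.
have EE : E * E = E by rewrite /E -lrmM ee.
have key x t : star x = x -> E * x * E = x ->
    (forall eps : R, 0 < eps -> exists a, [/\ star a = a, cpos (iota a - x) &
      complex.Re (mps (e k) a) < t + eps]) -> cpos (t%:C *: E - x).
  move=> xs xE H; apply: cpos_archi => eps e0; have [a [as_ ax lt]] := H eps e0.
  have := cpos_conj E ax; rewrite Es mulrBr mulrBl xE -!lrmM mpsE// lrmZ -/E => h1.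
  have aC : mps (e k) a = (complex.Re (mps (e k) a))%:C.
    have := state_sa (mps_state mk) as_; case: (mps _ a) => r i /= ->.
    by [].
  rewrite aC in h1; set r := complex.Re _ in h1 lt.
  (* The corner only yields eps E; the remaining eps (1 - E) is positive by itself. *)
  have -> : t%:C *: E - x + eps%:C *: 1 =
    (r%:C *: E - x) + (t + eps - r)%:C *: E + eps%:C *: (1 - E) by ncring.
  have Ep : cpos E by exists E; rewrite Es EE.
  apply: cposD; first by apply: cposD => //; apply: cposZr => //; lra.
  apply: cposZr; first exact: ltW.
  exists (1 - E); rewrite starB star1 Es mulrBl mul1r mulrBr mulr1 EE subrr subr0.
  by [].
have nbs : star (- b) = - b by rewrite starN bs.
have [psi [[st _] e1 H1]] := pure_extension hiota (mps_pure mk) bs.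
have [psi' [[st' _] e2 H2]] := pure_extension hiota (mps_pure mk) nbs.
exists psi, psi'; split=> //; apply/eqP => bb.
have h1 := key _ _ bs bE H1.
have h2 : cpos ((complex.Re (psi' (- b)))%:C *: E - (- b)).
  by apply: key => //; rewrite mulrN mulNr bE.
have [l' _ _] := st'; rewrite (linN l') -bb in h2.
apply: (bn (complex.Re (psi b))%:C); apply/eqP; rewrite eq_sym -subr_eq0; apply/eqP.
apply: cpos_antisym => //; move: h2; case: (psi b) => r i /=.
by congr cpos; rewrite -/E; ncring.
Qed.

Lemma two_cond_exp : ~ scalar_corners -> exists E E' l c t t',
  [/\ cond_exp E, cond_exp E', t != t', E c = t *: block_proj (kap l) &
      E' c = t' *: block_proj (kap l)].
Proof.
move=> /existsNP[l /existsNP[b0 nb0]]; pose P := iota (e (kap l)).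
have [es ee] := frame_proj fr (kap l).
have Ps : star P = P by rewrite /P -(lrm_star hiota) es.
have PP : P * P = P by rewrite /P -lrmM ee.
have [b [bs bE bn]] : exists b, [/\ star b = b, P * b * P = b & forall c, b <> c *: P].
  have [x [y [xs ys xy _]]] := star_real_imag b0.
  have [[c hc]|nx] := pselect (exists c, P * x * P = c *: P); last first.
    exists (P * x * P); split; first by rewrite !starM Ps xs mulrA.
      by rewrite !mulrA PP -!mulrA PP.
    by move=> c hc; apply: nx; exists c.
  exists (P * y * P); split; first by rewrite !starM Ps ys mulrA.
    by rewrite !mulrA PP -!mulrA PP.
  move=> c' hc'; apply: nb0; exists (c + 'i * c').
  by rewrite -/P xy mulrDr mulrDl hc -scalerAr -scalerAl hc' scalerDl scalerA.
have [psi [psi' [st st' e1 e2 neq]]] := nonscalar_corner_states bs bE bn.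
have s0 : star (0 : B) = 0 by exact: star0.
have [psi0 Hpsi0] := choice (fun k => pure_extension hiota (mps_pure (frame_minproj fr k)) s0).
(* The two families differ only at the block of l; the others share the extension [psi0]. *)
pose fam (p : B -> R[i]) k := if k == kap l then p else psi0 k.
have fam_st p : is_state p -> forall k, is_state (fam p k).
  by move=> sp k; rewrite /fam; case: eqP => // _; have [[]] := Hpsi0 k.
have fam_ext p : (forall a, p (iota a) = mps (e (kap l)) a) ->
    forall k a, fam p k (iota a) = mps (e k) a.
  by move=> ep k a; rewrite /fam; case: eqP => [->//|_]; have [] := Hpsi0 k.
have [E hE Ec] := cond_exp_of_states (fam_st _ st) (fam_ext _ e1).
have [E' hE' Ec'] := cond_exp_of_states (fam_st _ st') (fam_ext _ e2).
exists E, E', l, (\sum_(i | kap i == kap l) iota (u i) * b * star (iota (u i))).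
exists (psi b), (psi' b); split=> //.
  by rewrite Ec// /fam eqxx.
by rewrite Ec'// /fam eqxx.
Qed.

End ConditionalExpectations.

(** * The conditions against scalar corners *)

Section ScalarCorners.
Context {R : realType} {A B : cstarAlgType R} (iota : {lrmorphism A -> B}).
Hypothesis hiota : cstar_inclusion iota.
Context {N : nat} {u : 'I_N -> A} {kap : 'I_N -> 'I_N} {e : 'I_N -> A}.
Hypotheses (hA : finite_dim A) (fr : is_frame u kap e).

Local Notation H := (@scalar_corners R A B iota N kap e).
Local Notation p k := (@block_proj R A N u kap k).

Lemma block_proj_mul k i : p k * u i = if kap i == k then u i else 0.
Proof.
rewrite /block_proj mulr_suml big_mkcond (bigD1 i)//= [X in _ + X]big1 ?addr0 => [|j ji].
  by case: eqP => // _; rewrite -mulrA (frame_uu fr) (frame_ue fr).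
by case: ifP => // _; rewrite -mulrA (frame_orth fr)// mulr0.
Qed.

Lemma block_proj_star k : star (p k) = p k.
Proof. by rewrite /block_proj star_sum; apply: eq_bigr => i _; rewrite starM starK. Qed.

Lemma mul_block_proj k i : star (u i) * p k = if kap i == k then star (u i) else 0.
Proof.
apply: star_inj; rewrite starM starK block_proj_star block_proj_mul.
by case: ifP; rewrite ?starK ?star0.
Qed.

Lemma frame_ext (x y : A) : (forall i j, star (u i) * x * u j = star (u i) * y * u j) -> x = y.
Proof.
move=> h; rewrite (frame_expand fr x) (frame_expand fr y).
by apply: eq_bigr => i _; apply: eq_bigr => j _; rewrite h.
Qed.

Lemma block_proj_central k a : p k * a = a * p k.
Proof.
apply: frame_ext => i j; rewrite mulrA mul_block_proj -!mulrA block_proj_mul.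
have [ij|ij] := eqVneq (kap i) (kap j).
  by rewrite ij; case: eqP => _; rewrite ?mul0r ?mulr0// mulrA.
have h0 := frame_disj fr a ij; rewrite -mulrA in h0.
by case: eqP => _; case: eqP => _; rewrite ?mul0r ?mulr0// h0.
Qed.

Lemma block_proj_idem k : p k * p k = p k.
Proof.
rewrite {2}/block_proj mulr_sumr; apply: eq_bigr => i /eqP ik.
by rewrite mulrA block_proj_mul ik eqxx.
Qed.

Lemma block_proj_is_proj k : is_proj (p k).
Proof. by split; [exact: block_proj_star|exact: block_proj_idem]. Qed.

Lemma mps_block_proj l : mps (e (kap l)) (p (kap l)) = 1.
Proof.
apply: (mps_eq (frame_minproj fr _)); rewrite scale1r -{1}(frame_uu fr).
rewrite -[star _ * _ * _]mulrA -block_proj_central block_proj_mul eqxx (frame_uu fr).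
exact: (frame_proj fr _).2.
Qed.

Lemma block_proj_neq0 l : p (kap l) != 0.
Proof.
apply/eqP => p0; have := mps_block_proj l; rewrite p0.
have [ll _ _] := mps_state (frame_minproj fr (kap l)).
by rewrite (lin0 ll) => /eqP; rewrite eq_sym oner_eq0.
Qed.

Lemma unique_cond_exp_scalar_corners : unique_conditional_expectation iota -> H.
Proof.
move=> [E0 [_ uniq]]; apply: contrapT => /(two_cond_exp hiota hA fr).
move=> [E [E' [l [c [t [t' [hE hE' tt Ec E'c]]]]]]].
have EE : E = E' by rewrite -(uniq _ hE) -(uniq _ hE').
move: E'c; rewrite -EE Ec => /(scale_inj (block_proj_neq0 l)) /eqP.
by rewrite (negPf tt).
Qed.

Lemma scalar_corners_unique_cond_exp : H -> unique_conditional_expectation iota.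
Proof.
move=> h; have [E hE] := cond_exp_exists hiota hA; exists E; split=> // E' hE'.
exact: (cond_exp_unique hiota fr h).
Qed.

Lemma state_cond_exp (E : B -> A) phi : cond_exp iota E -> is_state phi -> is_state (phi \o E).
Proof.
move=> [Eucp Ea] [l pos phi1]; have [_ El E1 _] := Eucp; split=> [c x y|x px|] /=.
- by rewrite El// l.
- by apply: pos; exact: (ucp_cpos (@opsysT _ _) Eucp).
- by rewrite E1.
Qed.

Lemma AEP_scalar_corners : AEP iota -> H.
Proof.
move=> aep; apply: contrapT => /(two_cond_exp hiota hA fr).
move=> [E [E' [l [c [t [t' [hE hE' tt Ec E'c]]]]]]].
have pure := mps_pure (frame_minproj fr (kap l)).
pose U : set {ptws A -> R[i]^o} := [set phi | phi (p (kap l)) != 0].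
have : nbhs (mps (e (kap l)) : {ptws A -> R[i]^o}) U.
  have C := @proj_continuous A (fun=> R[i]^o) (p (kap l)) (mps (e (kap l))).
  apply: (C [set z : R[i]^o | z != 0]); rewrite /proj mps_block_proj.
  apply/nbhs_ballP; exists 1; first exact: ltr01.
  by move=> z zb; apply/eqP => z0; move: zb; rewrite z0 /ball /= subr0 normr1 ltxx.
move=> /(aep _ pure)[phi [[phi_pure phi_ext] phi0]].
have st := phi_pure.1; have [ll _ _] := st.
(* The composites phi o E and phi o E' are states that need not be pure. *)
have eqE := unique_pure_extension hiota phi_pure phi_ext (state_cond_exp hE st)
  (state_cond_exp hE' st) (fun a => congr1 phi (hE.2 a)) (fun a => congr1 phi (hE'.2 a)).
have := congr1 (@^~ c) eqE; rewrite /= Ec E'c !(linZ ll) => /eqP.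
rewrite -subr_eq0 -mulrBl mulf_eq0 subr_eq0 (negPf tt) /=.
by apply/negP.
Qed.

(** The sum of the u_i u_i^* is 1, so q u_i <> 0 for some i; a partial isometry then conjugates the
    corner of q into that of e (kap i). *)
Lemma scalar_corners_minproj q b : H -> minproj q ->
  exists c, iota q * b * iota q = c *: iota q.
Proof.
move=> h mq; have [[qs qq] q0 _] := mq.
have [i qi] : exists i, q * u i != 0.
  apply: contrapT => /forallNP no; move/eqP: q0; apply.
  rewrite -[q]mulr1 -(frame_sum fr) mulr_sumr big1// => i _.
  by have /negP/negPn/eqP := no i; rewrite mulrA => ->; rewrite mul0r.
have qi' : q * u i * e (kap i) != 0 by rewrite -mulrA (frame_ue fr).
have [w [qw we ww wws]] := minproj_partial_isometry mq (frame_minproj fr (kap i)) qi'.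
have [c hc] := h i (iota (star w) * b * iota w); exists c.
have ews : e (kap i) * star w = star w.
  by rewrite -[e _](frame_proj fr _).1 -starM we.
have E : iota (star w) * b * iota w = c *: iota (e (kap i)).
  by rewrite -hc !mulrA -lrmM ews -!mulrA -lrmM we.
rewrite -{1 2}wws !lrmM.
have -> : iota w * iota (star w) * b * (iota w * iota (star w)) =
   iota w * (iota (star w) * b * iota w) * iota (star w) by ncring.
by rewrite E -scalerAr -scalerAl -!lrmM we wws.
Qed.

(** For d <> 0 in D, d^* d has a nonzero spectral projection P at some z <> 0; z P <= d^* d puts P
    in D, and with it the minimal projections below P. *)
Lemma hereditary_minproj (D : set A) : hereditary_subalg D ->
  (exists2 d, D d & d <> 0) -> exists2 q, D q & minproj q.
Proof.
move=> [[_ [D0 Dlin] Dmul Dstar] Dher] [d0 Dd0 d00].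
have DZ c x : D x -> D (c *: x) by move=> Dx; have := Dlin c x 0 Dx D0; rewrite addr0.
pose h := star d0 * d0; have Dh : D h by apply: Dmul => //; exact: Dstar.
have hs : star h = h by rewrite /h starM starK.
have h0 : h <> 0 by move=> /starM_eq0.
have [r [P [ru Ps PP P1 hP]]] := cstar_spectral hA hs.
have Pproj z : z \in r -> is_proj (P z) by move=> zr; split=> //; rewrite PP// eqxx.
have hE : h = \sum_(z <- r) z%:C *: P z.
  by rewrite -[LHS]mulr1 -P1 mulr_sumr; apply: eq_big_seq => z zr; exact: hP.
have Pneg z : z \in r -> z < 0 -> P z = 0.
  move=> zr z0; apply/eqP/negPn/negP => Pn.
  have : cpos (z%:C *: P z).
    have -> : z%:C *: P z = star (P z) * h * P z.
      by rewrite Ps -mulrA hP// -scalerAr PP// eqxx.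
    by apply: cpos_conj; exists d0.
  move=> /(cpos_unscale (proj_cpos (Pproj z zr)) Pn).
  by rewrite ler0c leNgt z0.
have zPpos z : z \in r -> cpos (z%:C *: P z).
  move=> zr; have [z0|z0] := leP 0 z; last by rewrite Pneg// scaler0; exact: cpos0.
  by apply: cposZr => //; exact/proj_cpos/Pproj.
have [z [zr z0 Pz]] : exists z, [/\ z \in r, z != 0 & P z != 0].
  apply: contrapT => no; apply: h0; rewrite hE big1_seq// => z /andP[_ zr].
  have [->|z0] := eqVneq z 0; first by rewrite rmorph0 scale0r.
  have [->|Pz] := eqVneq (P z) 0; first by rewrite scaler0.
  by case: no; exists z.
have DPz : D (P z).
  have : D (z%:C *: P z).
    apply: (Dher _ h) => //; first exact: zPpos.
    rewrite hE (bigD1_seq z)//= addrAC subrr add0r.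
    rewrite big_seq_cond; apply: cpos_sum => w /andP[wr _]; exact: zPpos.
  move=> /(DZ (z%:C^-1)); rewrite scalerA mulVf ?scale1r//.
  by rewrite -(rmorph0 (real_complex R)) (inj_eq (@complexI R)).
have [M [q [qm qo qs]]] := minproj_decomp hA (Pproj z zr).
have [i _] : exists i : 'I_M, True.
  case: M q qm qo qs => [|M] q qm qo qs; last by exists ord0.
  by move: Pz; rewrite -qs big_ord0 eqxx.
exists (q i) => //; apply: (Dher _ (P z)) => //.
  by apply: proj_cpos; case: (qm i).
rewrite -qs (bigD1 i)//= addrAC subrr add0r.
by apply: cpos_sum => j _; apply: proj_cpos; case: (qm j).
Qed.

Lemma scalar_corners_aperiodic : H -> aperiodic iota.
Proof.
move=> h b D eps Dh Dn0 e0; have [q Dq qm] := hereditary_minproj Dh Dn0.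
have [c hc] := scalar_corners_minproj b h qm; have [[qs qq] q0 _] := qm.
exists q, (c *: q); split=> //; first exact: proj_cpos.
  have := cnorm_sa qs; rewrite qq expr2 => /eqP.
  rewrite -{1}[cnorm q]mulr1 -subr_eq0 -mulrBr mulf_eq0 cnorm_eq0 (negPf q0) /=.
  by rewrite subr_eq0 => /eqP.
by rewrite hc lrmZ subrr cnorm0.
Qed.

Lemma minproj_hereditary q : minproj q -> hereditary_subalg [set x : A | exists c, x = c *: q].
Proof.
move=> mq; have [[qs qq] q0 qc] := mq.
have Dq x : q * x * q = x -> exists c, x = c *: q.
  by move=> <-; exact: qc.
split; first split.
- move=> v l vD vl; apply: Dq; apply: (cnorm_cvg_unique _ vl).
  have vE n : q * v n * q = v n.
    by have [c ->] := vD n; rewrite -scalerAr -scalerAl !qq.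
  have := @cnorm_cvg_lin _ _ v l (fun x => q * x * q) (cnorm q * cnorm q) _ vl.
  under eq_fun do rewrite vE.
  apply=> x y; have -> : q * x * q - q * y * q = q * (x - y) * q by ncring.
  apply: le_trans (cnormM_le _ _) _; rewrite mulrAC ler_wpM2r ?cnorm_ge0//.
  exact: cnormM_le.
- split; first by exists 0; rewrite scale0r.
  by move=> c _ _ [x ->] [y ->]; exists (c * x + y); rewrite scalerDl scalerA.
- by move=> _ _ [x ->] [y ->]; exists (x * y); rewrite -scalerAl -scalerAr qq scalerA.
- by move=> _ [x ->]; exists (conjc x); rewrite starZc qs.
move=> a _ [c ->] [y ->] da.
(* Compressing c q - y^* y by 1 - q kills the first term, so minus the square of y (1 - q) is
   positive. *)
have z0 : y * (1 - q) = 0.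
  apply: starM_eq0; apply: cpos_antisym; first by exists (y * (1 - q)).
  have := cpos_conj (1 - q) da; congr cpos.
  have Q0 : q * (1 - q) = 0 by rewrite mulrBr mulr1 qq subrr.
  move: (1 - q) Q0 => w Q0.
  have -> : star w * (c *: q - star y * y) * w =
    c *: (star w * (q * w)) - (star w * star y) * (y * w) by ncring.
  by rewrite Q0 mulr0 scaler0 sub0r starM.
have yq : y * q = y.
  by apply/eqP; rewrite eq_sym -subr_eq0; move: z0; rewrite mulrBr mulr1 => ->.
apply: Dq; have qy : q * star y = star y by rewrite -{1}qs -starM yq.
by rewrite !mulrA qy -mulrA yq.
Qed.

(** The only positive element of norm 1 in C q is q, so q b q is a norm limit of elements of A. By
    completeness it lies in A, hence in q A q = C q. *)
Lemma aperiodic_scalar_corners : aperiodic iota -> H.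
Proof.
move=> ap i b; set q := e (kap i).
have mq : minproj q := frame_minproj fr (kap i); have [[qs qq] q0 qc] := mq.
have Q2 : iota q * iota q = iota q by rewrite -lrmM qq.
have close eps : 0 < eps -> exists a, cnorm (iota q * b * iota q - iota a) < eps.
  move=> e0; have [|d [a [[c dE] dpos d1 lt]]] := ap b _ eps (minproj_hereditary mq) _ e0.
    by exists q; [exists 1; rewrite scale1r|apply/eqP].
  exists a; suff dq : d = q by rewrite -dq.
  have q1 : cnorm q = 1.
    have := cnorm_sa qs; rewrite qq expr2 => /eqP.
    rewrite -{1}[cnorm q]mulr1 -subr_eq0 -mulrBr mulf_eq0 cnorm_eq0 (negPf q0) /=.
    by rewrite subr_eq0 => /eqP.
  have /complex_ge0P[] : 0 <= c.
    by apply: (cpos_unscale (proj_cpos (conj qs qq)) q0); rewrite -dE.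
  move: dE d1; case: c => t s dE d1 /= t0 s0; rewrite s0 in dE.
  move: d1; rewrite dE cnormZr q1 mulr1 ger0_norm// => ->.
  by rewrite scale1r.
set x := iota q * b * iota q.
have n0 n : 0 < n.+1%:R^-1 :> R by rewrite invr_gt0 ltr0n.
have [a ha] := choice (fun n => close _ (n0 n)).
have small eps : 0 < eps -> exists M, forall n, (M <= n)%N -> cnorm (x - iota (a n)) < eps.
  move=> e0; have e'0 : 0 <= eps^-1 by rewrite invr_ge0 ltW.
  exists (Num.bound eps^-1) => n Mn; apply: lt_trans (ha n) _.
  rewrite invf_plt ?posrE ?ltr0n//; apply: lt_le_trans (archi_boundP e'0) _.
  by rewrite ler_nat (leq_trans Mn).
have [|l al] := @cnorm_complete R A a.
  move=> eps e0; have [M HM] := small _ (divr_gt0 e0 (ltr0n _ 2)).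
  exists M => m n Mm Mn; rewrite -hiota.2 lrmB.
  have -> : iota (a m) - iota (a n) = (x - iota (a n)) - (x - iota (a m)) by ncring.
  have := cnormB_le (x - iota (a n)) (x - iota (a m)).
  by have := HM _ Mm; have := HM _ Mn; lra.
have xl : x = iota l.
  apply/eqP; rewrite -subr_eq0; apply/eqP/cnorm_small_eq0 => eps e0.
  have e20 : 0 < eps / 2 by lra.
  have [M HM] := small _ e20; have /cnorm_cvgP/(_ _ e20)[M' HM'] := al.
  have := HM _ (leq_maxl M M'); have := HM' _ (leq_maxr M M').
  set n := maxn M M'; rewrite -hiota.2 lrmB => h1 h2.
  have := cnormD_le (x - iota (a n)) (iota (a n) - iota l).
  by rewrite addrA subrK; lra.
have [c hc] := qc l; exists c; rewrite -/x -lrmZ -hc !lrmM -xl /x.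
by rewrite !mulrA Q2 -!mulrA Q2.
Qed.

Lemma frame_extB (x y : B) :
  (forall i j, star (iota (u i)) * x * iota (u j) = star (iota (u i)) * y * iota (u j)) -> x = y.
Proof.
move=> h; have F1 : \sum_i iota (u i) * star (iota (u i)) = 1.
  rewrite -(lrm1 iota) -(frame_sum fr) lrm_sum; apply: eq_bigr => i _.
  by rewrite lrmM (lrm_star hiota).
have E z : z = \sum_i \sum_j iota (u i) * (star (iota (u i)) * z * iota (u j)) * star (iota (u j)).
  rewrite -[LHS]mul1r -F1 mulr_suml; apply: eq_bigr => i _.
  rewrite -[LHS]mulr1 -F1 mulr_sumr; apply: eq_bigr => j _.
  by rewrite !mulrA.
by rewrite (E x) (E y); apply: eq_bigr => i _; apply: eq_bigr => j _; rewrite h.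
Qed.

Lemma relative_commutant_scalar_corners :
  relative_commutant iota = iota @` cstar_center A -> H.
Proof.
move=> rc l b; set k := kap l; set P := iota (e k); set b' := P * b * P.
have [es ee] := frame_proj fr k.
have PP : P * P = P by rewrite -lrmM ee.
have Pb : P * b' = b' by rewrite /b' !mulrA PP.
have bP : b' * P = b' by rewrite /b' -!mulrA PP.
move: b' Pb bP => {}b Pb bP.
pose c := \sum_(i | kap i == k) iota (u i) * b * star (iota (u i)).
have uc i : star (iota (u i)) * c = if kap i == k then b * star (iota (u i)) else 0.
  rewrite /c mulr_sumr big_mkcond (bigD1 i)//= [X in _ + X]big1 ?addr0 => [|j ji].
    case: eqP => // ik; rewrite !mulrA -!(lrm_star hiota) -lrmM (frame_uu fr) ik.
    by rewrite -/P Pb.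
  case: ifP => // _; rewrite !mulrA -!(lrm_star hiota) -lrmM.
  by rewrite (frame_orth fr) 1?eq_sym// lrm0 !mul0r.
have cu i : c * iota (u i) = if kap i == k then iota (u i) * b else 0.
  rewrite /c mulr_suml big_mkcond (bigD1 i)//= [X in _ + X]big1 ?addr0 => [|j ji].
    case: eqP => // ik; rewrite -!mulrA -!(lrm_star hiota) -lrmM (frame_uu fr) ik.
    by rewrite -/P bP.
  case: ifP => // _; rewrite -!mulrA -!(lrm_star hiota) -lrmM.
  by rewrite (frame_orth fr)// lrm0 !mulr0.
have : relative_commutant iota c.
  move=> a; apply: frame_extB => i j.
  have -> : star (iota (u i)) * (c * iota a) * iota (u j) =
    (star (iota (u i)) * c) * (iota a * iota (u j)) by rewrite !mulrA.
  have -> : star (iota (u i)) * (iota a * c) * iota (u j) =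
    (star (iota (u i)) * iota a) * (c * iota (u j)) by rewrite !mulrA.
  rewrite uc cu.
  have S : star (iota (u i)) * iota a * iota (u j) = iota (star (u i) * a * u j).
    by rewrite -(lrm_star hiota) !lrmM.
  have [ij|ij] := eqVneq (kap i) (kap j); last first.
    have h0 : star (iota (u i)) * iota a * iota (u j) = 0 by rewrite S (frame_disj fr)// lrm0.
    transitivity (0 : B).
      by case: ifP => _; rewrite ?mul0r// -mulrA (mulrA (star _)) h0 mulr0.
    by case: ifP => _; rewrite ?mulr0// mulrA h0 mul0r.
  rewrite -ij; case: eqP => ik; last by rewrite mul0r mulr0.
  rewrite -(mulrA b) (mulrA (star _)) (mulrA _ _ b) S (frame_coef fr)// ik lrmZ -/P.
  by rewrite -scalerAr -scalerAl bP Pb.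
rewrite rc => -[z _ zc].
exists (mps (e k) (star (u l) * z * u l)).
have <- : star (iota (u l)) * c * iota (u l) = b.
  by rewrite uc eqxx -mulrA -(lrm_star hiota) -lrmM (frame_uu fr) bP.
by rewrite -zc -(lrm_star hiota) -!lrmM {1}(frame_coef fr)// lrmZ.
Qed.

(** If b commutes with A, inserting 1 = sum u_i u_i^* gives b = sum u_i (e b e) u_i^* with e = e
    (kap i), which lies in A. *)
Lemma scalar_corners_relative_commutant :
  H -> relative_commutant iota = iota @` cstar_center A.
Proof.
move=> h; apply/seteqP; split=> [b bc|_ [z zc <-] a]; last by rewrite -!lrmM zc.
have [c hc] := choice (fun i => h i b).
pose z := \sum_i c i *: (u i * star (u i)).
have zb : iota z = b.
  have F1 : \sum_i iota (u i) * star (iota (u i)) = 1.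
    rewrite -(lrm1 iota) -(frame_sum fr) lrm_sum; apply: eq_bigr => i _.
    by rewrite lrmM (lrm_star hiota).
  rewrite -[RHS]mulr1 -F1 mulr_sumr lrm_sum; apply: eq_bigr => i _.
  have Pu : iota (u i) * iota (e (kap i)) = iota (u i) by rewrite -lrmM (frame_ue fr).
  have uP : iota (e (kap i)) * star (iota (u i)) = star (iota (u i)).
    by rewrite -(lrm_star hiota) -lrmM (frame_eu fr).
  have -> : b * (iota (u i) * star (iota (u i))) =
      iota (u i) * (iota (e (kap i)) * b * iota (e (kap i))) * star (iota (u i)).
    by rewrite -!mulrA uP (mulrA (iota (u i)) (iota (e _))) Pu !mulrA bc.
  by rewrite hc -scalerAr Pu -scalerAl lrmZ lrmM (lrm_star hiota).
by exists z => // a; apply: (lrm_inj hiota); rewrite !lrmM zb bc.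
Qed.

(** For x0 <> 0 in e B f, x0 x0^* is a nonzero multiple of e, so any y in e B f is a multiple of x0
    (x0^* y); and x0^* y lies in f B f = C f. *)
Lemma scalar_corners_finite_dim : H -> finite_dim B.
Proof.
move=> h; have corner i j : exists w, forall b, exists c,
    star (iota (u i)) * b * iota (u j) = c *: w.
  have [[b0 b0n]|no] := pselect (exists b, star (iota (u i)) * b * iota (u j) <> 0); last first.
    exists 0 => b; exists 0; rewrite scaler0; apply: contrapT => hb; apply: no.
    by exists b.
  set x0 := star (iota (u i)) * b0 * iota (u j) in b0n.
  pose Pi := iota (e (kap i)); pose Pj := iota (e (kap j)).
  have Pu l : iota (u l) * iota (e (kap l)) = iota (u l) by rewrite -lrmM (frame_ue fr).
  have uP l : iota (e (kap l)) * star (iota (u l)) = star (iota (u l)).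
    by rewrite -(lrm_star hiota) -lrmM (frame_eu fr).
  have Pis : star Pi = Pi by rewrite /Pi -(lrm_star hiota) (frame_proj fr _).1.
  have Pjs : star Pj = Pj by rewrite /Pj -(lrm_star hiota) (frame_proj fr _).1.
  have Px b : Pi * (star (iota (u i)) * b * iota (u j)) = star (iota (u i)) * b * iota (u j).
    by rewrite !mulrA uP.
  have xP b : star (iota (u i)) * b * iota (u j) * Pj = star (iota (u i)) * b * iota (u j).
    by rewrite -!mulrA Pu.
  have sxP : star x0 * Pi = star x0 by rewrite -{1}Pis -starM Px.
  have Psx : Pj * star x0 = star x0 by rewrite -{1}Pjs -starM xP.
  have [c' hc'] := h i (x0 * star x0).
  have xx : x0 * star x0 = c' *: Pi by rewrite -hc' -/Pi mulrA Px -mulrA sxP.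
  have c'0 : c' != 0.
    apply/eqP => c0; apply: b0n; apply: star_inj; rewrite star0; apply: starM_eq0.
    by rewrite starK xx c0 scale0r.
  exists x0 => b; set y := star (iota (u i)) * b * iota (u j).
  have [d hd] := h j (star x0 * y); exists (c'^-1 * d).
  have yy : star x0 * y = d *: Pj by rewrite -hd -/Pj mulrA Psx -mulrA xP.
  have -> : y = c'^-1 *: (x0 * star x0 * y) by rewrite xx -scalerAl Px scalerA mulVf// scale1r.
  by rewrite -mulrA yy -scalerAr xP scalerA.
have [w hw] := choice (fun ij : 'I_N * 'I_N => corner ij.1 ij.2).
apply: (@finite_dim_fin _ _ ('I_N * 'I_N)%type
  (fun ij => iota (u ij.1) * w ij * star (iota (u ij.2)))) => b.
have [c hc] := choice (fun ij => hw ij b); exists c.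
have F1 : \sum_i iota (u i) * star (iota (u i)) = 1.
  rewrite -(lrm1 iota) -(frame_sum fr) lrm_sum; apply: eq_bigr => l _.
  by rewrite lrmM (lrm_star hiota).
transitivity (\sum_i \sum_j c (i, j) *: (iota (u i) * w (i, j) * star (iota (u j)))); last first.
  by rewrite pair_bigA /=; apply: eq_bigr => -[].
rewrite -[LHS]mul1r -F1 mulr_suml.
apply: eq_bigr => i _; rewrite -[LHS]mulr1 -F1 mulr_sumr; apply: eq_bigr => j _.
by rewrite scalerAl scalerAr -(hc (i, j)) !mulrA.
Qed.

(** A pure state takes the value 1 at the unit q of a block. Every extension is then determined on q
    B q, which scalar corners place in A. *)
Lemma scalar_corners_PEP : H -> PEP iota.
Proof.
move=> h phi pure; have [st ext] := pure; have [l pos phi1] := st.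
have [i phi_i] : exists i, phi (u i * star (u i)) != 0.
  apply: contrapT => /forallNP no; move/eqP: (phi1); rewrite -(frame_sum fr) (lin_sum l).
  rewrite big1 ?(eq_sym 0) ?oner_eq0// => i _.
  by have /negP/negPn/eqP := no i.
pose k := kap i; pose q := p k.
have qproj : is_proj q := block_proj_is_proj k; have [qs qq] := qproj.
have [/andP[t0 t1] tI] := state_le1 st qs qq.
pose t := complex.Re (phi q); have tE : phi q = t%:C.
  by rewrite /t; case: (phi q) tI => r s /= ->.
have tpos : 0 < t.
  have /complex_ge0P[a1 a2] : 0 <= phi (u i * star (u i)).
    by apply: pos; exists (star (u i)); rewrite starK.
  have : 0 <= phi (q - u i * star (u i)).
    apply: pos; rewrite /q /block_proj (bigD1 i)//= addrAC subrr add0r.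
    by apply: cpos_sum => j _; exists (star (u j)); rewrite starK.
  rewrite (linB l) tE => /complex_ge0P[].
  move: phi_i a1 a2; case: (phi (u i * _)) => r s; rewrite eq_complex /= => rs r0 s0.
  move: rs; rewrite s0 eqxx andbT => rn; rewrite subr_ge0 => rt _.
  by apply: lt_le_trans rt; rewrite lt_neqAle eq_sym rn.
(* If 0 < t < 1, phi is a proper convex combination of its normalised restrictions to q A and (1 -
   q) A; purity identifies phi with the first, whose value at q is 1. *)
have phiq : phi q = 1.
  rewrite tE; suff -> : t = 1 by [].
  apply/eqP/negPn/negP => tn1; have tlt : t < 1 by rewrite lt_neqAle tn1 -/t.
  have comp r : is_proj r -> (forall a, r * a = a * r) -> forall s : R, 0 < s ->
      phi r = s%:C -> is_state (fun a => s^-1%:C * phi (r * a)).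
    move=> [rs rr] rc s s0 rE; split.
    - move=> c x y; rewrite mulrDr -scalerAr (linD l) (linZ l) mulrDr.
      by rewrite -[c *: _]/(c * _) mulrCA.
    - move=> x [y ->]; apply: mulr_ge0; first by rewrite ler0c invr_ge0 ltW.
      apply: pos; exists (y * r); rewrite starM rs -!mulrA -{1}rr -mulrA; congr (_ * _).
      by rewrite rc !mulrA.
    - by rewrite mulr1 rE -rmorphM mulVf ?gt_eqF.
  have r1 : is_proj (1 - q).
    by apply: projB => //; [split; rewrite ?star1 ?mulr1|rewrite mul1r].
  have st1 := comp q qproj (block_proj_central k) t tpos tE.
  have t1' : 0 < 1 - t by lra.
  have st2 : is_state (fun a => (1 - t)^-1%:C * phi ((1 - q) * a)).
    apply: comp => //; first by move=> a; rewrite mulrBl mulrBr mul1r mulr1 block_proj_central.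
    by rewrite (linB l) phi1 tE rmorphB.
  have [|x|h1 _] := ext _ _ t st1 st2.
  - by rewrite tpos.
  - rewrite !mulrA -!rmorphM !divff ?gt_eqF// !mul1r -(linD l).
    by rewrite -mulrDl addrC subrK mul1r.
  have := congr1 (@^~ q) h1; rewrite /= qq tE -rmorphM mulVf ?gt_eqF// => /complexI t1E.
  by rewrite -t1E eqxx in tn1.
have comp (b : B) : exists a, iota q * b * iota q = iota a.
  have C (ij : 'I_N * 'I_N) : exists c, (kap ij.1 == k) && (kap ij.2 == k) ->
      star (iota (u ij.1)) * b * iota (u ij.2) = c *: iota (e k).
    have [/andP[/eqP ik /eqP jk]|no] := boolP ((kap ij.1 == k) && (kap ij.2 == k)); last by exists 0.
    by have [c hc] := scalar_corners_coef hiota fr h b (etrans ik (esym jk)); exists c; rewrite hc ik.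
  have [c hc] := choice C.
  exists (\sum_(i' | kap i' == k) \sum_(j' | kap j' == k) c (i', j') *: (u i' * star (u j'))).
  rewrite /q /block_proj !lrm_sum !mulr_suml; apply: eq_bigr => i' ik.
  rewrite mulr_sumr lrm_sum; apply: eq_bigr => j' jk.
  rewrite lrmZ !lrmM !(lrm_star hiota) !mulrA -(mulrA (iota (u i'))) -(mulrA (iota (u i'))).
  rewrite (hc (i', j')) /= ?ik ?jk// -scalerAr -scalerAl -lrmM.
  by rewrite -(eqP ik) (frame_ue fr).
have [psi [psi_pure psi_ext _]] := pure_extension hiota pure (star0 : star (0 : B) = 0).
exists psi; split=> // psi' [psi'_pure psi'_ext]; apply/funext => b.
have key f : pure_state f -> (forall a, f (iota a) = phi a) -> f b = f (iota q * b * iota q).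
  move=> [fst _] fe; apply: state_compress => //.
  - by rewrite -(lrm_star hiota) qs.
  - by rewrite -lrmM qq.
  - by rewrite fe.
by rewrite (key psi)// (key psi')//; have [a ->] := comp b; rewrite psi_ext psi'_ext.
Qed.

End ScalarCorners.

(** * Pseudo-expectations *)

Section PseudoExpectations.
Context {R : realType} {A B : cstarAlgType R} (iota : {lrmorphism A -> B}).
Hypotheses (hiota : cstar_inclusion iota) (hA : finite_dim A).

Lemma unique_cond_exp_pseudo :
  unique_conditional_expectation iota -> unique_pseudo_expectation iota.
Proof.
move=> uce; exists A, idfun; split; last exact: uce.
split=> //; first exact: finite_dim_injective.
by move=> V AV _; apply/seteqP; split=> // a _; apply: AV; exists a.
Qed.

(** The range of j is injective: extend a map in IA, then apply j o E with E an expectation of IA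
    onto A. Minimality of the envelope concludes. *)
Lemma injective_envelope_surj (IA : cstarAlgType R) (j : {lrmorphism A -> IA}) :
  injective_envelope j -> range j = [set: IA].
Proof.
move=> [hj [_ IAinj] IAmin]; apply: IAmin => //.
have [E [[_ El E1 Ecp] Ej]] := cond_exp_exists hj hA.
split.
  split; first by exists 1; rewrite ?lrm1.
    by move=> c _ _ [x _ <-] [y _ <-]; exists (c *: x + y); rewrite // lrmD lrmZ.
  by move=> _ [x _ <-]; exists (star x); rewrite // (lrm_star hj).
move=> C V W f Vop Wop VW [fV fl f1 fcp].
have fucp : ucp V [set: IA] f by [].
have [g [[_ gl g1 gcp] gf]] := IAinj C V W f Vop Wop VW fucp.
exists (fun x => j (E (g x))); split; last first.
  by move=> v Vv; rewrite gf//; have [a _ <-] := fV v Vv; rewrite Ej.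
split.
- by move=> x _; exists (E (g x)).
- by move=> c x y Wx Wy; rewrite gl// El// lrmD lrmZ.
- by rewrite g1 E1 lrm1.
- move=> n M VM Mpos.
  have [Y YE] := Ecp _ _ (fun _ _ => I) (gcp n M VM Mpos).
  exists (map_mx j Y); apply/matrixP => a b.
  have := congr1 (fun M : 'M[A]_n => j (M a b)) YE; rewrite !mxE lrm_sum => ->.
  by apply: eq_bigr => r _; rewrite !mxE lrmM (lrm_star hj).
Qed.

(** With E an expectation of IA onto A, E o Psi is one of B. Any E' gives the pseudo-expectation j o
    E', which is Psi, and E undoes j. *)
Lemma unique_pseudo_cond_exp :
  unique_pseudo_expectation iota -> unique_conditional_expectation iota.
Proof.
move=> [IA [j [env [Psi [[[_ Pl P1 Pcp] Pj] uniq]]]]].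
have jsurj := injective_envelope_surj env; have [hj _ _] := env.
have [E [[_ El E1 Ecp] Ej]] := cond_exp_exists hj hA.
exists (fun b => E (Psi b)); split.
  split; last by move=> a; rewrite Pj Ej.
  split=> //.
  - by move=> c x y _ _; rewrite Pl// El.
  - by rewrite P1 E1.
  - move=> n M _ Mpos; have := Ecp _ _ (fun _ _ => I) (Pcp n M (fun _ _ => I) Mpos).
    by congr mxpos; apply/matrixP => a b; rewrite !mxE.
move=> E' [[_ E'l E'1 E'cp] E'a].
suff -> : Psi = (fun b => j (E' b)) by apply/funext => b; rewrite Ej.
apply: uniq; split; last by move=> a; rewrite E'a.
split=> //.
- by move=> c x y _ _; rewrite E'l// lrmD lrmZ.
- by rewrite E'1 lrm1.
- move=> n M _ Mpos; have [Y YE] := E'cp n M (fun _ _ => I) Mpos.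
  exists (map_mx j Y); apply/matrixP => a b.
  have := congr1 (fun M : 'M[A]_n => j (M a b)) YE; rewrite !mxE lrm_sum => ->.
  by apply: eq_bigr => r _; rewrite !mxE lrmM (lrm_star hj).
Qed.

End PseudoExpectations.

Theorem theorem2p4 (R : realType) (A B : cstarAlgType R)
    (iota : {lrmorphism A -> B}) (hiota : cstar_inclusion iota)
    (hA : finite_dim A) :
  [<-> PEP iota;
       AEP iota;
       aperiodic iota;
       unique_pseudo_expectation iota;
       unique_conditional_expectation iota;
       relative_commutant iota = iota @` cstar_center A]
  /\ (~ finite_dim B ->
      ~ PEP iota /\
      ~ AEP iota /\
      ~ aperiodic iota /\
      ~ unique_pseudo_expectation iota /\
      ~ unique_conditional_expectation iota /\
      ~ (relative_commutant iota = iota @` cstar_center A)).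
Proof.
have [N [u [kap [e fr]]]] := frame_exists hA.
have PA : PEP iota -> AEP iota.
  by move=> pep phi pure; apply: subset_closure; split=> //; exact: pep.
have hAEP := AEP_scalar_corners hiota hA fr.
have haper := aperiodic_scalar_corners hiota fr.
have hce := unique_cond_exp_scalar_corners hiota hA fr.
have hce' := scalar_corners_unique_cond_exp hiota hA fr.
have hpe := @unique_pseudo_cond_exp _ _ _ iota hA.
have hrc := relative_commutant_scalar_corners hiota fr.
have hfd := scalar_corners_finite_dim hiota fr.
split.
  (* The cycle follows the listed order; except for (i) to (ii) and (iv) to (v), every arrow passes
     through scalar corners. *)
  tfae.
  - exact: PA.
  - by move=> /hAEP; exact: (scalar_corners_aperiodic hA fr).
  - by move=> /haper/hce'; exact: (unique_cond_exp_pseudo hA).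
  - exact: hpe.
  - by move=> /hce; exact: (scalar_corners_relative_commutant hiota fr).
  - by move=> /hrc; exact: (scalar_corners_PEP hiota fr).
move=> Binf; do !split; move=> h; apply: Binf; apply: hfd.
- exact/hAEP/PA.
- exact: hAEP.
- exact: haper.
- exact/hce/hpe.
- exact: hce.
- exact: hrc.
Qed.
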